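(* Let $\mathbb P\neq\mathbb Q$ be Gaussian probability measures on $\mathbb R^d$, $\mathbb P=N(\mu,\Sigma)$, $\mathbb Q=N(\nu,\Xi)$, with $\Sigma$ and $\Xi$ of full rank. Let $n\in\mathbb N$ and $m=m(n)\in\mathbb N$ be such that $n/m(n)\to a/(1-a)$ as $n\to\infty$ for some $a\in(0,1)$. Let $X_1,\dots,X_n$ be i.i.d. with law $\mathbb P$ and $Y_1,\dots,Y_m$ be i.i.d. with law $\mathbb Q$, the two samples being independent of each other. Let $\widehat{\mathcal{GW}}_{n,m}=\mathcal W_2^2\big(N(\hat\mu_n,\hat\Sigma_n),N(\hat\nu_m,\hat\Xi_m)\big)$ and $\mathcal{GW}=\mathcal W_2^2(\mathbb P,\mathbb Q)$. Then, as $n\to\infty$, $$\sqrt{\frac{mn}{m+n}}\,\big(\widehat{\mathcal{GW}}_{n,m}-\mathcal{GW}\big)\Rightarrow N(0,\varpi^2),$$ where $$\begin{aligned}\varpi^2={}&4(\nu-\mu)^t\big((1-a)\Sigma+a\Xi\big)(\nu-\mu)+2\,\mathrm{tr}\big((1-a)\Sigma^2+a\Xi^2\big)+2\,\mathrm{tr}(\Sigma\Xi)\\&-4\sum_{k=1}^d\kappa_k^{1/2}q_k^t\big((1-a)\Sigma+a\,\Sigma^{-1/2}\Xi\,\Sigma^{1/2}\big)q_k\\&-2(1-a)\sum_{k,l=1}^d\kappa_l^{1/2}\kappa_k^{1/2}\sum_{i=1}^d\ \sum_{\substack{j=1\\ j\neq i,\ \lambda_i=\lambda_j}}^d (q_l^tp_i)(p_i^tq_k)(q_l^tp_j)(p_j^tq_k).\end{aligned}$$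 Here $\{(\kappa_l,q_l):l=1,\dots,d\}$ is the eigendecomposition of the symmetric matrix $\Sigma^{1/2}\Xi\Sigma^{1/2}$ into orthonormal eigenpairs (eigenvalues and eigenvectors), and $\{(\lambda_l,p_l):l=1,\dots,d\}$ is the eigendecomposition of $\Sigma$ into orthonormal eigenpairs.
   Context: $\mathcal W_2$ is the 2-Wasserstein distance on $\mathbb R^d$: $\mathcal W_2^2(\mathbb P,\mathbb Q)=\inf_{\pi}\int\|x-y\|^2\,\pi(dx,dy)$, the infimum over all couplings $\pi$ of $\mathbb P$ and $\mathbb Q$, with $\|\cdot\|$ the Euclidean norm. For Gaussians it is known that $\mathcal W_2^2(N(\mu,\Sigma),N(\nu,\Xi))=\|\mu-\nu\|^2+\mathrm{tr}(\Sigma)+\mathrm{tr}(\Xi)-2\,\mathrm{tr}\big[(\Sigma^{1/2}\Xi\Sigma^{1/2})^{1/2}\big]$. Square roots of symmetric nonnegative definite matrices are the spectral ones. Empirical means and covariances: $\hat\mu_n=\frac1n\sum_{i=1}^nX_i$, $\hat\Sigma_n=\frac1{n-1}\sum_{i=1}^n(X_i-\hat\mu_n)(X_i-\hat\mu_n)^t$, $\hat\nu_m=\frac1m\sum_{i=1}^mY_i$, $\hat\Xi_m=\frac1{m-1}\sum_{i=1}^m(Y_i-\hat\nu_m)(Y_i-\hat\nu_m)^t$. The symbol $\Rightarrow$ denotes weak convergence (convergence in law); ${}^t$ denotes transpose.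
   Formalization: If Σ has a multiple eigenvalue, the last sum depends on the chosen eigenvectors p_i and the claim fails for some choices; the formal theorem asserts the limit for some orthonormal eigenbasis of Σ, agreeing with any given one at simple eigenvalues. *)

(* Defs.v *)
From HB Require Import structures.
From mathcomp Require Import all_boot all_order all_algebra.
From mathcomp Require Import all_classical all_reals all_analysis.
From mathcomp Require Import measurable_realfun giry.

Set Implicit Arguments.
Unset Strict Implicit.
Unset Printing Implicit Defensive.

Import Order.TTheory GRing.Theory Num.Theory.
Import numFieldNormedType.Exports.

Local Open Scope classical_set_scope.
Local Open Scope ring_scope.

(* The sigma-algebra on R^d generated by the coordinate maps, i.e. the Borel
   one, as for the tuples and products of the library. *)
Definition vec_display : measure_display.
Proof. by constructor. Qed.

Definition coords {R : realType} {d : nat} (i : 'I_d) (v : 'cV[R]_d) : R :=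
  v i 0.

Section vec_measurable.
Context {R : realType} {d : nat}.

Let vec_set0 : g_sigma_preimage (@coords R d) set0.
Proof. exact: sigma_algebra0. Qed.

Let vec_setC A : g_sigma_preimage (@coords R d) A ->
  g_sigma_preimage (@coords R d) (~` A).
Proof. exact: sigma_algebraC. Qed.

Let vec_bigcup (F : (set 'cV[R]_d)^nat) :
  (forall i, g_sigma_preimage (@coords R d) (F i)) ->
  g_sigma_preimage (@coords R d) (\bigcup_i (F i)).
Proof. exact: sigma_algebra_bigcup. Qed.

HB.instance Definition _ := @isMeasurable.Build vec_display 'cV[R]_d
  (g_sigma_preimage (@coords R d)) vec_set0 vec_setC vec_bigcup.

End vec_measurable.

Lemma measurable_fun_vec {R : realType} {d : nat} {dT : measure_display}
    {T : measurableType dT} (f : T -> 'cV[R]_d) :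
  (forall i, measurable_fun setT (fun x => f x i 0)) -> measurable_fun setT f.
Proof.
move=> mf.
pose G := \big[setU/set0]_(i < d)
  preimage_set_system setT (@coords R d i) measurable.
have mG A : G A -> measurable (f @^-1` A).
  rewrite /G; elim/big_ind : _ => [//|U V hU hV|i _]; first by case=> [/hU|/hV].
  by move=> [B mB <-]; rewrite setTI -[X in measurable X]setTI; exact: (mf i).
apply: (@measurability _ _ _ _ _ f G) => // _ [A GA <-].
by rewrite setTI; exact: mG.
Qed.

Section eigen.
Context {R : realType} {d : nat}.
Implicit Types A S : 'M[R]_d.

Definition psdmx A := A^T = A /\ forall x : 'cV[R]_d, 0 <= (x^T *m A *m x) 0 0.

Definition eigendecomp A (l : 'I_d -> R) (p : 'I_d -> 'cV[R]_d) :=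
  (forall i, A *m p i = l i *: p i) /\
  (forall i j, ((p i)^T *m p j) 0 0 = (i == j)%:R).

(* The value does not depend on the decomposition; 0 if there is none (i.e. if
   A is not symmetric). *)
Definition sqrtmx A : 'M[R]_d :=
  xget 0 [set S | exists l p, eigendecomp A l p /\
                  S = \sum_i Num.sqrt (l i) *: (p i *m (p i)^T)].

End eigen.

Section gaussian.
Context {R : realType}.
Local Notation mR := (measurableTypeR R).

Section cons_map.
Variable d : nat.
Definition cons_pair (x : mR * d.-tuple mR) : d.+1.-tuple mR :=
  [the d.+1.-tuple mR of x.1 :: x.2].
Let measurable_cons_pair : measurable_fun setT cons_pair.
Proof. by apply: measurable_cons; [exact: measurable_fst|exact: measurable_snd]. Qed.
HB.instance Definition _ := isMeasurableFun.Build _ _ _ _ cons_pair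
  measurable_cons_pair.
End cons_map.

(* Law of d independent N(0, 1) variables. *)
Fixpoint std_normal (d : nat) : probability (d.-tuple mR) R :=
  match d with
  | 0 => dirac [tuple]
  | d'.+1 => distribution (normal_prob 0 1 \x std_normal d')%E (@cons_pair d')
  end.

Section affine_map.
Context {d : nat} (mu : 'cV[R]_d) (S : 'M[R]_d).
Definition affine (z : d.-tuple mR) : 'cV[R]_d := mu + S *m \col_i tnth z i.
Let measurable_affine : measurable_fun setT affine.
Proof.
apply: measurable_fun_vec => i.
rewrite (_ : (fun x => _) =
    (fun z : d.-tuple mR => mu i 0 + \sum_(j < d) S i j * tnth z j)).
  apply: measurable_funD => //; apply: measurable_sum => j.
  by apply: measurable_funM => //; exact: measurable_tnth.
by apply/funext => z; rewrite !mxE; under eq_bigr do rewrite mxE.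
Qed.
HB.instance Definition _ := isMeasurableFun.Build _ _ _ _ affine
  measurable_affine.
End affine_map.

(* N(mu, Sigma) is the law of mu + Sigma^(1/2) Z with Z standard normal;
   Sigma may be singular, as an empirical covariance matrix may be. *)
Definition gauss {d} (mu : 'cV[R]_d) (Sigma : 'M[R]_d) :
    probability 'cV[R]_d R :=
  distribution (std_normal d) (affine mu (sqrtmx Sigma)).

End gaussian.

Section wasserstein.
Context {R : realType} {d : nat}.

Definition sqnorm (x : 'cV[R]_d) : R := \sum_i x i 0 ^+ 2.

Definition couplings (P Q : probability 'cV[R]_d R) :
    set (probability ('cV[R]_d * 'cV[R]_d)%type R) :=
  [set pi | forall A, measurable A ->
              pi (A `*` setT) = P A /\ pi (setT `*` A) = Q A].

Definition W2sq (P Q : probability 'cV[R]_d R) : \bar R :=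
  ereal_inf [set (\int[pi]_z (sqnorm (z.1 - z.2))%:E)%E | pi in couplings P Q].

End wasserstein.

Section sample.
Context {R : realType} {d n : nat}.
Implicit Types x : 'I_n -> 'cV[R]_d.

Definition smean x : 'cV[R]_d := n%:R^-1 *: \sum_i x i.

Definition scov x : 'M[R]_d :=
  n.-1%:R^-1 *: \sum_i (x i - smean x) *m (x i - smean x)^T.

End sample.

Section independence.
Context {R : realType} {dT dU : measure_display}.
Context {T : measurableType dT} {U : measurableType dU}.
Variable Pr : probability T R.

Definition mutually_independent {n} (X : 'I_n -> T -> U) :=
  forall (J : {set 'I_n}) (B : 'I_n -> set U), (forall i, measurable (B i)) ->
    Pr [set w | forall i, i \in J -> B i (X i w)] =
    (\prod_(i in J) Pr (X i @^-1` B i))%E.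

Definition iid {n} (X : 'I_n -> {RV Pr >-> U}) (P : probability U R) :=
  mutually_independent X /\
  forall i, measure_eq (distribution Pr (X i)) P.

Definition independent_samples {n m} (X : 'I_n -> T -> U) (Y : 'I_m -> T -> U) :=
  forall A B, g_sigma_preimage X A -> g_sigma_preimage Y B ->
    Pr (A `&` B) = (Pr A * Pr B)%E.

End independence.

(* Weak convergence to nu of the laws of the Z n, each of which may live on a
   probability space of its own. *)
Definition cvg_in_law {R : realType} {dT : nat -> measure_display}
    {T : forall n, measurableType (dT n)} (Pr : forall n, probability (T n) R)
    (Z : forall n, T n -> R) (nu : probability (measurableTypeR R) R) :=
  (forall n, measurable_fun setT (Z n)) /\
  forall f : R -> R, continuous f -> bounded_fun f ->
    (\int[Pr n]_w (f (Z n w))%:E)%E @[n --> \oo] --> (\int[nu]_x (f x)%:E)%E.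

Section asymptotic_variance.
Context {R : realType} {d : nat}.

(* The last sum is 2 (1 - a) sum_(i <> j, lambda_i = lambda_j) (p_i^T K p_j)^2,
   where K is the matrix with eigenpairs (kappa_k^(1/2), q_k): it does not depend
   on q, but it does depend on the basis p_i chosen in each eigenspace of Sigma
   of dimension at least 2. *)
Definition varpi2 (a : R) (mu nu : 'cV[R]_d) (Sigma Xi : 'M[R]_d)
    (kappa : 'I_d -> R) (q : 'I_d -> 'cV[R]_d)
    (lambda : 'I_d -> R) (p : 'I_d -> 'cV[R]_d) : R :=
  let dot (x y : 'cV[R]_d) := (x^T *m y) 0 0 in
  let S := sqrtmx Sigma in
  4 * dot (nu - mu) (((1 - a) *: Sigma + a *: Xi) *m (nu - mu))
  + 2 * \tr ((1 - a) *: (Sigma *m Sigma) + a *: (Xi *m Xi))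
  + 2 * \tr (Sigma *m Xi)
  - 4 * \sum_k Num.sqrt (kappa k) *
      dot (q k) (((1 - a) *: Sigma + a *: (invmx S *m Xi *m S)) *m q k)
  - 2 * (1 - a) * \sum_k \sum_l Num.sqrt (kappa l) * Num.sqrt (kappa k) *
      \sum_i \sum_(j | (j != i) && (lambda i == lambda j))
        dot (q l) (p i) * dot (p i) (q k) * dot (q l) (p j) * dot (p j) (q k).

End asymptotic_variance.

(* Main.v *)
(* Young's inequality 2 x.y <= x.Ax + y.A^-1 y, for A positive definite, bounds the cost of
   every coupling from below, and its infimum over A is the formula for W_2^2 between
   Gaussians, attained by a linear image of a standard Gaussian vector.  The same duality,
   tested with the optimal transport map T of (Sigma, Xi) and with the map of the empirical
   covariances, which is Lipschitz in them, gives the derivative of the fidelity term: it is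
   H |-> tr(T H) in Sigma and H |-> tr(T^-1 H) in Xi, with a quadratic remainder.  Hence the
   centred statistic is a sum of two empirical means of influence functions, quadratic in the
   observations, up to a term of order 1/n in probability.  Their central limit theorem is
   obtained by Lindeberg replacement, for Lipschitz test functions smoothed by a small
   Gaussian noise; monotone approximation of a continuous function by inf-convolutions then
   gives convergence in law.  The variances of the influence functions are computed from the
   first four Gaussian moments.  The limit variance agrees with varpi2 once the eigenvectors p
   diagonalise K = (Sigma^1/2 Xi Sigma^1/2)^1/2 on each eigenspace of Sigma: the last sum in
   varpi2, which depends on p, is then zero. *)

From HB Require Import structures.
Require Import Defs.
From mathcomp Require Import all_boot all_order all_algebra.
From mathcomp Require Import all_classical all_reals all_analysis.
From mathcomp Require Import perm measurable_realfun giry ring lra.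

Set Implicit Arguments.
Unset Strict Implicit.
Unset Printing Implicit Defensive.

Import Order.TTheory GRing.Theory Num.Theory.
Import numFieldNormedType.Exports.

Local Open Scope classical_set_scope.
Local Open Scope ring_scope.

(** No derivative of the matrix square root is computed: the two-sided use of duality replaces it,
    so multiple eigenvalues of [Sigma] do not disturb the linearisation. Two obstacles shape the
    statements. Empirical covariances may be singular, and the statistic exists for every n; hence
    Gelbrich's formula and the measurability of [sqrtmx] are proved for all nonnegative definite
    matrices, and invertibility is used only for the linearisation near ([Sigma], [Xi]). Each n has
    its own probability space; hence the two samples are transferred to a product law depending only
    on the sample sizes, and the estimates there have constants independent of these sizes. Gaussian
    calculus rests on the rotation invariance of the standard normal law of the plane: it yields
    invariance under orthogonal matrices, the odd and fourth moments, and stability under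
    convolution. With s^2 = nm/(n+m), the ratios s^2/n and s^2/m tend to 1-a and a, the weights of
    the two influence variances in the limit. That the two laws differ makes the limit variance
    positive. *)

Section dot.
Context {R : comPzRingType} {n : nat}.
Implicit Types (x y z : 'cV[R]_n) (k : R).

Definition dot x y : R := (x^T *m y) 0 0.

Lemma dotE x y : dot x y = \sum_i x i 0 * y i 0.
Proof. by rewrite /dot mxE; apply: eq_bigr => i _; rewrite mxE. Qed.

Lemma dotC x y : dot x y = dot y x.
Proof. by rewrite !dotE; apply: eq_bigr => i _; rewrite mulrC. Qed.

Lemma dotDr x y z : dot x (y + z) = dot x y + dot x z.
Proof. by rewrite /dot mulmxDr mxE. Qed.

Lemma dotDl x y z : dot (x + y) z = dot x z + dot y z.
Proof. by rewrite dotC dotDr !(dotC z). Qed.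

Lemma dotZr k x y : dot x (k *: y) = k * dot x y.
Proof. by rewrite /dot -scalemxAr mxE. Qed.

Lemma dotZl k x y : dot (k *: x) y = k * dot x y.
Proof. by rewrite dotC dotZr dotC. Qed.

Lemma dotNr x y : dot x (- y) = - dot x y.
Proof. by rewrite -scaleN1r dotZr mulN1r. Qed.

Lemma dotNl x y : dot (- x) y = - dot x y.
Proof. by rewrite dotC dotNr dotC. Qed.

Lemma dotBr x y z : dot x (y - z) = dot x y - dot x z.
Proof. by rewrite dotDr dotNr. Qed.

Lemma dotBl x y z : dot (x - y) z = dot x z - dot y z.
Proof. by rewrite dotDl dotNl. Qed.

Lemma dot0r x : dot x 0 = 0.
Proof. by rewrite /dot mulmx0 mxE. Qed.

Lemma dot0l x : dot 0 x = 0.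
Proof. by rewrite dotC dot0r. Qed.

Lemma dot_delta i x : dot (delta_mx i 0) x = x i 0.
Proof.
rewrite dotE (bigD1 i)//= big1 ?mxE ?eqxx ?mul1r ?addr0// => j ji.
by rewrite mxE (negbTE ji) mul0r.
Qed.

Lemma trmx_mulmx x y : x^T *m y = (dot x y)%:M.
Proof. exact: mx11_scalar. Qed.

Lemma dot_mulmx m (A : 'M[R]_(n, m)) x (y : 'cV_m) :
  dot x (A *m y) = (x^T *m A *m y) 0 0.
Proof. by rewrite /dot mulmxA. Qed.

End dot.

Lemma dot_trmx (R : comPzRingType) m n (A : 'M[R]_(m, n)) x y :
  dot x (A *m y) = dot (A^T *m x) y.
Proof. by rewrite /dot trmx_mul trmxK mulmxA. Qed.

Lemma dot_tr (R : comPzRingType) n (x y : 'cV[R]_n) : dot x y = \tr (x *m y^T).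
Proof. by rewrite mxtrace_mulC [RHS]big_ord1 [RHS]dotC. Qed.

Lemma le_of_eq (R : numDomainType) (x y : R) : x = y -> x <= y.
Proof. by move->. Qed.

Section dot_real.
Context {R : realFieldType}.

Lemma dot_ge0 n (x : 'cV[R]_n) : 0 <= dot x x.
Proof. by rewrite dotE sumr_ge0// => i _; rewrite -expr2 sqr_ge0. Qed.

Lemma dot_eq0 n (x : 'cV[R]_n) : dot x x = 0 -> x = 0.
Proof.
rewrite dotE => /eqP; rewrite psumr_eq0; last first.
  by move=> i _; rewrite -expr2 sqr_ge0.
move=> /allP x0; apply/colP => i; have := x0 i (mem_index_enum _).
by rewrite /= -expr2 sqrf_eq0 mxE => /eqP.
Qed.

Lemma dot_gt0 n (x : 'cV[R]_n) : x != 0 -> 0 < dot x x.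
Proof.
by move=> x0; rewrite lt_def dot_ge0 andbT; apply: contra_neq x0; exact: dot_eq0.
Qed.

Lemma coord_le_dot n (x : 'cV[R]_n) i : x i 0 ^+ 2 <= dot x x.
Proof.
rewrite dotE (bigD1 i)//= -expr2 lerDl sumr_ge0// => j _.
by rewrite -expr2 sqr_ge0.
Qed.

(** The reflection along x - y. This vector vanishes at the coordinates where x and y agree, so the
    rows of H there are those of the identity; this clause is what makes the reflection compatible
    with colours in [coloured_spectral]. *)
Lemma householder n (x y : 'cV[R]_n) : dot x x = dot y y ->
  exists H : 'M[R]_n, [/\ H^T = H, H *m H = 1%:M, H *m x = y &
    forall i j, x i 0 = y i 0 -> H i j = (i == j)%:R].
Proof.
have [-> _|xy0 xy] := eqVneq x y.
  exists 1%:M; split; rewrite ?trmx1 ?mul1mx// => i j _.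
  by rewrite mxE.
pose w := x - y; have w0 : dot w w != 0.
  by rewrite gt_eqF// dot_gt0// subr_eq0.
have ww : dot w w = 2 * dot w x.
  by rewrite /w !dotBl !dotBr (dotC y x) xy; ring.
pose H := 1%:M - (2 / dot w w) *: (w *m w^T).
have WE z : w *m w^T *m z = dot w z *: w.
  by rewrite -mulmxA trmx_mulmx mul_mx_scalar.
have HW : H *m (w *m w^T) = - (w *m w^T).
  rewrite mulmxBl mul1mx -scalemxAl mulmxA WE -scalemxAl scalerA divfK//.
  by rewrite scaler_nat mulr2n opprD addrA subrr sub0r.
exists H; split.
- by rewrite /H linearB/= linearZ/= trmx1 trmx_mul trmxK.
- rewrite {2}/H mulmxBr mulmx1 -scalemxAr HW scalerN opprK.
  by rewrite /H subrK.
- rewrite /H mulmxBl mul1mx -scalemxAl WE scalerA ww mulrAC.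
  rewrite mulfV; last by rewrite -ww.
  by rewrite scale1r /w opprB addrC subrK.
- move=> i j xyi; rewrite !mxE big_ord1 !mxE xyi subrr mul0r mulr0 subr0.
  by [].
Qed.

End dot_real.

Lemma continuous_bigsum (R : numFieldType) (T : topologicalType) I (r : seq I)
    (P : pred I) (F : I -> T -> R) :
  (forall i, continuous (F i)) -> continuous (fun x => \sum_(i <- r | P i) F i x).
Proof.
move=> cF; elim: r => [|i r IHr].
  rewrite (_ : (fun x => _) = cst 0); first exact: cst_continuous.
  by apply/funext => x; rewrite big_nil.
have [Pi|Pi] := boolP (P i); last first.
  by under eq_fun do rewrite big_cons (negbTE Pi).
under eq_fun do rewrite big_cons Pi.
by move=> x; apply: continuousD; [exact: cF|exact: IHr].
Qed.

(* In an eigenbasis of another matrix, with the eigenvalues as colours, the coloured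
   matrices are those preserving its eigenspaces. *)
Definition coloured (R : pzRingType) (C : eqType) n (c : 'I_n -> C)
    (B : 'M[R]_n) :=
  forall i j, c i != c j -> B i j = 0.

(** The first-order condition at an extremum, for a quadratic of unknown curvature c. The test value
    t = - b / (|c| + 1) is small enough for the linear term to win whatever the sign of c. *)
Lemma quadratic_ge0 (R : realFieldType) (b c : R) :
  (forall t, 0 <= 2 * t * b + t ^+ 2 * c) -> b = 0.
Proof.
move=> bc; apply/eqP/negP => /negP b0.
have c1 : 0 < `|c| + 1 by rewrite ltr_wpDl.
have := bc (- b / (`|c| + 1)).
rewrite (_ : _ + _ = - (b / (`|c| + 1)) ^+ 2 * (2 * (`|c| + 1) - c)); last first.
  by field; rewrite gt_eqF.
rewrite mulNr oppr_ge0 pmulr_rle0; last first.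
  by rewrite exprn_even_gt0//= mulf_neq0// invr_eq0 gt_eqF.
by apply/negP; rewrite -ltNge; have := ler_norm c; have := normr_ge0 c; lra.
Qed.

(** The deflation common to the inductions on the dimension in [coloured_spectral], [gram_diag] and
    [gvec_orth]. *)
Lemma block_mx_scalarl (R : pzRingType) n (M : 'M[R]_(1 + n)) (l : R) :
  (forall i, M i (lshift n 0) = l * (i == lshift n 0)%:R) ->
  (forall j, M (lshift n 0) (rshift 1 j) = 0) ->
  M = block_mx l%:M 0 0 (drsubmx M).
Proof.
move=> Ml M0; rewrite -[LHS]submxK; congr block_mx.
- by apply/matrixP => i j; rewrite !ord1 !mxE Ml !eqxx mulr1n mulr1.
- by apply/matrixP => i j; rewrite !ord1 !mxE M0.
- by apply/matrixP => i j; rewrite !ord1 !mxE Ml eq_rlshift mulr0.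
Qed.

(** * Spectral theorem and matrix square roots *)

Section coloured_spectral.
Context {R : realType} {C : eqType}.

(* Maximise the Rayleigh quotient on the unit vectors supported on the colour of [z]. *)
Lemma coloured_eigenvector n (z : 'I_n) (c : 'I_n -> C) (B : 'M[R]_n) :
  B^T = B -> coloured c B ->
  exists l (v : 'cV[R]_n), [/\ B *m v = l *: v, dot v v = 1 &
    forall i, c i != c z -> v i 0 = 0].
Proof.
move=> symB cB.
pose f1 (x : 'rV[R]_n) := \sum_i x 0 i ^+ 2.
pose f2 (x : 'rV[R]_n) := \sum_(i | c i != c z) x 0 i ^+ 2.
pose f (x : 'rV[R]_n) := \sum_i \sum_j x 0 i * B i j * x 0 j.
pose S := [set x | f1 x = 1 /\ f2 x = 0].
have cc i : continuous (fun x : 'rV[R]_n => x 0 i) by exact: coord_continuous.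
have csq i : continuous (fun x : 'rV[R]_n => x 0 i ^+ 2).
  by move=> x; exact: (continuousM (cc i x) (cc i x)).
have cf1 : continuous f1 by apply: continuous_bigsum.
have cf2 : continuous f2 by apply: continuous_bigsum.
have cf : continuous f.
  apply: continuous_bigsum => i; apply: continuous_bigsum => j x.
  exact: (continuousM (continuousM (cc i x) (@cst_continuous _ _ (B i j) x)) (cc j x)).
have f1E x : f1 x = dot x^T x^T.
  by rewrite dotE; apply: eq_bigr => i _; rewrite mxE expr2.
have fE x : f x = dot x^T (B *m x^T).
  rewrite dotE; apply: eq_bigr => i _; rewrite !mxE mulr_sumr.
  by apply: eq_bigr => j _; rewrite mxE mulrA.
have f2P x : f2 x = 0 <-> forall i, c i != c z -> x 0 i = 0.
  split=> [/eqP|x0]; last by apply: big1 => i /x0 ->; rewrite expr0n.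
  rewrite psumr_eq0; last by move=> i _; rewrite sqr_ge0.
  move=> /allP x0 i ci; have := x0 i (mem_index_enum _).
  by rewrite ci/= sqrf_eq0 => /eqP.
have clS : closed S.
  have -> : S = f1 @^-1` [set 1] `&` f2 @^-1` [set 0] by [].
  by apply: closedI; apply: preimage_closed => //; exact: closed_eq.
have S0 : S !=set0.
  exists (delta_mx 0 z); split.
    rewrite /f1 (bigD1 z)//= big1 ?addr0 ?mxE ?eqxx ?expr1n// => i i0.
    by rewrite mxE (negbTE i0) andbF expr0n.
  apply/f2P => i ci; rewrite mxE/=; have [i0|//] := eqVneq i z.
  by rewrite i0 eqxx in ci.
have cS : compact S.
  apply: (@subclosed_compact _ _
      [set v : 'rV[R]_n | forall i, v ord0 i \in `[-1, 1]]) => //.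
    by have := @rV_compact _ n (fun=> `[-1 : R, 1]%classic); apply => _; exact: segment_compact.
  move=> v [fv _] i /=; rewrite in_itv/= -ler_norml -(@expr_le1 _ 2)// real_normK ?num_real//.
  by have := coord_le_dot v^T i; rewrite -f1E fv mxE.
have [v /[!inE] -[fv1 fv2] vmax] := EVT_max_rV S0 cS (continuous_subspaceT cf).
pose V := v^T.
exists (f v), V.
have V1 : dot V V = 1 by rewrite -f1E.
have cV i : c i != c z -> V i 0 = 0.
  by move=> ci; rewrite mxE; apply: (f2P v).1.
split => //.
have le (u : 'cV[R]_n) : (forall i, c i != c z -> u i 0 = 0) ->
    dot u (B *m u) <= f v * dot u u.
  move=> cu; have [->|u0] := eqVneq u 0.
    by rewrite !dot0l mulr0.
  pose r := Num.sqrt (dot u u).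
  have r0 : 0 < r by rewrite sqrtr_gt0 dot_gt0.
  have rr : r ^+ 2 = dot u u by rewrite sqr_sqrtr// dot_ge0.
  have /vmax : (r^-1 *: u)^T \in S.
    rewrite inE; split.
      by rewrite f1E trmxK dotZl dotZr -rr mulrA -expr2 -exprMn mulVf ?expr1n// gt_eqF.
    by apply/f2P => i ci; rewrite !mxE cu// mulr0.
  rewrite fE trmxK -scalemxAr dotZl dotZr mulrA -expr2 exprVn rr.
  by rewrite mulrC ler_pdivrMr// dot_gt0.
(* The residual of the eigenvalue equation has the colour of z, so V + t w is an admissible
   competitor for every t. Maximality makes a quadratic in t nonnegative whose linear coefficient is
   - dot w w, which therefore vanishes. *)
pose w := B *m V - f v *: V.
have cw i : c i != c z -> w i 0 = 0.
  move=> ci; rewrite /w mxE [X in _ + X]mxE [X in _ - X]mxE cV// mulr0 subr0.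
  rewrite mxE big1// => j _.
  have [cij|cij] := eqVneq (c i) (c j); last by rewrite cB// mul0r.
  by rewrite cV ?mulr0// -cij.
have fvE : f v = dot V (B *m V) by rewrite fE.
have symD x y : dot x (B *m y) = dot y (B *m x).
  by rewrite dot_trmx symB dotC.
have BV : B *m V = w + f v *: V by rewrite /w subrK.
suff : - dot w w = 0.
  move=> /eqP; rewrite oppr_eq0 => /eqP/dot_eq0 w0.
  by rewrite BV w0 add0r.
clearbody w.

apply: (@quadratic_ge0 _ _ (f v * dot w w - dot w (B *m w))) => t.
have := le (V + t *: w); rewrite -subr_ge0 => H.
apply: le_trans (H _) _; last first.
  rewrite mulmxDr -scalemxAr !dotDl !dotDr !(dotZl, dotZr) (symD V w).
  rewrite V1 -fvE (dotC V w) BV dotDr dotZr.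
  by apply: le_of_eq; ring.
by move=> i ci; rewrite mxE [X in _ + X]mxE cV// cw// mulr0 addr0.
Qed.

Lemma coloured_mulmx n (c : 'I_n -> C) (A B : 'M[R]_n) :
  coloured c A -> coloured c B -> coloured c (A *m B).
Proof.
move=> cA cB i j cij; rewrite mxE big1// => k _.
have [cik|cik] := eqVneq (c i) (c k); last by rewrite cA// mul0r.
by rewrite cB ?mulr0// -cik.
Qed.

(** A reflection sends the first basis vector to an eigenvector of the same colour. Both vectors
    vanish at the other colours, so the reflection is coloured, and so is the smaller block left
    after deflation. *)
Lemma coloured_spectral n (c : 'I_n -> C) (B : 'M[R]_n) :
  B^T = B -> coloured c B ->
  exists (V : 'M[R]_n) (D : 'rV[R]_n), [/\ V^T *m V = 1%:M, coloured c V &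
    V^T *m B *m V = diag_mx D].
Proof.
elim: n c B => [|n IHn] c B symB cB.
  by exists 1%:M, 0; split => [|[]|]//; apply/matrixP => -[].
rewrite -[n.+1]/(1 + n)%N in c B symB cB *.
pose z := lshift n (0 : 'I_1).
have [l [v [Bv v1 cv]]] := coloured_eigenvector z symB cB.
pose e : 'cV[R]_(1 + n) := delta_mx z 0.
have e1 : dot e e = 1 by rewrite dot_delta mxE !eqxx.
have [H [HT HH He H0]] : exists H : 'M[R]_(1 + n), [/\ H^T = H, H *m H = 1%:M,
    H *m e = v & forall i j, e i 0 = v i 0 -> H i j = (i == j)%:R].
  by apply: householder; rewrite e1 v1.
have Hv : H *m v = e by rewrite -He mulmxA HH mul1mx.
have cH : coloured c H.
  move=> i j cij.
  have col0 k : c k != c z -> e k 0 = v k 0.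
    move=> ck; rewrite cv// mxE andbT; have [k0|//] := eqVneq k z.
    by rewrite k0 eqxx in ck.
  have ij : (i == j) = false by apply: contra_neqF cij => /eqP ->.
  have [ci|ci] := eqVneq (c i) (c z); last by rewrite H0 ?ij// col0.
  by rewrite -HT mxE H0 ?(eq_sym j) ?ij// col0// -ci eq_sym.
have [M HBH] : exists M : 'M[R]_(1 + n), H *m B *m H = M by eexists.
have symM : M^T = M by rewrite -HBH !trmx_mul symB HT mulmxA.
have cM : coloured c M by rewrite -HBH; do 2?apply: coloured_mulmx.
have Mz i : M i z = l * (i == z)%:R.
  have : (M *m e) i 0 = M i z by rewrite /e -colE mxE.
  by rewrite -HBH -!mulmxA He Bv -scalemxAr Hv !mxE andbT.
have ME : M = block_mx l%:M 0 0 (drsubmx M).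
  by apply: block_mx_scalarl => // j; rewrite -symM mxE Mz eq_rlshift mulr0.
have symM' : (drsubmx M)^T = drsubmx M by rewrite trmx_drsub symM.
have cM' : coloured (c \o @rshift 1 n) (drsubmx M).
  by move=> i j cij; rewrite !mxE; exact: cM.
have [V' [D' [VV' cV' VMV']]] := IHn _ _ symM' cM'.
pose W : 'M[R]_(1 + n) := block_mx 1%:M 0 0 V'.
have WT : W^T = block_mx 1%:M 0 0 V'^T by rewrite tr_block_mx trmx1 !trmx0.
exists (H *m W), (row_mx l%:M D'); split.
- rewrite trmx_mul mulmxA -(mulmxA _ H^T) HT HH mulmx1 WT /W mulmx_block.
  by rewrite !(mul0mx, mulmx0, mul1mx, add0r, addr0) VV' -scalar_mx_block.
- apply: coloured_mulmx => // i j.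
  case: (split_ordP i) => i' ->; case: (split_ordP j) => j' -> cij.
  + by move: cij; rewrite !ord1 eqxx.
  + by rewrite block_mxEur mxE.
  + by rewrite block_mxEdl mxE.
  + by rewrite block_mxEdr; exact: cV'.
- have -> : (H *m W)^T *m B *m (H *m W) = W^T *m M *m W.
    by rewrite trmx_mul HT -HBH !mulmxA.
  rewrite ME WT /W !mulmx_block !(mul0mx, mulmx0, mul1mx, mulmx1, add0r, addr0).
  by rewrite VMV' diag_mx_row; congr block_mx; apply/matrixP => i j; rewrite !ord1 !mxE.
Qed.

End coloured_spectral.

Lemma spectral (R : realType) n (B : 'M[R]_n) : B^T = B ->
  exists (V : 'M[R]_n) (D : 'rV[R]_n), V^T *m V = 1%:M /\
    B = V *m diag_mx D *m V^T.
Proof.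
move=> symB; have [|V [D [VV _ VBV]]] := @coloured_spectral _ unit n (fun=> tt) B symB.
  by move=> i j; rewrite eqxx.
exists V, D; split => //; rewrite -VBV !mulmxA (mulmx1C VV) mul1mx.
by rewrite -mulmxA (mulmx1C VV) mulmx1.
Qed.

Section spectral_calculus.
Context {R : realFieldType} {n : nat}.
Implicit Types (V X : 'M[R]_n) (f g : 'I_n -> R).

(** Functions of one symmetric matrix share the orthogonal matrix V, so identities between them
    reduce to scalar identities on the f i. *)
Definition conjD V f := V *m diag_mx (\row_i f i) *m V^T.

Lemma eq_conjD V f g : f =1 g -> conjD V f = conjD V g.
Proof. by move=> fg; congr (_ *m diag_mx _ *m _); apply/rowP => i; rewrite !mxE. Qed.

Lemma conjD_tr V f : (conjD V f)^T = conjD V f.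
Proof. by rewrite !trmx_mul trmxK tr_diag_mx mulmxA. Qed.

Lemma conjD_sum V f : conjD V f = \sum_i f i *: (col i V *m (col i V)^T).
Proof.
rewrite /conjD mul_mx_diag; apply/matrixP => i j.
rewrite !mxE summxE; apply: eq_bigr => k _.
by rewrite !mxE big_ord1 !mxE mulrA [f k * _]mulrC.
Qed.

Section orthogonal.
Variables (V : 'M[R]_n) (VV : V^T *m V = 1%:M).

Lemma conjD_mul f g : conjD V f *m conjD V g = conjD V (fun i => f i * g i).
Proof.
rewrite /conjD !mulmxA -(mulmxA _ V^T V) VV mulmx1 -(mulmxA V) mulmx_diag.
by congr (_ *m diag_mx _ *m _); apply/rowP => i; rewrite !mxE.
Qed.

Lemma conjD_cst k : conjD V (fun=> k) = k%:M.
Proof.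
rewrite /conjD (_ : diag_mx _ = k%:M).
  by rewrite mul_mx_scalar -scalemxAl (mulmx1C VV) scalemx1.
by apply/matrixP => i j; rewrite !mxE.
Qed.

Lemma conjD_mxtrace f : \tr (conjD V f) = \sum_i f i.
Proof.
rewrite /conjD mxtrace_mulC mulmxA VV mul1mx mxtrace_diag.
by apply: eq_bigr => i _; rewrite mxE.
Qed.

Lemma conjD_col f i : conjD V f *m col i V = f i *: col i V.
Proof.
rewrite !colE /conjD mulmxA -(mulmxA _ V^T) VV mulmx1 -mulmxA scalemxAr.
congr (_ *m _); apply/colP => j; rewrite mul_diag_mx !mxE.
by have [->|] := eqVneq j i; rewrite //= !mulr0.
Qed.

Lemma dot_col_orth i j : dot (col i V) (col j V) = (i == j)%:R.
Proof.
have := congr1 (fun M : 'M[R]_n => M i j) VV; rewrite !mxE => <-.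
by rewrite dotE; apply: eq_bigr => k _; rewrite !mxE.
Qed.

Lemma dot_conjD f x :
  dot x (conjD V f *m x) = \sum_i f i * (V^T *m x) i 0 ^+ 2.
Proof.
rewrite /conjD -!mulmxA dot_trmx dotE; apply: eq_bigr => i _.
by rewrite mul_diag_mx !mxE expr2 mulrCA.
Qed.

Lemma dot_orth x : dot (V^T *m x) (V^T *m x) = dot x x.
Proof. by rewrite -dot_trmx mulmxA (mulmx1C VV) mul1mx. Qed.

End orthogonal.

Lemma conjDD V f g : conjD V f + conjD V g = conjD V (fun i => f i + g i).
Proof. by rewrite !conjD_sum -big_split; apply: eq_bigr => i _; rewrite scalerDl. Qed.

Lemma conjDZ V k f : k *: conjD V f = conjD V (fun i => k * f i).
Proof. by rewrite !conjD_sum scaler_sumr; apply: eq_bigr => i _; rewrite scalerA. Qed.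

End spectral_calculus.

Section psd.
Context {R : realType} {n : nat}.
Implicit Types (A B S V X : 'M[R]_n).

Lemma psdmxP A : psdmx A <-> A^T = A /\ forall x, 0 <= dot x (A *m x).
Proof.
by split=> -[AT A0]; split => // x; have := A0 x; rewrite dot_mulmx.
Qed.

Lemma psdmx_conj m A (X : 'M[R]_(n, m)) : psdmx A -> psdmx (X^T *m A *m X).
Proof.
move=> [AT A0]; split=> [|x]; first by rewrite !trmx_mul trmxK AT mulmxA.
by have := A0 (X *m x); rewrite trmx_mul !mulmxA.
Qed.

Lemma psdmxD A B : psdmx A -> psdmx B -> psdmx (A + B).
Proof.
move=> /psdmxP[AT A0] /psdmxP[BT B0]; apply/psdmxP; split=> [|x].
  by rewrite linearD/= AT BT.
by rewrite mulmxDl dotDr addr_ge0.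
Qed.

Lemma psdmxZ k A : 0 <= k -> psdmx A -> psdmx (k *: A).
Proof.
move=> k0 /psdmxP[AT A0]; apply/psdmxP; split=> [|x].
  by rewrite linearZ/= AT.
by rewrite -scalemxAl dotZr mulr_ge0.
Qed.

Lemma psdmx_gram m (X : 'M[R]_(m, n)) : psdmx (X^T *m X).
Proof.
apply/psdmxP; split=> [|x]; first by rewrite trmx_mul trmxK.
by rewrite -mulmxA dot_trmx trmxK dot_ge0.
Qed.

Lemma psdmx_conjD V f : V^T *m V = 1%:M -> (forall i, 0 <= f i) -> psdmx (conjD V f).
Proof.
move=> VV f0; apply/psdmxP; split=> [|x]; first exact: conjD_tr.
by rewrite dot_conjD sumr_ge0// => i _; rewrite mulr_ge0// sqr_ge0.
Qed.

Lemma psdmx_conjD_ge0 V f : V^T *m V = 1%:M -> psdmx (conjD V f) ->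
  forall i, 0 <= f i.
Proof.
move=> VV /psdmxP[_ f0] i; have := f0 (col i V).
by rewrite conjD_col// dotZr dot_col_orth// eqxx mulr1.
Qed.

Lemma symmetric_conjD A : A^T = A ->
  exists V f, V^T *m V = 1%:M /\ A = conjD V f.
Proof.
move=> /spectral[V [D [VV AE]]]; exists V, (D 0); split => //.
by rewrite AE; congr (_ *m diag_mx _ *m _); apply/rowP => i; rewrite mxE.
Qed.

Lemma psdmx_spectral A : psdmx A ->
  exists V f, [/\ V^T *m V = 1%:M, forall i, 0 <= f i & A = conjD V f].
Proof.
move=> pA; have [V [f [VV AE]]] := symmetric_conjD pA.1.
by exists V, f; split => //; rewrite AE in pA; exact: psdmx_conjD_ge0 pA.
Qed.

Lemma mxtrace_conj m A (X : 'M[R]_(n, m)) :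
  \tr (X^T *m A *m X) = \sum_j dot (col j X) (A *m col j X).
Proof.
rewrite /mxtrace; apply: eq_bigr => j _.
rewrite -mulmxA mxE dotE; apply: eq_bigr => i _.
rewrite !mxE; congr (_ * _).
by apply: eq_bigr => k _; rewrite !mxE.
Qed.

Lemma psdmx_mxtrace_conj m A (X : 'M[R]_(n, m)) :
  psdmx A -> 0 <= \tr (X^T *m A *m X).
Proof. by move=> /psdmxP[_ A0]; rewrite mxtrace_conj sumr_ge0. Qed.

(** The quadratic form is minimal at x; its derivative there in the direction A x is twice the
    square norm of A x. *)
Lemma psdmx_ker A x : psdmx A -> dot x (A *m x) = 0 -> A *m x = 0.
Proof.
move=> /psdmxP[AT A0] Ax0; apply: dot_eq0.
apply: (@quadratic_ge0 _ _ (dot (A *m x) (A *m (A *m x)))) => t.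
have := A0 (x + t *: (A *m x)).
rewrite mulmxDr -scalemxAr !dotDl !dotDr !(dotZl, dotZr) Ax0.
rewrite [dot x _]dot_trmx AT.
by move=> /le_trans; apply; apply: le_of_eq; ring.
Qed.

Lemma psdmx_trace_ker m A (X : 'M[R]_(n, m)) :
  psdmx A -> \tr (X^T *m A *m X) = 0 -> A *m X = 0.
Proof.
move=> pA; have /psdmxP[_ A0] := pA.
rewrite mxtrace_conj => /eqP; rewrite psumr_eq0// => /allP X0.
apply/matrixP => i j; have /eqP := X0 j (mem_index_enum _).
move=> /(psdmx_ker pA) /(congr1 (fun M : 'cV[R]_n => M i 0)).
rewrite [in RHS]mxE => Ax0; rewrite [RHS]mxE -Ax0 !mxE.
by apply: eq_bigr => k _; rewrite mxE.
Qed.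

(** With D = A - B, equality of the squares reads A D + D B = 0. Multiplying by D and taking traces
    gives tr(D A D) + tr(D B D) = 0 with both terms nonnegative, so A D = B D = 0 and D D = 0. *)
Lemma psdmx_sqr_inj A B : psdmx A -> psdmx B -> A *m A = B *m B -> A = B.
Proof.
move=> pA pB AB; pose D := A - B.
have DT : D^T = D by rewrite /D linearB/= pA.1 pB.1.
have ADB : A *m D + D *m B = 0.
  by rewrite /D mulmxBr mulmxBl AB addrA subrK subrr.
have tr0 : \tr (D^T *m A *m D) + \tr (D^T *m B *m D) = 0.
  rewrite DT [X in _ + X]mxtrace_mulC -linearD/= -mulmxA -mulmxDr.
  by rewrite ADB mulmx0 linear0.
have /eqP := tr0; rewrite paddr_eq0 ?psdmx_mxtrace_conj// => /andP[/eqP tA /eqP tB].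
have AD : A *m D = 0 by apply: psdmx_trace_ker.
have BD : B *m D = 0 by apply: psdmx_trace_ker.
have DD : D^T *m 1%:M *m D = 0 by rewrite DT mulmx1 {1}/D mulmxBl AD BD subrr.
have : 1%:M *m D = 0.
  apply: psdmx_trace_ker; last by rewrite DD linear0.
  by rewrite -[1%:M]mulmx1 -{1}(trmx1 _ n); exact: psdmx_gram.
by rewrite mul1mx => /subr0_eq.
Qed.

Lemma eigendecompE A (l : 'I_n -> R) (p : 'I_n -> 'cV[R]_n) :
  eigendecomp A l p -> exists V, [/\ V^T *m V = 1%:M, A = conjD V l &
    forall i, p i = col i V].
Proof.
move=> [Ap pp]; pose V : 'M[R]_n := \matrix_(i, j) p j i 0.
have pE i : p i = col i V by apply/colP => j; rewrite !mxE.
have VV : V^T *m V = 1%:M.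
  apply/matrixP => i j; rewrite [RHS]mxE -pp !mxE.
  by apply: eq_bigr => k _; rewrite !mxE.
exists V; split => //.
rewrite -[LHS]mulmx1 -(mulmx1C VV) mulmxA; congr (_ *m _).
apply/matrixP => i j; rewrite mul_mx_diag !mxE.
have := congr1 (fun M : 'cV[R]_n => M i 0) (Ap j).
rewrite !mxE mulrC => <-; apply: eq_bigr => k _.
by rewrite !mxE.
Qed.

Lemma conjD_eigendecomp V f : V^T *m V = 1%:M ->
  eigendecomp (conjD V f) f (fun i => col i V).
Proof.
by move=> VV; split=> [i|i j]; [exact: conjD_col|exact: dot_col_orth].
Qed.

Lemma sqrtmx_psd A : psdmx A -> psdmx (sqrtmx A) /\ sqrtmx A *m sqrtmx A = A.
Proof.
move=> pA; rewrite /sqrtmx; case: xgetP => [S _ [l [p [Alp ->]]]|].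
  have [V [VV AE pE]] := eigendecompE Alp.
  have l0 : forall i, 0 <= l i by apply: (psdmx_conjD_ge0 VV); rewrite -AE.
  have -> : \sum_i Num.sqrt (l i) *: (p i *m (p i)^T) =
      conjD V (fun i => Num.sqrt (l i)).
    by rewrite conjD_sum; apply: eq_bigr => i _; rewrite pE.
  split; first by apply: psdmx_conjD => // i; exact: sqrtr_ge0.
  by rewrite conjD_mul// AE; apply: eq_conjD => i; rewrite -expr2 sqr_sqrtr.
(* The default value in [sqrtmx] is excluded, since the spectral theorem supplies a
   decomposition. *)
have [V [f [VV f0 AE]]] := psdmx_spectral pA.
move=> /(_ (\sum_i Num.sqrt (f i) *: (col i V *m (col i V)^T))); case.
exists f, (fun i => col i V); split => //.
by rewrite AE; exact: conjD_eigendecomp.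
Qed.

Lemma sqrtmx_uniq A S : psdmx S -> S *m S = A -> sqrtmx A = S.
Proof.
move=> pS SS; have pA : psdmx A by rewrite -SS -{1}pS.1; exact: psdmx_gram.
by have [pS' SS'] := sqrtmx_psd pA; apply: psdmx_sqr_inj; rewrite ?SS'.
Qed.

Lemma sqrtmx_conjD V f : V^T *m V = 1%:M -> (forall i, 0 <= f i) ->
  sqrtmx (conjD V f) = conjD V (fun i => Num.sqrt (f i)).
Proof.
move=> VV f0; apply: sqrtmx_uniq.
  by apply: psdmx_conjD => // i; exact: sqrtr_ge0.
by rewrite conjD_mul//; apply: eq_conjD => i; rewrite -expr2 sqr_sqrtr.
Qed.

Lemma sqrtmx_ge0 A : psdmx A -> psdmx (sqrtmx A).
Proof. by case/sqrtmx_psd. Qed.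

Lemma sqrtmx_sqr A : psdmx A -> sqrtmx A *m sqrtmx A = A.
Proof. by case/sqrtmx_psd. Qed.

Lemma sqrtmx_sym A : psdmx A -> (sqrtmx A)^T = sqrtmx A.
Proof. by move=> /sqrtmx_ge0[]. Qed.

End psd.

Section frobenius.
Context {R : realFieldType}.

Lemma dot_cauchy n (x y : 'cV[R]_n) : dot x y ^+ 2 <= dot x x * dot y y.
Proof.
have [->|y0] := eqVneq y 0; first by rewrite !dot0r expr0n mulr0.
have yy := dot_gt0 y0.
have := dot_ge0 (dot y y *: x - dot x y *: y).
rewrite dotBl !dotBr !(dotZl, dotZr) (dotC y x).
rewrite (_ : _ - _ = dot y y * (dot x x * dot y y - dot x y ^+ 2)); last by ring.
by rewrite pmulr_rge0// subr_ge0.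
Qed.

(** The square of the Frobenius norm: a remainder linear in [frob] is quadratic in the matrix, and
    [frobD] carries the factor 2 of a squared norm. *)
Definition frob m n (A : 'M[R]_(m, n)) : R := \tr (A^T *m A).

Lemma frobE m n (A : 'M[R]_(m, n)) : frob A = \sum_j dot (col j A) (col j A).
Proof.
apply: eq_bigr => j _; rewrite mxE dotE.
by apply: eq_bigr => i _; rewrite !mxE.
Qed.

Lemma frob_sum m n (A : 'M[R]_(m, n)) : frob A = \sum_i \sum_j A i j ^+ 2.
Proof.
rewrite frobE exchange_big; apply: eq_bigr => j _; rewrite dotE.
by apply: eq_bigr => i _; rewrite !mxE expr2.
Qed.

Lemma mxtraceB n (A B : 'M[R]_n) : \tr (A - B) = \tr A - \tr B.
Proof. exact: raddfB. Qed.

Lemma mxtrace_mul_sum m n (A B : 'M[R]_(m, n)) :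
  \tr (A^T *m B) = \sum_i \sum_j A i j * B i j.
Proof.
rewrite exchange_big; apply: eq_bigr => j _; rewrite mxE.
by apply: eq_bigr => i _; rewrite mxE.
Qed.

Lemma frob_ge0 m n (A : 'M[R]_(m, n)) : 0 <= frob A.
Proof. by rewrite frobE sumr_ge0// => j _; exact: dot_ge0. Qed.

Lemma frob_tr m n (A : 'M[R]_(m, n)) : frob A^T = frob A.
Proof. by rewrite /frob trmxK mxtrace_mulC. Qed.

Lemma frobN m n (A : 'M[R]_(m, n)) : frob (- A) = frob A.
Proof. by rewrite !frob_sum; apply: eq_bigr => i _; apply: eq_bigr => j _; rewrite mxE sqrrN. Qed.

Lemma frobD m n (A B : 'M[R]_(m, n)) : frob (A + B) <= 2 * (frob A + frob B).
Proof.
rewrite !frob_sum -big_split/= mulr_sumr ler_sum// => i _.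
rewrite -big_split/= mulr_sumr ler_sum// => j _; rewrite mxE.
by rewrite -subr_ge0; have := sqr_ge0 (A i j - B i j); lra.
Qed.

Lemma frob_mulmx m n p (A : 'M[R]_(m, n)) (B : 'M[R]_(n, p)) :
  frob (A *m B) <= frob A * frob B.
Proof.
rewrite -(frob_tr A) frob_sum !frobE mulr_suml ler_sum// => i _.
rewrite mulr_sumr ler_sum// => j _.
rewrite (_ : (A *m B) i j = dot (col i A^T) (col j B)) ?dot_cauchy//.
by rewrite dotE mxE; apply: eq_bigr => k _; rewrite !mxE.
Qed.

Lemma mxtrace_mul_frob m n (k : R) (A : 'M[R]_(m, n)) (B : 'M[R]_(m, n)) :
  0 < k -> 2 * `|\tr (A^T *m B)| <= k * frob A + k^-1 * frob B.
Proof.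
move=> k0; have H (C : 'M[R]_(m, n)) :
    2 * \tr (A^T *m C) <= k * frob A + k^-1 * frob C.
  rewrite mxtrace_mul_sum !frob_sum !mulr_sumr -big_split/= ler_sum// => i _.
  rewrite !mulr_sumr -big_split/= ler_sum// => j _.
  have := sqr_ge0 (k * A i j - C i j).
  rewrite -(ler_pM2l k0) [in X in _ -> X]mulrDr mulrA (mulrA k k^-1) mulfV ?gt_eqF//.
  by rewrite -subr_ge0 => H; nra.
have [tr0|tr0] := leP 0 (\tr (A^T *m B)); first by rewrite ger0_norm.
rewrite ltr0_norm// -linearN/= -mulmxN -(frobN B); exact: H.
Qed.

Lemma dot_frob n (A : 'M[R]_n) x :
  dot (A *m x) (A *m x) <= frob A * dot x x.
Proof.
have := frob_mulmx A x; rewrite {1 3}/frob !trmx_mulmx.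
by rewrite !mxtrace_scalar.
Qed.

End frobenius.

Section polar.
Context {R : realType}.

Lemma mulmx_tr_eq0 m n (W : 'M[R]_(m, n)) : W^T *m W = 0 -> W = 0.
Proof.
move=> WW; have /eqP : frob W = 0 by rewrite /frob WW linear0.
rewrite frobE psumr_eq0; last by move=> j _; exact: dot_ge0.
move=> /allP W0; apply/matrixP => i j; have /eqP/dot_eq0 := W0 j (mem_index_enum _).
by move=> /(congr1 (fun M : 'cV[R]_m => M i 0)); rewrite !mxE.
Qed.

(** The columns of W are orthogonal with lengths |D i|. The difficulty is to complete the normalised
    nonzero columns to an orthogonal matrix when some D i vanish; reflecting one nonzero column onto
    an axis splits off a block of size one, and the zero matrix is the terminal case. *)
Lemma gram_diag n (W : 'M[R]_n) (D : 'I_n -> R) :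
  W^T *m W = diag_mx (\row_i (D i ^+ 2)) ->
  exists U : 'M[R]_n, U^T *m U = 1%:M /\ W = U *m diag_mx (\row_i D i).
Proof.
elim: n W D => [|n IHn] W D WD.
  by exists 1%:M; split; apply/matrixP => -[].
have [D0|] := boolP [forall i, D i == 0].
  exists 1%:M; split; first by rewrite trmx1 mulmx1.
  rewrite mul1mx (_ : diag_mx _ = 0).
    apply: mulmx_tr_eq0; rewrite WD; apply/matrixP => i j; rewrite !mxE.
    by rewrite (eqP (forallP D0 i)) expr0n mul0rn.
  by apply/matrixP => i j; rewrite !mxE (eqP (forallP D0 i)) mul0rn.
rewrite negb_forall => /existsP[k Dk].
(* Permuting the columns, one may assume that the first one is not zero. *)
wlog k0 : k W D WD Dk / k = 0.
  move=> wl; pose s := tperm 0 k;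
  have sK i : s (s i) = i by rewrite tpermK.
  have [||//|U [UU WU]] := wl 0 (col_perm s W) (D \o s).
  - apply/matrixP => i j; have := congr1 (fun M : 'M[R]_n.+1 => M (s i) (s j)) WD.
    rewrite !mxE (inj_eq perm_inj) => <-.
    by apply: eq_bigr => l _; rewrite !mxE.
  - by rewrite /= tpermL.
  exists (col_perm s U); split.
    apply/matrixP => i j; have := congr1 (fun M : 'M[R]_n.+1 => M (s i) (s j)) UU.
    rewrite !mxE (inj_eq perm_inj) => <-.
    by apply: eq_bigr => l _; rewrite !mxE.
  apply/matrixP => i j; have := congr1 (fun M : 'M[R]_n.+1 => M i (s j)) WU.
  by rewrite !mul_mx_diag !mxE/= !sK.
rewrite {}k0 in Dk.
rewrite -[n.+1]/(1 + n)%N in W D WD Dk *.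
pose z := lshift n (0 : 'I_1).
have z0 : z = 0 :> 'I_n.+1 by exact: val_inj.
have {z0} Dz : D z != 0 by rewrite z0.
have cz : dot (col z W) (col z W) = D z ^+ 2.
  have := congr1 (fun M : 'M[R]_(1 + n) => M z z) WD.
  rewrite !mxE eqxx mulr1n => <-.
  by rewrite dotE; apply: eq_bigr => i _; rewrite !mxE.
have /householder[H [HT HH He _]] : dot (col z W) (col z W) =
    dot (D z *: delta_mx z 0) (D z *: delta_mx z 0).
  by rewrite cz dotZl dotZr dot_delta mxE !eqxx mulr1 expr2.
have [M HW] : exists M : 'M[R]_(1 + n), H *m W = M by eexists.
have WM : W = H *m M by rewrite -HW mulmxA HH mul1mx.
have MM : M^T *m M = diag_mx (\row_i (D i ^+ 2)).
  by rewrite -HW trmx_mul HT mulmxA -(mulmxA _ H H) HH mulmx1.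
have Mz i : M i z = D z * (i == z)%:R.
  have := congr1 (fun M : 'cV[R]_(1 + n) => M i 0) He.
  by rewrite colE mulmxA HW -colE mxE => ->; rewrite !mxE andbT.
have Mzr j : M z (rshift 1 j) = 0.
  have := congr1 (fun M : 'M[R]_(1 + n) => M z (rshift 1 j)) MM.
  rewrite [in RHS]mxE eq_lrshift mulr0n mxE (bigD1 z)//= big1; last first.
    by move=> i i0; rewrite mxE Mz (negbTE i0) mulr0 mul0r.
  rewrite addr0 mxE Mz eqxx mulr1 => /eqP; rewrite mulf_eq0.
  by rewrite (negbTE Dz) => /eqP.
have ME := block_mx_scalarl Mz Mzr.
have [M' M'E] : exists M', M' = drsubmx M by eexists.
rewrite -M'E in ME.
have [U' [UU' MU']] : exists U' : 'M[R]_n, U'^T *m U' = 1%:M /\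
    M' = U' *m diag_mx (\row_i D (rshift 1 i)).
  apply: IHn; apply/matrixP => i j.
  have := congr1 (fun M : 'M[R]_(1 + n) => M (rshift 1 i) (rshift 1 j)) MM.
  rewrite ME tr_block_mx mulmx_block block_mxEdr !(trmx0, mul0mx, mulmx0, add0r).
  by move=> ->; rewrite !mxE eq_rshift.
pose B : 'M[R]_(1 + n) := block_mx 1%:M 0 0 U'.
have BB : B^T *m B = 1%:M.
  rewrite /B tr_block_mx mulmx_block trmx1 !trmx0.
  by rewrite !(mul0mx, mulmx0, mul1mx, add0r, addr0) UU' -scalar_mx_block.
exists (H *m B); split.
  by rewrite trmx_mul mulmxA -(mulmxA _ H^T) HT HH mulmx1.
rewrite WM -mulmxA; congr (_ *m _); rewrite ME.
have -> : \row_i D i = row_mx (D z)%:M (\row_i D (rshift 1 i)).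
  apply/rowP => i; rewrite mxE; case: (split_ordP i) => i' ->.
    by rewrite row_mxEl !ord1 mxE eqxx mulr1n.
  by rewrite row_mxEr mxE.
rewrite diag_mx_row /B mulmx_block !(mul0mx, mulmx0, mul1mx, add0r, addr0) -MU'.
by congr block_mx; apply/matrixP => i j; rewrite !ord1 !mxE.
Qed.

(** K may be singular, so O cannot be defined as N K^-1. In an eigenbasis V of K the columns of N V
    are orthogonal, with the eigenvalues of K as lengths, and [gram_diag] applies. *)
Lemma polar n (N K : 'M[R]_n) : psdmx K -> N^T *m N = K *m K ->
  exists O : 'M[R]_n, O^T *m O = 1%:M /\ N = O *m K.
Proof.
move=> pK NK; have [V [f [VV f0 KE]]] := psdmx_spectral pK.
have [|U [UU NU]] := @gram_diag n (N *m V) f.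
  rewrite trmx_mul mulmxA -(mulmxA _ N^T) NK KE conjD_mul// /conjD !mulmxA VV.
  rewrite mul1mx -mulmxA VV mulmx1.
  by congr diag_mx; apply/rowP => i; rewrite !mxE expr2.
exists (U *m V^T); split.
  by rewrite trmx_mul trmxK mulmxA -(mulmxA _ U^T) UU mulmx1 (mulmx1C VV).
rewrite KE /conjD !mulmxA -(mulmxA U V^T) VV mulmx1 -NU.
by rewrite -mulmxA (mulmx1C VV) mulmx1.
Qed.

End polar.

(** * Duality for the fidelity and its first-order expansion *)

Section duality.
Context {R : realType} {n : nat}.
Implicit Types (A S K N T : 'M[R]_n).

Lemma psdmx_invmx A : psdmx A -> psdmx (invmx A).
Proof.
(* On a singular matrix [invmx] is the identity, so nothing remains to be shown in that case. *)
move=> pA; have [uA|] := boolP (A \in unitmx); last by move=> /negbTE nA; rewrite /invmx nA.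
rewrite -[invmx A]mul1mx -(mulVmx uA) -{1}pA.1 -trmx_inv.
exact: psdmx_conj.
Qed.

Lemma psdmx_mxtrace_mul A B : psdmx A -> psdmx B -> 0 <= \tr (A *m B).
Proof.
move=> pA pB; have pS := sqrtmx_ge0 pB.
rewrite -(sqrtmx_sqr pB) mulmxA mxtrace_mulC mulmxA -{1}pS.1.
exact: psdmx_mxtrace_conj.
Qed.

Lemma mulmx1_invmx A B : A *m B = 1%:M -> invmx A = B.
Proof.
by move=> AB; have [uA _] := mulmx1_unit AB; rewrite -[RHS](mulKmx uA) AB mulmx1.
Qed.

(** The expansion of the nonnegative trace of (A X - Y)^T A^-1 (A X - Y); equality would mean Y = A
    X. *)
Lemma young_mx m A (X Y : 'M[R]_(n, m)) : psdmx A -> A \in unitmx ->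
  2 * \tr (X^T *m Y) <= \tr (X^T *m A *m X) + \tr (Y^T *m invmx A *m Y).
Proof.
move=> pA uA; have pV := psdmx_invmx pA.
have := psdmx_mxtrace_conj (A *m X - Y) pV.
have -> : (A *m X - Y)^T *m invmx A *m (A *m X - Y) =
    X^T *m A *m X - X^T *m Y - (Y^T *m X - Y^T *m invmx A *m Y).
  rewrite [(_ - _)^T]linearB/= trmx_mul pA.1 mulmxBl mulmxK// mulmxBl !mulmxBr.
  by rewrite !mulmxA mulmxKV.
rewrite !mxtraceB -(mxtrace_tr (Y^T *m X)) trmx_mul trmxK.
set a := \tr (X^T *m A *m X); lra.
Qed.

(** The nuclear norm of Xi^1/2 Sigma^1/2, known as the quantum fidelity of the two matrices. *)
Definition fidelity (Sigma Xi : 'M[R]_n) : R :=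
  \tr (sqrtmx (sqrtmx Sigma *m Xi *m sqrtmx Sigma)).

Lemma psdmx_sandwich (Sigma Xi : 'M[R]_n) : psdmx Sigma -> psdmx Xi ->
  psdmx (sqrtmx Sigma *m Xi *m sqrtmx Sigma).
Proof.
by move=> pS pX; rewrite -{1}(sqrtmx_sym pS); exact: psdmx_conj.
Qed.

(** The polar factor of Xi^1/2 Sigma^1/2 aligns the two square roots. It enters the dual bound
    [fidelity_le] as well as the optimal coupling of [gelbrich_attained], and exists for singular
    matrices. *)
Lemma fidelity_polar (Sigma Xi : 'M[R]_n) : psdmx Sigma -> psdmx Xi ->
  exists O : 'M[R]_n, O^T *m O = 1%:M /\
    \tr (O^T *m sqrtmx Xi *m sqrtmx Sigma) = fidelity Sigma Xi.
Proof.
move=> pS pX; have pM := psdmx_sandwich pS pX.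
have [|O [OO NO]] := @polar _ _ (sqrtmx Xi *m sqrtmx Sigma) _ (sqrtmx_ge0 pM).
  rewrite trmx_mul !sqrtmx_sym// (sqrtmx_sqr pM) mulmxA -(mulmxA _ (sqrtmx Xi) (sqrtmx Xi)).
  by rewrite sqrtmx_sqr.
by exists O; split => //; rewrite -mulmxA NO mulmxA OO mul1mx.
Qed.

(** Weak duality: [young_mx] at X = Sigma^1/2 and Y = Xi^1/2 U, for which Y Y^T = Xi because U is
    orthogonal. *)
Lemma fidelity_le (Sigma Xi : 'M[R]_n) A : psdmx Sigma -> psdmx Xi ->
  psdmx A -> A \in unitmx ->
  2 * fidelity Sigma Xi <= \tr (A *m Sigma) + \tr (invmx A *m Xi).
Proof.
move=> pS pX pA uA; have [U [UU <-]] := fidelity_polar pS pX.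
have := @young_mx _ _ (sqrtmx Sigma) (sqrtmx Xi *m U) pA uA.
have -> : \tr ((sqrtmx Sigma)^T *m (sqrtmx Xi *m U)) =
    \tr (U^T *m sqrtmx Xi *m sqrtmx Sigma).
  by rewrite -mxtrace_tr !trmx_mul trmxK !sqrtmx_sym.
have -> : \tr ((sqrtmx Sigma)^T *m A *m sqrtmx Sigma) = \tr (A *m Sigma).
  by rewrite sqrtmx_sym// mxtrace_mulC mulmxA sqrtmx_sqr// mxtrace_mulC.
rewrite trmx_mul sqrtmx_sym// [X in _ <= _ + X]mxtrace_mulC !mulmxA.
rewrite -(mulmxA _ U U^T) (mulmx1C UU) mulmx1 sqrtmx_sqr//.
by rewrite (mxtrace_mulC Xi).
Qed.

Lemma conjD_unit (V : 'M[R]_n) (f : 'I_n -> R) : V^T *m V = 1%:M -> (forall i, f i != 0) ->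
  conjD V f \in unitmx /\ invmx (conjD V f) = conjD V (fun i => (f i)^-1).
Proof.
move=> VV f0.
have ff : conjD V f *m conjD V (fun i => (f i)^-1) = 1%:M.
  rewrite conjD_mul// -(conjD_cst VV); apply: eq_conjD => i.
  by rewrite mulfV.
have [uf _] := mulmx1_unit ff.
by split => //; rewrite -[LHS]mulmx1 -ff mulKmx.
Qed.

(* When [Sigma] and [K] are invertible, [A] is [S^-1 K S^-1] with [S = sqrtmx Sigma] and
   [K = sqrtmx (S Xi S)]; otherwise regularise both inverses. *)
Lemma fidelity_approx (Sigma Xi : 'M[R]_n) (eta : R) : psdmx Sigma -> psdmx Xi -> 0 < eta ->
  exists A, [/\ psdmx A, A \in unitmx &
    \tr (A *m Sigma) + \tr (invmx A *m Xi) <= 2 * fidelity Sigma Xi + eta].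
Proof.
move=> pS pX eta0; rewrite /fidelity.
have pM := psdmx_sandwich pS pX.
have KM := sqrtmx_sqr pM; have pK := sqrtmx_ge0 pM.
set S := sqrtmx Sigma in pM KM pK *.
set K := sqrtmx (S *m Xi *m S) in KM pK *.
have SS : S *m S = Sigma by exact: sqrtmx_sqr.
have pSS : psdmx S by exact: sqrtmx_ge0.
have [V [s [VV s0 SE]]] := psdmx_spectral pSS.
have [U [k [UU k0 KE]]] := psdmx_spectral pK.
(* Adding [delta] to the n eigenvalues of K raises the trace by n [delta], at most eta / 2; [n.+1]
   keeps the denominator positive in dimension 0. *)
pose delta := eta / (2 * n.+1%:R).
have delta0 : 0 < delta by rewrite divr_gt0// mulr_gt0.
have k1 i : k i + delta != 0 by rewrite gt_eqF// ltr_wpDl.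
have [Kd KdE] : exists Kd, Kd = conjD U (fun i => k i + delta) by eexists.
have uKd : Kd \in unitmx by rewrite KdE; have [] := conjD_unit UU k1.
have VKd : invmx Kd = conjD U (fun i => (k i + delta)^-1).
  by rewrite KdE; have [] := conjD_unit UU k1.
have pKd : psdmx Kd by rewrite KdE; apply: psdmx_conjD => // i; rewrite addr_ge0// ltW.
have pVKd : psdmx (invmx Kd) by exact: psdmx_invmx.
pose c1 := \tr (invmx Kd *m (S *m Xi + Xi *m S)).
pose c2 := \tr (invmx Kd *m Xi).
have c2_ge0 : 0 <= c2 by exact: psdmx_mxtrace_mul.
(* [eps] regularises S and is chosen after [delta], since [c1] and [c2] involve the inverse of [Kd].
   These are the coefficients of [eps] and [eps ^+ 2] in the second trace; [eps] at most 1 bounds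
   the square by [eps]. *)
pose eps := Num.min 1 (eta / (2 * (`|c1| + c2 + 1))).
have c0 : 0 < `|c1| + c2 + 1 by rewrite ltr_wpDl// addr_ge0.
have eps0 : 0 < eps by rewrite lt_min ltr01/= divr_gt0// mulr_gt0.
have eps1 : eps <= 1 by rewrite ge_min lexx.
have epsc : eps * c1 + eps ^+ 2 * c2 <= eta / 2.
  have H : eps * (`|c1| + c2 + 1) <= eta / 2.
    have : eps <= eta / (2 * (`|c1| + c2 + 1)) by rewrite ge_min lexx orbT.
    by rewrite ler_pdivlMr ?mulr_gt0// => H; lra.
  apply: le_trans H; have := ler_norm c1; rewrite expr2 => H1.
  have H2 : eps * eps * c2 <= eps * c2 by rewrite ler_wpM2r// ler_piMl// ltW.
  have H3 : eps * c1 <= eps * `|c1| by rewrite ler_pM2l.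
  lra.
have s1 i : s i + eps != 0 by rewrite gt_eqF// ltr_wpDl.
have [Se Se0] : exists Se, Se = conjD V (fun i => s i + eps) by eexists.
have SeE : Se = S + eps%:M by rewrite Se0 SE -(conjD_cst VV) conjDD.
have uSe : Se \in unitmx by rewrite Se0; have [] := conjD_unit VV s1.
have VSe : invmx Se = conjD V (fun i => (s i + eps)^-1).
  by rewrite Se0; have [] := conjD_unit VV s1.
have symSe : Se^T = Se by rewrite Se0 conjD_tr.
have symVSe : (invmx Se)^T = invmx Se by rewrite trmx_inv symSe.
exists (invmx Se *m Kd *m invmx Se); split.
- by rewrite -{1}symVSe; exact: psdmx_conj.
- by rewrite !unitmx_mul !unitmx_inv uSe uKd.
have -> : invmx (invmx Se *m Kd *m invmx Se) = Se *m invmx Kd *m Se.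
  apply: mulmx1_invmx; rewrite !mulmxA mulmxKV// (mulmxK uKd).
  by rewrite mulVmx.
have E1 : \tr (invmx Se *m Kd *m invmx Se *m Sigma) <= \tr K + eta / 2.
  (* The matrix Se^-1 S S Se^-1 is a function of S with eigenvalues at most 1, so this trace is at
     most that of [Kd]. For the other trace, the scalar inequality k^2 / (k + delta) <= k
     suffices. *)
  have -> : \tr (invmx Se *m Kd *m invmx Se *m Sigma) =
      \tr (Kd *m (invmx Se *m S *m S *m invmx Se)).
    by rewrite -SS -!mulmxA mxtrace_mulC !mulmxA.
  have -> : \tr K + eta / 2 = \tr (Kd *m 1%:M) + (eta / 2 - n%:R * delta).
    rewrite mulmx1 KE KdE !conjD_mxtrace// big_split/= sumr_const card_ord -mulr_natl.
    by ring.
  rewrite -subr_ge0 addrAC -linearB/= -mulmxBr addr_ge0//.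
    apply: psdmx_mxtrace_mul => //.
    rewrite VSe SE !conjD_mul// -(conjD_cst VV) -scaleN1r conjDZ conjDD.
    apply: psdmx_conjD => // i; rewrite mulN1r subr_ge0.
    rewrite -!mulrA mulrC -!mulrA -invfM mulrA ler_pdivrMr ?mul1r; last first.
      by rewrite mulr_gt0// ltr_wpDl.
    by have := s0 i; have := eps0; nra.
  have -> : n%:R * delta = eta / 2 * (n%:R / n.+1%:R) by rewrite /delta invfM; ring.
  rewrite subr_ge0; apply: ler_piMr; first by rewrite divr_ge0// ltW.
  by rewrite ler_pdivrMr// mul1r ler_nat.
have E2 : \tr (Se *m invmx Kd *m Se *m Xi) <= \tr K + eta / 2.
  have -> : \tr (Se *m invmx Kd *m Se *m Xi) =
      \tr (invmx Kd *m (K *m K)) + (eps * c1 + eps ^+ 2 * c2).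
    rewrite /c1 /c2 KM -!mxtraceZ -!mxtraceD !scalemxAr -!mulmxDr.
    rewrite -2!mulmxA mxtrace_mulC -!mulmxA; congr (\tr (_ *m _)).
    rewrite SeE mulmxDl !mulmxDr mul_scalar_mx !mul_mx_scalar mulmxA -!addrA.
    by rewrite -scalemxAr mul_scalar_mx scalerA -expr2 scalerDr -!addrA.
  rewrite lerD//.
  rewrite VKd KE !conjD_mul// !conjD_mxtrace// ler_sum// => i _.
  rewrite mulrC ler_pdivrMr ?ltr_wpDl// mulrDr lerDl mulr_ge0//.
  exact: ltW.
by lra.
Qed.

End duality.

Section transport.
Context {R : realType} {n : nat}.
Implicit Types (A S K N T D : 'M[R]_n) (Sigma Xi : 'M[R]_n).

Lemma sqrtmx_unit A : psdmx A -> A \in unitmx -> sqrtmx A \in unitmx.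
Proof.
by move=> pA; rewrite -{1}(sqrtmx_sqr pA) unitmx_mul => /andP[].
Qed.

(** The matrix of the Brenier map from N(0, Sigma) to N(0, Xi): by [otmap_sandwich] it transports
    one covariance onto the other, and its inverse transports back. *)
Definition otmap Sigma Xi : 'M[R]_n :=
  invmx (sqrtmx Sigma) *m sqrtmx (sqrtmx Sigma *m Xi *m sqrtmx Sigma) *m
  invmx (sqrtmx Sigma).

Section otmap.
Variables (Sigma Xi : 'M[R]_n).
Hypotheses (pS : psdmx Sigma) (pX : psdmx Xi).
Hypotheses (uS : Sigma \in unitmx) (uX : Xi \in unitmx).

Lemma otmap_psd : psdmx (otmap Sigma Xi).
Proof.
have E : (invmx (sqrtmx Sigma))^T = invmx (sqrtmx Sigma).
  by rewrite trmx_inv sqrtmx_sym.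
rewrite /otmap -{1}E; apply: psdmx_conj; apply: sqrtmx_ge0.
exact: psdmx_sandwich.
Qed.

Lemma otmapM : otmap Sigma Xi *m Sigma = invmx (sqrtmx Sigma) *m
  sqrtmx (sqrtmx Sigma *m Xi *m sqrtmx Sigma) *m sqrtmx Sigma.
Proof.
have uR := sqrtmx_unit pS uS.
by rewrite /otmap -[X in _ *m X = _](sqrtmx_sqr pS) mulmxA mulmxKV.
Qed.

Lemma otmap_sandwich : otmap Sigma Xi *m Sigma *m otmap Sigma Xi = Xi.
Proof.
have uR := sqrtmx_unit pS uS; have pM := psdmx_sandwich pS pX.
rewrite otmapM /otmap !mulmxA (mulmxK uR) -(mulmxA _ (sqrtmx _) (sqrtmx _)).
by rewrite sqrtmx_sqr// !mulmxA mulVmx// mul1mx mulmxK.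
Qed.

Lemma otmap_unit : otmap Sigma Xi \in unitmx.
Proof.
by have := uX; rewrite -{1}otmap_sandwich 2!unitmx_mul => /andP[/andP[]].
Qed.

Lemma otmap_inv_sandwich :
  invmx (otmap Sigma Xi) *m Xi *m invmx (otmap Sigma Xi) = Sigma.
Proof.
have uT := otmap_unit.
rewrite -[X in _ *m X *m _]otmap_sandwich.
by rewrite -[otmap _ _ *m _ *m _]mulmxA mulKmx// mulmxK.
Qed.

(** Together with [otmap_inv_mxtrace], this says that the transport map attains equality in
    [fidelity_le]. *)
Lemma otmap_mxtrace : \tr (otmap Sigma Xi *m Sigma) = fidelity Sigma Xi.
Proof.
have uR := sqrtmx_unit pS uS.
by rewrite otmapM mxtrace_mulC !mulmxA mulmxV// mul1mx.
Qed.

Lemma otmap_inv_mxtrace :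
  \tr (invmx (otmap Sigma Xi) *m Xi) = fidelity Sigma Xi.
Proof.
have uT := otmap_unit.
rewrite -[X in _ *m X]otmap_sandwich -[otmap _ _ *m _ *m _]mulmxA mulKmx//.
by rewrite mxtrace_mulC otmap_mxtrace.
Qed.

End otmap.

Definition coercive (c : R) A := forall x : 'cV[R]_n, c * dot x x <= dot x (A *m x).

Lemma psdmx_coercive A : psdmx A -> A \in unitmx ->
  exists2 c, 0 < c & coercive c A.
Proof.
move=> pA uA; have [V [f [VV f0 AE]]] := psdmx_spectral pA.
have fgt0 i : 0 < f i.
  rewrite lt_neqAle f0 andbT eq_sym; apply/eqP => fi0.
  have := conjD_col VV f i; rewrite -AE fi0 scale0r => Ai.
  have := dot_col_orth VV i i; rewrite -[col i V](mulKmx uA) Ai mulmx0 dot0l eqxx.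
  by move/eqP; rewrite eq_sym oner_eq0.
(* The smallest eigenvalue, capped at 1 so that the bound is positive in dimension 0 too. *)
exists (\big[Num.min/1]_i f i).
  by elim/big_ind : _ => // x y x0 y0; rewrite lt_min x0.
move=> x; rewrite AE dot_conjD -(dot_orth VV) dotE mulr_sumr ler_sum// => i _.
rewrite -expr2 ler_wpM2r ?sqr_ge0//.
by rewrite (bigD1 i)//= ge_min lexx.
Qed.

Lemma coercive_frob c A m (X : 'M[R]_(n, m)) : coercive c A ->
  c * frob X <= \tr (X^T *m A *m X).
Proof. by move=> cA; rewrite mxtrace_conj frobE mulr_sumr ler_sum. Qed.

Lemma coercive_sqr c A : 0 < c -> A^T = A -> coercive c A -> coercive (c ^+ 2) (A *m A).
Proof.
move=> c0 symA cA x; rewrite -mulmxA dot_trmx symA.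
have [->|x0] := eqVneq x 0; first by rewrite !dot0r mulr0 mulmx0 dot0r.
have x1 := dot_gt0 x0; rewrite -(ler_pM2l x1).
apply: le_trans (dot_cauchy x (A *m x)).
rewrite mulrCA -expr2 -exprMn ler_pXn2r ?nnegrE ?mulr_ge0 ?dot_ge0 ?(ltW c0)//.
by apply: le_trans (cA x); rewrite mulr_ge0 ?dot_ge0// ltW.
Qed.

(** The difference D = T' - T solves T' Sigma' D + D Sigma' T = E, where E is linear in the two
    increments. Testing this Sylvester equation against Sigma' D Sigma' gives two nonnegative
    traces: the one with T' is dropped, the one with T is at least t c^3 times [frob D]. *)
Lemma transport_lipschitz (c t b : R) Sigma Sigma' Xi Xi' T T' :
  0 < c -> 0 < t -> 0 < b ->
  psdmx Sigma' -> coercive c Sigma' -> frob Sigma' <= b ->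
  T^T = T -> coercive t T -> psdmx T' ->
  T *m Sigma *m T = Xi -> T' *m Sigma' *m T' = Xi' ->
  frob (T' - T) <= 2 * (b / (t * c ^+ 3)) ^+ 2 * (1 + frob T ^+ 2) *
     (frob (Sigma' - Sigma) + frob (Xi' - Xi)).
Proof.
move=> c0 t0 b0 pS' cS' bS' symT cT pT' TX TX'.
have symS' := pS'.1; have symT' := pT'.1.
have [D DE] : exists D, D = T' - T by eexists.
have symD : D^T = D by rewrite DE linearB/= symT' symT.
have [S SE] : exists S, S = sqrtmx Sigma' by eexists.
have SS : S *m S = Sigma' by rewrite SE sqrtmx_sqr.
have symS : S^T = S by rewrite SE sqrtmx_sym.
pose E := Xi' - Xi - T *m (Sigma' - Sigma) *m T.
have EE : E = T' *m Sigma' *m D + D *m Sigma' *m T.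
  have -> : D *m Sigma' *m T = T' *m Sigma' *m T - T *m Sigma' *m T.
    by rewrite DE !mulmxBl.
  have -> : T' *m Sigma' *m D = T' *m Sigma' *m T' - T' *m Sigma' *m T.
    by rewrite DE mulmxBr.
  have ET : T *m (Sigma' - Sigma) *m T = T *m Sigma' *m T - T *m Sigma *m T.
    by rewrite mulmxBr mulmxBl.
  by rewrite /E ET -TX -TX' addrA subrK opprB addrA subrK.
pose X := Sigma' *m D *m S.
have XE T0 : \tr (X^T *m T0 *m X) =
    \tr (Sigma' *m D *m Sigma' *m T0 *m Sigma' *m D).
  rewrite /X !trmx_mul symS' symD symS !mulmxA mxtrace_mulC !mulmxA.
  by rewrite SS.
have trE : \tr ((Sigma' *m D *m Sigma')^T *m E) = \tr (X^T *m T' *m X) + \tr (X^T *m T *m X).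
  rewrite EE mulmxDr mxtraceD !XE !trmx_mul symS' symD !mulmxA; congr (_ + _).
  have -> : Sigma' *m D *m Sigma' *m D *m Sigma' *m T =
    (Sigma' *m D) *m (Sigma' *m D *m Sigma' *m T) by rewrite !mulmxA.
  by rewrite mxtrace_mulC !mulmxA.
have pX : 0 <= \tr (X^T *m T' *m X) by exact: psdmx_mxtrace_conj.
have tX : t * frob X <= \tr (X^T *m T *m X) by exact: coercive_frob.
have cX : c ^+ 3 * frob D <= frob X.
  have -> : frob X = \tr ((D *m S)^T *m (Sigma' *m Sigma') *m (D *m S)).
    by rewrite /frob /X !trmx_mul symS' !mulmxA.
  apply: le_trans (coercive_frob (D *m S) (coercive_sqr c0 symS' cS')).
  rewrite exprSr -mulrA ler_pM2l ?exprn_gt0//.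
  rewrite -(frob_tr (D *m S)) trmx_mul symS symD.
  have -> : frob (S *m D) = \tr (D^T *m Sigma' *m D).
    by rewrite /frob trmx_mul symS -SS !mulmxA.
  exact: coercive_frob.
have bD : frob (Sigma' *m D *m Sigma') <= b ^+ 2 * frob D.
  apply: le_trans (frob_mulmx _ _) _; apply: (@le_trans _ _ (b * frob D * b)).
    apply: ler_pM; rewrite ?frob_ge0//; apply: le_trans (frob_mulmx _ _) _.
    by rewrite ler_wpM2r ?frob_ge0.
  by rewrite mulrAC expr2.
have E2 : frob E <= 2 * (1 + frob T ^+ 2) * (frob (Sigma' - Sigma) + frob (Xi' - Xi)).
  apply: le_trans (frobD _ _) _; rewrite frobN -mulrA ler_pM2l//.
  have : frob (T *m (Sigma' - Sigma) *m T) <= frob T ^+ 2 * frob (Sigma' - Sigma).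
    apply: le_trans (frob_mulmx _ _) _; rewrite expr2 mulrAC.
    by rewrite ler_wpM2r ?frob_ge0// frob_mulmx.
  have := frob_ge0 (Sigma' - Sigma); have := frob_ge0 (Xi' - Xi).
  have := sqr_ge0 (frob T).
  set x := frob T ^+ 2; set y := frob (_ - _); set z := frob (_ - _); nra.
have tc0 : 0 < t * c ^+ 3 by rewrite mulr_gt0// exprn_gt0.
(* With this weight the term in D produced by the Young inequality is at most t c^3 [frob D], and is
   absorbed by twice the lower bound of the left-hand side. *)
have k0 : 0 < t * c ^+ 3 / b ^+ 2 by rewrite divr_gt0// exprn_gt0.
have := mxtrace_mul_frob (Sigma' *m D *m Sigma') E k0.
rewrite trE -DE => H.
have H1 : t * c ^+ 3 * frob D <= (b ^+ 2 / (t * c ^+ 3)) * frob E.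
  have H2 : t * c ^+ 3 / b ^+ 2 * frob (Sigma' *m D *m Sigma') <= t * c ^+ 3 * frob D.
    rewrite -mulrA ler_pM2l// mulrC ler_pdivrMr ?exprn_gt0//.
    by rewrite (mulrC (frob D)).
  have H3 : t * c ^+ 3 * frob D <= t * frob X by rewrite -mulrA ler_pM2l.
  rewrite invf_div in H.
  have := ler_norm (\tr (X^T *m T' *m X) + \tr (X^T *m T *m X)); lra.
have H4 : frob D <= (b / (t * c ^+ 3)) ^+ 2 * frob E.
  rewrite -(ler_pM2l tc0); apply: le_trans H1 _.
  apply: le_of_eq; field.
  by rewrite !gt_eqF.
apply: le_trans H4 _; apply: le_trans (ler_wpM2l (sqr_ge0 _) E2) _.
by apply: le_of_eq; ring.
Qed.

Lemma coercive_near (c : R) A B : 0 < c -> coercive c A ->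
  frob (B - A) <= (c / 2) ^+ 2 -> coercive (c / 2) B.
Proof.
move=> c0 cA BA x; have := cA x.
have -> : B = A + (B - A) by rewrite addrC subrK.
rewrite mulmxDl dotDr; set y := dot x ((B - A) *m x).
have : `|y| <= c / 2 * dot x x.
  rewrite -(@ler_pXn2r _ 2)// ?nnegrE ?mulr_ge0 ?dot_ge0 ?(ltW c0)//.
  rewrite real_normK ?num_real//; apply: le_trans (dot_cauchy _ _) _.
  have H : dot ((B - A) *m x) ((B - A) *m x) <= (c / 2) ^+ 2 * dot x x.
    by apply: le_trans (dot_frob _ _) _; rewrite ler_wpM2r ?dot_ge0.
  apply: le_trans (ler_wpM2l (dot_ge0 x) H) _.
  by apply: le_of_eq; ring.
by rewrite ler_norml => /andP[+ _]; lra.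
Qed.

Lemma coercive_unit (c : R) A : 0 < c -> psdmx A -> coercive c A -> A \in unitmx.
Proof.
move=> c0 pA cA; have [V [f [VV f0 AE]]] := psdmx_spectral pA.
have f1 i : f i != 0.
  have := cA (col i V); rewrite AE conjD_col// dotZr dot_col_orth// eqxx !mulr1.
  by move=> cf; rewrite gt_eqF// (lt_le_trans c0).
by rewrite AE; have [] := conjD_unit VV f1.
Qed.

(* Testing the duality at [Sigma, Xi] with the optimal map of the perturbed pair, and
   conversely, squeezes the remainder by products of increments of the map and of the
   matrices. *)
Lemma fidelity_expansion Sigma Xi : psdmx Sigma -> psdmx Xi ->
  Sigma \in unitmx -> Xi \in unitmx ->
  exists C eta : R, [/\ 0 < eta, 0 <= C & forall Sigma' Xi' : 'M[R]_n,
    psdmx Sigma' -> psdmx Xi' ->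
    frob (Sigma' - Sigma) <= eta -> frob (Xi' - Xi) <= eta ->
    `|2 * fidelity Sigma' Xi' - 2 * fidelity Sigma Xi
      - \tr (otmap Sigma Xi *m (Sigma' - Sigma))
      - \tr (invmx (otmap Sigma Xi) *m (Xi' - Xi))|
    <= C * (frob (Sigma' - Sigma) + frob (Xi' - Xi))].
Proof.
move=> pS pX uS uX.
have [T TE] : exists T, T = otmap Sigma Xi by eexists.
have pT : psdmx T by rewrite TE; exact: otmap_psd.
have uT : T \in unitmx by rewrite TE; exact: otmap_unit.
have pTi := psdmx_invmx pT.
have uTi : invmx T \in unitmx by rewrite unitmx_inv.
have [c c0 cS] := psdmx_coercive pS uS.
have [e e0 cX] := psdmx_coercive pX uX.
have [t t0 cT] := psdmx_coercive pT uT.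
have [u u0 cTi] := psdmx_coercive pTi uTi.
(* Within this squared radius the perturbed matrices keep half of their coercivity constants; they
   stay invertible, so their own transport map is available. *)
pose eta := Num.min ((c / 2) ^+ 2) ((e / 2) ^+ 2).
have eta0 : 0 < eta by rewrite lt_min !exprn_gt0// divr_gt0.
pose b A := 2 * (frob A + eta).
have b0 A : 0 < b A by rewrite mulr_gt0// ltr_wpDl// frob_ge0.
pose K (c t b : R) A := 2 * (b / (t * c ^+ 3)) ^+ 2 * (1 + frob A ^+ 2).
have K0 c' t' b' A : 0 <= K c' t' b' A.
  apply: mulr_ge0; first by apply: mulr_ge0 => //; exact: sqr_ge0.
  by apply: addr_ge0 => //; exact: sqr_ge0.
pose C1 := K (c / 2) t (b Sigma) T.
pose C2 := K (e / 2) u (b Xi) (invmx T).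
exists (C1 + C2 + 1), eta; split => //.
  by rewrite !addr_ge0// K0.
move=> Sigma' Xi' pS' pX' dS dX; rewrite -TE.
have near A B : frob (B - A) <= eta -> frob B <= b A.
  move=> BA; rewrite -[B](subrK A) [_ + A]addrC; apply: le_trans (frobD _ _) _.
  by rewrite ler_pM2l// lerD2l.
have cS' : coercive (c / 2) Sigma'.
  by apply: coercive_near cS _ => //; apply: le_trans dS _; rewrite ge_min lexx.
have cX' : coercive (e / 2) Xi'.
  by apply: coercive_near cX _ => //; apply: le_trans dX _; rewrite ge_min lexx orbT.
have c20 : 0 < c / 2 by rewrite divr_gt0.
have e20 : 0 < e / 2 by rewrite divr_gt0.
have uS' := coercive_unit c20 pS' cS'.
have uX' := coercive_unit e20 pX' cX'.
have [T' T'E] : exists T', T' = otmap Sigma' Xi' by eexists.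
have pT' : psdmx T' by rewrite T'E; exact: otmap_psd.
have uT' : T' \in unitmx by rewrite T'E; exact: otmap_unit.
have pT'i := psdmx_invmx pT'.
set dSig := frob (Sigma' - Sigma) in dS *; set dXi := frob (Xi' - Xi) in dX *.
have LT : frob (T' - T) <= C1 * (dSig + dXi).
  apply: transport_lipschitz => //; first exact: near.
  - exact: pT.1.
  - by rewrite TE; exact: otmap_sandwich.
  - by rewrite T'E; exact: otmap_sandwich.
(* The inverse map transports Xi to Sigma, so the same Lipschitz bound applies with the two matrices
   exchanged. *)
have LTi : frob (invmx T' - invmx T) <= C2 * (dXi + dSig).
  apply: transport_lipschitz => //; first exact: near.
  - exact: pTi.1.
  - by rewrite TE; exact: otmap_inv_sandwich.
  - by rewrite T'E; exact: otmap_inv_sandwich.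
have F : 2 * fidelity Sigma Xi = \tr (T *m Sigma) + \tr (invmx T *m Xi).
  by rewrite TE otmap_mxtrace// otmap_inv_mxtrace// mulr2n mulrDl !mul1r.
have F' : 2 * fidelity Sigma' Xi' = \tr (T' *m Sigma') + \tr (invmx T' *m Xi').
  by rewrite T'E otmap_mxtrace// otmap_inv_mxtrace// mulr2n mulrDl !mul1r.
(* By [up] the remainder is nonpositive; by [lo] it is at least tr((T' - T)(Sigma' - Sigma)) plus
   the analogous trace for the inverses. Both factors of each product are small, which gives the
   quadratic order. *)
have up := fidelity_le pS' pX' pT uT.
have lo := fidelity_le pS pX pT' uT'.
have := @mxtrace_mul_frob _ _ _ 1 (T' - T) (Sigma' - Sigma) ltr01.
have := @mxtrace_mul_frob _ _ _ 1 (invmx T' - invmx T) (Xi' - Xi) ltr01.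
rewrite invr1 !mul1r -/dSig -/dXi => H1 H2.
have symD A B : psdmx A -> psdmx B -> (A - B)^T = A - B.
  by move=> pA pB; rewrite linearB/= pA.1 pB.1.
rewrite !symD// in H1 H2.
have expand A B C D : \tr ((A - B) *m (C - D)) =
    \tr (A *m C) - \tr (A *m D) - (\tr (B *m C) - \tr (B *m D)).
  by rewrite mulmxBl !mulmxBr !mxtraceB.
rewrite !expand in H1 H2.
rewrite !mulmxBr !mxtraceB ler_norml.
have d0 : 0 <= dSig by exact: frob_ge0.
have d1 : 0 <= dXi by exact: frob_ge0.
have n1 := ler_norm (- (\tr (invmx T' *m Xi') - \tr (invmx T' *m Xi) -
          (\tr (invmx T *m Xi') - \tr (invmx T *m Xi)))).
have n2 := ler_norm (- (\tr (T' *m Sigma') - \tr (T' *m Sigma) -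
          (\tr (T *m Sigma') - \tr (T *m Sigma)))).
rewrite !normrN in n1 n2.
have CC1 : 0 <= C1 * (dSig + dXi) by rewrite mulr_ge0 ?addr_ge0// K0.
have CC2 : 0 <= C2 * (dSig + dXi) by rewrite mulr_ge0 ?addr_ge0// K0.
rewrite (addrC dXi) in LTi; rewrite !mulrDl mul1r.
by apply/andP; split; lra.
Qed.

End transport.

(** * Gaussian vectors *)

Section density.
Context d (T : measurableType d) {R : realType}.
Local Open Scope ereal_scope.
Import HBNNSimple.
Variables (m n : {measure set T -> \bar R}) (g : T -> R).
Hypotheses (mg : measurable_fun setT g) (g0 : forall x, (0 <= g x)%R).
Hypothesis nE : forall A, measurable A -> n A = \int[m]_(x in A) (g x)%:E.

Lemma integral_density_nnsfun (h : {nnsfun T >-> R}) :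
  \int[n]_x (h x)%:E = \int[m]_x ((h x)%:E * (g x)%:E).
Proof.
under [LHS]eq_integral do rewrite fimfunE -fsumEFin//.
rewrite [LHS]ge0_integral_fsum//; last 2 first.
  - by move=> r; exact/measurable_EFinP/measurableT_comp.
  - by move=> k x _; rewrite EFinM nnfun_muleindic_ge0.
under [RHS]eq_integral.
  move=> x xD; rewrite fimfunE -fsumEFin// muleC ge0_mule_fsumr; last first.
    by move=> r; rewrite EFinM nnfun_muleindic_ge0.
  over.
rewrite [RHS]ge0_integral_fsum//; last 2 first.
  - move=> r; apply: emeasurable_funM; first exact/measurable_EFinP.
    by apply/measurable_EFinP/measurableT_comp.
  - move=> k x _; apply: mule_ge0; first by rewrite lee_fin.
    by rewrite EFinM nnfun_muleindic_ge0.
apply: eq_fsbigr => r _.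
rewrite integralZl_indic_nnsfun//= integral_indic// setIT nE//.
have [r0|r0] := leP 0%R r; last first.
  rewrite preimage_nnfun0// integral_set0 mule0 integral0_eq// => x _.
  by rewrite indicE in_set0 mulr0 mule0.
have -> : \int[m]_(x in h @^-1` [set r]) (g x)%:E =
    \int[m]_x (g x * \1_(h @^-1` [set r]) x)%:E.
  rewrite integral_mkcond; apply: eq_integral => x _; rewrite patchE indicE.
  by case: (x \in _); rewrite ?mulr1 ?mulr0.
rewrite -ge0_integralZl//.
- by apply: eq_integral => x _; rewrite -!EFinM mulrCA.
- by apply/measurable_EFinP; apply: measurable_funM.
- by move=> x _; rewrite lee_fin mulr_ge0.
Qed.

Lemma ge0_integral_density (f : T -> \bar R) : measurable_fun setT f ->
  (forall x, 0 <= f x) -> \int[n]_x f x = \int[m]_x (f x * (g x)%:E).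
Proof.
move=> mf f0; pose f_ := nnsfun_approx measurableT mf.
transitivity (limn (fun k => \int[n]_x (f_ k x)%:E)).
  rewrite -monotone_convergence//=.
  - apply: eq_integral => x _; apply/esym/cvg_lim => //=.
    exact: cvg_nnsfun_approx.
  - by move=> k; apply: measurableT_comp => //; exact: measurable_funTS.
  - by move=> k x _; rewrite lee_fin.
  - by move=> x _ a b ab; rewrite lee_fin//; exact/lefP/nd_nnsfun_approx.
rewrite (_ : \int[m]_x _ =
    limn (fun k => \int[m]_x ((f_ k x)%:E * (g x)%:E))); last first.
  rewrite -monotone_convergence//=.
  - apply: eq_integral => x _; apply/esym/cvg_lim => //.
    apply: cvgeMr => //; exact: cvg_nnsfun_approx.
  - move=> k; apply: emeasurable_funM; last exact/measurable_EFinP.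
    by apply/measurable_EFinP.
  - by move=> k x _; rewrite mule_ge0 ?lee_fin.
  - move=> x _ a b ab; apply: lee_pmul; rewrite ?lee_fin//.
    by exact/lefP/nd_nnsfun_approx.
by congr (limn _); apply/funext => k; rewrite integral_density_nnsfun.
Qed.

End density.

Section normal_plane.
Context {R : realType}.
Local Notation mR := (measurableTypeR R).
Local Notation lambda := (@lebesgue_measure R).
Local Notation gamma := (@normal_prob R 0 1).
Local Open Scope ereal_scope.

Lemma lebesgue_measure_shift (c : R) (A : set mR) : measurable A ->
  lambda A = lambda ((fun x => x + c)%R @^-1` A).
Proof.
have mc : measurable_fun setT (fun x : mR => x + c : mR)%R.
  exact: measurable_funD.
move=> mA; rewrite -[RHS]/(pushforward lambda (fun x : mR => x + c : mR)%R A).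
apply: lebesgue_measure_unique => // _ [[a b]] _ <- /=.
rewrite /pushforward (_ : _ @^-1` _ = `](a - c)%R, (b - c)%R]%classic); last first.
  by apply/seteqP; split => x /=; rewrite !in_itv/= ltrBlDr lerBrDr.
rewrite !lebesgue_measure_itv/= !lte_fin ltrD2r.
by case: ifP => // _; rewrite -!EFinB; congr EFin; rewrite opprB addrA addrNK.
Qed.

Lemma ge0_integral_shift (c : R) (f : mR -> \bar R) : measurable_fun setT f ->
  (forall x, 0 <= f x) -> \int[lambda]_x f (x + c)%R = \int[lambda]_x f x.
Proof.
move=> mf f0.
have mc : measurable_fun setT (fun x : mR => x + c : mR)%R.
  exact: measurable_funD.
rewrite [RHS](eq_measure_integral (pushforward lambda (fun x : mR => x + c : mR)%R)).
  by rewrite ge0_integral_pushforward.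
by move=> A mA _; exact: lebesgue_measure_shift.
Qed.

Lemma ge0_integral_normal (f : mR -> \bar R) : measurable_fun setT f ->
  (forall x, 0 <= f x) ->
  \int[gamma]_x f x = \int[lambda]_x (f x * (normal_pdf 0 1 x)%:E).
Proof.
move=> mf f0; apply: ge0_integral_density => //.
  exact: measurable_normal_pdf.
exact: normal_pdf_ge0.
Qed.

Lemma ge0_integral_shear (t : R) (F : mR * mR -> \bar R) :
  measurable_fun setT F -> (forall z, 0 <= F z) ->
  \int[lambda]_x \int[lambda]_y F (x + t * y, y)%R =
  \int[lambda]_x \int[lambda]_y F (x, y).
Proof.
move=> mF F0.
have mG : measurable_fun setT (fun z : mR * mR => F ((z.1 + t * z.2 : mR)%R, z.2)).
  apply: (measurableT_comp mF); apply/measurable_fun_pair => //.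
  by apply: measurable_funD => //; apply: measurable_funM.
apply: (etrans (fubini_tonelli _ mG (fun z => F0 _))).
apply: (etrans _ (esym (fubini_tonelli _ mF F0))).
apply: eq_integral => y _ /=.
apply: (ge0_integral_shift _ (f := fun x => F (x, y))) => //.
exact: measurableT_comp mF (measurable_pair2 y).
Qed.

Lemma ge0_integral_shear2 (t : R) (F : mR * mR -> \bar R) :
  measurable_fun setT F -> (forall z, 0 <= F z) ->
  \int[lambda]_x \int[lambda]_y F (x, y + t * x)%R =
  \int[lambda]_x \int[lambda]_y F (x, y).
Proof.
move=> mF F0; apply: eq_integral => x _.
apply: (ge0_integral_shift _ (f := fun y => F (x, y))) => //.
exact: measurableT_comp mF (measurable_pair1 x).
Qed.

Definition rot (c s : R) (z : mR * mR) : mR * mR :=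
  (c * z.1 - s * z.2, s * z.1 + c * z.2)%R.

Lemma measurable_rot c s : measurable_fun setT (rot c s).
Proof.
apply/measurable_fun_pair.
  by apply: measurable_funB => //; apply: measurable_funM.
by apply: measurable_funD => //; apply: measurable_funM.
Qed.

(** A rotation of angle theta is a product of three shears, with t = - tan(theta / 2). Each shear is
    a translation in one variable, so translation invariance on the line and Tonelli's theorem
    suffice. The value c = -1 has no such factorisation. *)
Lemma ge0_integral_rot_lebesgue (c s : R) (F : mR * mR -> \bar R) :
  (c ^+ 2 + s ^+ 2 = 1)%R -> c != (- 1)%R ->
  measurable_fun setT F -> (forall z, 0 <= F z) ->
  \int[lambda]_x \int[lambda]_y F (rot c s (x, y)) =
  \int[lambda]_x \int[lambda]_y F (x, y).
Proof.
move=> cs c1 mF F0; pose t := (- (s / (1 + c)))%R.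
have c0 : (1 + c != 0)%R by rewrite addrC addr_eq0.
pose sx (z : mR * mR) : mR * mR := ((z.1 + t * z.2)%R, z.2).
pose sy (z : mR * mR) : mR * mR := (z.1, (z.2 + s * z.1)%R).
have msx : measurable_fun setT sx.
  apply/measurable_fun_pair => //.
  by apply: measurable_funD => //; apply: measurable_funM.
have msy : measurable_fun setT sy.
  apply/measurable_fun_pair => //.
  by apply: measurable_funD => //; apply: measurable_funM.
have rotE z : rot c s z = sx (sy (sx z)).
  have s2 : (s ^+ 2 = (1 - c) * (1 + c))%R.
    have -> : (s ^+ 2 = 1 - c ^+ 2)%R by rewrite -cs addrAC subrr add0r.
    by ring.
  rewrite /rot /sx /sy /t; congr (_, _) => /=.
    apply/eqP; rewrite -subr_eq0; apply/eqP.
    rewrite [LHS](_ : _ = (z.1 * (c - 1) * (1 + c) + z.1 * s ^+ 2) / (1 + c) +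
      (z.2 * s * (- (1 + c) * (1 + c) + (1 + c) + (1 + c) - s ^+ 2)) / (1 + c) ^+ 2)%R.
      by rewrite s2; field.
    by field.
  apply/eqP; rewrite -subr_eq0; apply/eqP.
  rewrite [LHS](_ : _ = (z.2 * ((c - 1) * (1 + c) + s ^+ 2)) / (1 + c))%R.
    by rewrite s2; field.
  by field.
have mF1 : measurable_fun setT (F \o sx) by exact: measurableT_comp.
have mF2 := measurableT_comp mF1 msy.
have E1 := @ge0_integral_shear t _ mF2 (fun z => F0 _).
have E2 := @ge0_integral_shear2 s _ mF1 (fun z => F0 _).
have E3 := @ge0_integral_shear t _ mF F0.
transitivity (\int[lambda]_x \int[lambda]_y F (sx (sy (sx (x, y))))).
  by apply: eq_integral => x _; apply: eq_integral => y _; rewrite rotE.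
exact: (etrans E1 (etrans E2 E3)).
Qed.

Lemma normal_pdf_rot c s (z : mR * mR) : (c ^+ 2 + s ^+ 2 = 1)%R ->
  (normal_pdf 0 1 (rot c s z).1 * normal_pdf 0 1 (rot c s z).2 =
   normal_pdf 0 1 z.1 * normal_pdf 0 1 z.2)%R.
Proof.
move=> cs; rewrite !normal_pdfE ?oner_eq0// /normal_fun !subr0.
rewrite -!mulrA; congr (_ * _)%R; rewrite !(mulrCA (expR _)); congr (_ * _)%R.
rewrite -!expRD; congr expR; rewrite -!mulrDl; congr (_ / _)%R.
rewrite -!opprD; congr (- _)%R => /=.
rewrite [LHS](_ : _ = (c ^+ 2 + s ^+ 2) * (z.1 ^+ 2 + z.2 ^+ 2))%R; last by ring.
by rewrite cs mul1r.
Qed.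

Lemma ge0_integral_normal2 (F : mR * mR -> \bar R) :
  measurable_fun setT F -> (forall z, 0 <= F z) ->
  \int[gamma]_x \int[gamma]_y F (x, y) =
  \int[lambda]_x \int[lambda]_y
    (F (x, y) * (normal_pdf 0 1 x * normal_pdf 0 1 y)%:E).
Proof.
move=> mF F0; rewrite ge0_integral_normal; last 2 first.
  - exact: measurable_fun_fubini_tonelli_F.
  - by move=> x; exact: integral_ge0.
apply: eq_integral => x _; rewrite ge0_integral_normal//; last first.
  exact: measurableT_comp mF (measurable_pair1 x).
rewrite -ge0_integralZr//.
- by apply: eq_integral => y _; rewrite EFinM -muleA (muleC (normal_pdf 0 1 y)%:E).
- apply: emeasurable_funM; first exact: measurableT_comp mF (measurable_pair1 x).
  by apply/measurable_EFinP; exact: measurable_normal_pdf.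
- by move=> y _; rewrite mule_ge0// lee_fin normal_pdf_ge0.
- by rewrite lee_fin normal_pdf_ge0.
Qed.

Lemma ge0_integral_rot (c s : R) (F : mR * mR -> \bar R) :
  (c ^+ 2 + s ^+ 2 = 1)%R ->
  measurable_fun setT F -> (forall z, 0 <= F z) ->
  \int[gamma]_x \int[gamma]_y F (rot c s (x, y)) =
  \int[gamma]_x \int[gamma]_y F (x, y).
Proof.
(* The half turn is the quarter turn applied twice, which brings it back to the case of three
   shears. *)
wlog : c s F / c != (- 1)%R.
  move=> wl cs mF F0; have [c1|c1] := eqVneq c (- 1)%R; last exact: wl.
  have s0 : s = 0%R by move: cs; rewrite c1; nra.
  have rotE z : rot c s z = rot 0 1 (rot 0 1 z).
    by rewrite /rot c1 s0 /=; congr (_, _); ring.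
  have h01 : (0 != - 1 :> R)%R by rewrite eq_sym oppr_eq0 oner_eq0.
  have e01 : (0 ^+ 2 + 1 ^+ 2 = 1 :> R)%R by rewrite expr0n expr1n add0r.
  have mF1 := measurableT_comp mF (measurable_rot 0 1).
  have E1 := wl 0%R 1%R _ h01 e01 mF1 (fun z => F0 _).
  have E2 := wl 0%R 1%R _ h01 e01 mF F0.
  transitivity (\int[gamma]_x \int[gamma]_y F (rot 0 1 (rot 0 1 (x, y)))).
    by apply: eq_integral => x _; apply: eq_integral => y _; rewrite rotE.
  exact: (etrans E1 E2).
move=> c1 cs mF F0.
have mF1 := measurableT_comp mF (measurable_rot c s).
apply: (etrans (ge0_integral_normal2 mF1 (fun z => F0 _))).
apply: (etrans _ (esym (ge0_integral_normal2 mF F0))).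
pose G (z : mR * mR) := F z * (normal_pdf 0 1 z.1 * normal_pdf 0 1 z.2)%:E.
transitivity (\int[lambda]_x \int[lambda]_y G (rot c s (x, y))).
  apply: eq_integral => x _; apply: eq_integral => y _.
  by rewrite /G normal_pdf_rot.
apply: ge0_integral_rot_lebesgue => //.
  apply: emeasurable_funM => //; apply/measurable_EFinP/measurable_funM.
    by apply: measurableT_comp => //; exact: measurable_normal_pdf.
  by apply: measurableT_comp => //; exact: measurable_normal_pdf.
by move=> z; rewrite mule_ge0// lee_fin mulr_ge0// normal_pdf_ge0.
Qed.

End normal_plane.

Section vectors.
Context {R : realType}.
Local Notation mR := (measurableTypeR R).
Local Notation gamma := (@normal_prob R 0 1).
Implicit Types d n : nat.

Lemma measurable_coord d (i : 'I_d) : measurable_fun setT (@coords R d i).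
Proof.
move=> _ B mB; rewrite setTI; apply: sub_sigma_algebra.
rewrite (bigD1 i)//=; left; exists B => //; exact: setTI.
Qed.

Lemma measurable_coordP d dT (T : measurableType dT) (f : T -> 'cV[R]_d) :
  measurable_fun setT f <-> forall i, measurable_fun setT (fun x => f x i 0).
Proof.
split=> [mf i|]; last exact: measurable_fun_vec.
exact: measurableT_comp (measurable_coord i) mf.
Qed.

Lemma measurable_mulmx d n (A : 'M[R]_(d, n)) : measurable_fun setT (mulmx A : 'cV[R]_n -> 'cV[R]_d).
Proof.
apply: measurable_fun_vec => i; under eq_fun do rewrite mxE.
apply: measurable_sum => j; apply: measurable_funM => //.
exact: measurable_coord.
Qed.

Lemma measurable_addmx d dT (T : measurableType dT) (f g : T -> 'cV[R]_d) :
  measurable_fun setT f -> measurable_fun setT g ->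
  measurable_fun setT (fun x => f x + g x).
Proof.
move=> /measurable_coordP mf /measurable_coordP mg.
by apply: measurable_fun_vec => i; under eq_fun do rewrite mxE; exact: measurable_funD.
Qed.

Section col_map.
Variable d : nat.
Definition tuple_col (z : d.-tuple mR) : 'cV[R]_d := \col_i tnth z i.
Let measurable_tuple_col : measurable_fun setT tuple_col.
Proof.
apply: measurable_fun_vec => i; under eq_fun do rewrite mxE.
exact: measurable_tnth.
Qed.
HB.instance Definition _ := isMeasurableFun.Build _ _ _ _ tuple_col measurable_tuple_col.
End col_map.

Definition gvec d : probability 'cV[R]_d R := distribution (std_normal d) (@tuple_col d).

Section consv.
Variable d : nat.
Definition consv (x : mR * 'cV[R]_d) : 'cV[R]_(1 + d) := col_mx x.1%:M x.2.
Lemma measurable_consv : measurable_fun setT consv.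
Proof.
apply: measurable_fun_vec => i; case: (split_ordP i) => j ->.
  under eq_fun do rewrite /consv col_mxEu mxE ord1 eqxx mulr1n.
  exact: measurable_fst.
under eq_fun do rewrite /consv col_mxEd.
exact: measurableT_comp (measurable_coord j) (@measurable_snd _ _ _ _).
Qed.
HB.instance Definition _ := isMeasurableFun.Build _ _ _ _ consv measurable_consv.
End consv.

Lemma tuple_col_cons d (x : mR) (v : d.-tuple mR) :
  tuple_col (cons_pair (x, v)) = consv (x, tuple_col v) :> 'cV[R]_(1 + d).
Proof.
apply/colP => i; rewrite /consv; case: (split_ordP i) => j ->.
  by rewrite col_mxEu !ord1 !mxE eqxx mulr1n (tnth_nth 0).
by rewrite col_mxEd !mxE !(tnth_nth 0).
Qed.

Lemma gvecS d (A : set 'cV[R]_(1 + d)) : measurable A ->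
  gvec (1 + d) A = distribution (gamma \x gvec d)%E (@consv d) A.
Proof.
move=> mA; rewrite /gvec /distribution/= /pushforward/= /product_measure1/=.
apply: eq_integral => x _ /=; rewrite /distribution /pushforward /=.
congr (std_normal d _).
apply/seteqP; split => v /=; rewrite /xsection /= !inE /=.
  by rewrite (tuple_col_cons x v).
by rewrite -(tuple_col_cons x v).
Qed.

Local Open Scope ereal_scope.

Lemma integral_cst_probability dT (T : measurableType dT) (P : probability T R) (y : \bar R) :
  \int[P]_(x in setT) y = y.
Proof.
have PT : P setT = 1 := probability_setT P.
transitivity (y * 1); last exact: mule1.
by rewrite -PT; exact: integral_cst.
Qed.

Lemma ge0_integral_gvecS d (f : 'cV[R]_(1 + d) -> \bar R) :
  measurable_fun setT f -> (forall v, 0 <= f v) ->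
  \int[gvec (1 + d)]_v f v = \int[gamma]_x \int[gvec d]_v f (consv (x, v)).
Proof.
move=> mf f0.
rewrite (eq_measure_integral (distribution (gamma \x gvec d) (@consv d))); last first.
  by move=> A mA _; exact: gvecS.
rewrite ge0_integral_distribution//.
apply: (fubini_tonelli1 _ (measurableT_comp mf (@measurable_consv d))).
by move=> z; exact: f0.
Qed.

(** Phrased with integrals of nonnegative functions, so that coordinates can be integrated one at a
    time without integrability conditions. *)
Definition gvec_invariant d (Q : 'M[R]_d) :=
  forall f : 'cV[R]_d -> \bar R, measurable_fun setT f -> (forall v, 0 <= f v) ->
  \int[gvec d]_v f (Q *m v)%R = \int[gvec d]_v f v.

Lemma gvec_invariantM d (P Q : 'M[R]_d) :
  gvec_invariant P -> gvec_invariant Q -> gvec_invariant (P *m Q)%R.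
Proof.
move=> iP iQ f mf f0.
have mfP := measurableT_comp mf (measurable_mulmx P).
rewrite -(iP f mf f0) -(iQ _ mfP (fun v => f0 _)).
by apply: eq_integral => v _; rewrite /= mulmxA.
Qed.

Lemma gvec_invariant_block d (Q : 'M[R]_d) : gvec_invariant Q ->
  gvec_invariant (block_mx 1%:M 0 0 Q : 'M[R]_(1 + d))%R.
Proof.
move=> iQ f mf f0.
have mfB := measurableT_comp mf (@measurable_mulmx (1 + d) (1 + d) (block_mx 1%:M 0 0 Q)%R).
rewrite (ge0_integral_gvecS mfB (fun v => f0 _)) (ge0_integral_gvecS mf f0).
apply: eq_integral => x _.
have mfc : measurable_fun setT (fun v : 'cV[R]_d => f (consv (x, v))).
  exact: measurableT_comp (measurableT_comp mf (@measurable_consv d)) (measurable_pair1 x).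
rewrite -(iQ _ mfc (fun v => f0 _)); apply: eq_integral => v _.
rewrite /= /consv/= mul_block_col mul1mx !mul0mx addr0 add0r.
by [].
Qed.

Definition rotmx k (c s : R) : 'M[R]_(1 + (1 + k)) :=
  (block_mx c%:M (row_mx (- s)%:M 0) (col_mx s%:M 0) (block_mx c%:M 0 0 1%:M))%R.

Lemma rotmx_consv k (c s x y : R) (w : 'cV[R]_k) :
  (rotmx k c s *m consv (x, consv (y, w)) =
   consv (c * x - s * y, consv (s * x + c * y, w)))%R.
Proof.
rewrite /rotmx /consv /= mul_block_col mul_row_col mul_col_mx mul_block_col.
rewrite !mul0mx !addr0 add0r mul1mx add_col_mx add0r -!scalar_mxM.
by congr (col_mx _ (col_mx _ _)); rewrite -?raddfD// mulNr.
Qed.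

Lemma rotmx_orth k (c s : R) : (c ^+ 2 + s ^+ 2 = 1)%R ->
  ((rotmx k c s)^T *m rotmx k c s = 1%:M)%R.
Proof.
move=> cs; rewrite /rotmx tr_block_mx mulmx_block tr_row_mx tr_col_mx tr_block_mx.
rewrite !tr_scalar_mx !trmx0.
rewrite mul_row_col mul_row_block !mul_col_row mulmx_block mul_mx_row mul_col_mx.
rewrite ?mul_row_block ?mul_block_col.
rewrite !(mul0mx, mulmx0, addr0, add0r, mul1mx) ?add_block_mx ?add_row_mx ?add_col_mx.
rewrite -!scalar_mxM -!raddfD/= !(addr0, add0r) -!expr2 sqrrN (addrC (s ^+ 2)%R) cs.
have -> : (c * - s + s * c = 0)%R by ring.
have -> : (- s * c + c * s = 0)%R by ring.
have const0 m n : (const_mx 0 = 0 :> 'M[R]_(m, n))%R by [].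
rewrite raddf0 !const0 row_mx0 col_mx0.
by rewrite -!scalar_mx_block.
Qed.

Lemma gvec_invariant_rotmx k (c s : R) : (c ^+ 2 + s ^+ 2 = 1)%R ->
  gvec_invariant (rotmx k c s).
Proof.
move=> cs f mf f0.
have mfR := measurableT_comp mf (measurable_mulmx (rotmx k c s)).
have mg (g : 'cV[R]_(1 + (1 + k)) -> \bar R) : measurable_fun setT g ->
    measurable_fun setT
      (fun z : mR * mR * 'cV[R]_k => g (consv (z.1.1, consv (z.1.2, z.2)))).
  move=> mg; apply: (measurableT_comp mg).
  apply: (measurableT_comp (@measurable_consv (1 + k))).
  apply/measurable_fun_pair; first by apply: measurableT_comp => //.
  apply: (measurableT_comp (@measurable_consv k)).
  by apply/measurable_fun_pair => //; apply: measurableT_comp.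
pose F (g : 'cV[R]_(1 + (1 + k)) -> \bar R) (z : mR * mR) :=
  \int[gvec k]_w g (consv (z.1, consv (z.2, w))).
have E g : measurable_fun setT g -> (forall v, 0 <= g v) ->
    \int[gvec (1 + (1 + k))]_v g v = \int[gamma]_x \int[gamma]_y F g (x, y).
  move=> mg' g0; rewrite ge0_integral_gvecS//; apply: eq_integral => x _.
  rewrite (@ge0_integral_gvecS k (fun v => g (consv (x, v))))//.
  exact: measurableT_comp (measurableT_comp mg' (@measurable_consv _)) (measurable_pair1 x).
rewrite (E _ mfR (fun v => f0 _)) (E f mf f0).
have mF : measurable_fun setT (F f).
  exact: (measurable_fun_fubini_tonelli_F _ (mg f mf)).
rewrite -(ge0_integral_rot cs mF).
  apply: eq_integral => x _; apply: eq_integral => y _.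
  apply: eq_integral => w _ /=.
  by rewrite rotmx_consv.
by move=> z; apply: integral_ge0 => w _.
Qed.

(** A sign change on the line is not a rotation of the line, but it is the first coordinate of the
    half turn of a plane whose second coordinate is integrated out. *)
Lemma gvec_invariant_opp : gvec_invariant (- 1%:M : 'M[R]_(1 + 0))%R.
Proof.
move=> f mf f0.
have mfN := measurableT_comp mf (@measurable_mulmx (1 + 0) (1 + 0) (- 1%:M)%R).
rewrite (ge0_integral_gvecS mfN (fun v => f0 _)) (ge0_integral_gvecS mf f0).
have int0 (g : 'cV[R]_(1 + 0) -> \bar R) (x : R) :
    \int[gvec 0]_v g (consv (x, v)) = g (consv (x, 0%R)).
  have -> : (fun v : 'cV[R]_0 => g (consv (x, v))) = cst (g (consv (x, 0%R))).
    by apply/funext => v /=; congr (g (consv (_, _))); apply/colP => -[].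
  exact: integral_cst_probability.
under eq_integral do rewrite int0.
under [RHS]eq_integral do rewrite int0.
pose F (z : mR * mR) := f (consv (z.1, 0%R)).
have mF : measurable_fun setT F.
  apply: (measurableT_comp mf); apply: (measurableT_comp (@measurable_consv 0)).
  by apply/measurable_fun_pair.
have e1 : ((-1) ^+ 2 + 0 ^+ 2 = 1 :> R)%R by rewrite sqrrN expr1n expr0n addr0.
have := ge0_integral_rot e1 mF (fun z => f0 _).
have E (y : \bar R) : \int[gamma]_(t in setT) y = y.
  exact: integral_cst_probability.
rewrite /F /rot/=.
under eq_integral do under eq_integral do rewrite mul0r subr0.
under eq_integral do rewrite E.
under [RHS]eq_integral do rewrite E.
move=> <-; apply: eq_integral => x _; congr f.
by rewrite mulNmx mul1mx /consv opp_col_mx/= oppr0 mulN1r raddfN.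
Qed.

End vectors.

Section vectors_orth.
Context {R : realType}.

(* [Q] factors into a rotation in the plane of the first two coordinates and matrices
   acting on the last coordinates only, where induction applies. *)
Lemma gvec_orth d (Q : 'M[R]_d) : (Q^T *m Q = 1%:M)%R -> gvec_invariant Q.
Proof.
elim: d Q => [|d IHd] Q QQ.
  by move=> f _ _; apply: eq_integral => v _; congr f; apply/colP => -[].
rewrite -[d.+1]/(1 + d)%N in Q QQ *.
pose z := lshift d (ord0 : 'I_1).
pose u := col z Q.
have uu : dot u u = 1%R by rewrite dot_col_orth// eqxx.
(* A planar rotation needs two coordinates; in dimension one the orthogonal matrices are the two
   signs. *)
case: d => [|k] in IHd Q QQ z u uu *.
  have QE : Q = (u z 0)%:M.
    by apply/matrixP => i j; rewrite !ord1 !mxE eqxx mulr1n; congr (Q _ _); apply/val_inj.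
  have : (u z 0 == 1)%R || (u z 0 == -1)%R.
    rewrite -sqrf_eq1; move: uu; rewrite dotE big_ord1 expr2.
    by rewrite (_ : ord0 = z) => [->//|]; apply/val_inj.
  case/orP => /eqP uE; rewrite QE uE.
    by move=> f _ _; apply: eq_integral => v _; rewrite mul1mx.
  by rewrite raddfN; exact: gvec_invariant_opp.
pose u' := dsubmx u; pose r := Num.sqrt (dot u' u').
have rr : (r ^+ 2 = dot u' u')%R by rewrite sqr_sqrtr// dot_ge0.
pose z' := lshift k (ord0 : 'I_1).
have /householder[H [HT HH Hu _]] : dot (r *: delta_mx z' 0)%R (r *: delta_mx z' 0)%R = dot u' u'.
  by rewrite dotZl dotZr dot_delta mxE !eqxx mulr1 -expr2.
have cs : ((u z 0) ^+ 2 + r ^+ 2 = 1)%R.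
  rewrite rr -uu [RHS]dotE big_split_ord/= big_ord1 -expr2.
  by congr (_ + _)%R; rewrite dotE; apply: eq_bigr => i _; rewrite !mxE.
pose B : 'M[R]_(1 + (1 + k)) := (block_mx 1%:M 0 0 H)%R.
have BB : (B^T *m B = 1%:M)%R.
  rewrite /B tr_block_mx mulmx_block trmx1 !trmx0 HT.
  by rewrite !(mul0mx, mulmx0, mul1mx, add0r, addr0) HH -scalar_mx_block.
have iB : gvec_invariant B by apply: gvec_invariant_block; apply: IHd; rewrite HT.
pose S := rotmx k (u z 0) r.
have SS := rotmx_orth k cs; rewrite -/S in SS.
have iS : gvec_invariant S by exact: gvec_invariant_rotmx.
pose e : 'cV[R]_(1 + (1 + k)) := delta_mx z 0.
have BSe : (B *m S *m e = u)%R.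
  have -> : e = consv (1, consv (0, 0)).
    apply/colP => i; rewrite mxE andbT; case: (split_ordP i) => j ->.
      by rewrite col_mxEu !ord1 mxE eqxx.
    rewrite col_mxEd eq_rlshift; case: (split_ordP j) => l ->.
      by rewrite col_mxEu !ord1 mxE.
    by rewrite col_mxEd mxE.
  rewrite -mulmxA rotmx_consv mulr1 mulr0 subr0 mulr1 mulr0 addr0.
  rewrite /consv/= mul_block_col mul1mx !mul0mx addr0 add0r.
  have -> : col_mx r%:M 0 = (r *: delta_mx z' 0)%R :> 'cV[R]_(1 + k).
    apply/colP => i; rewrite !mxE andbT; case: (split_ordP i) => j ->.
      by rewrite !ord1 mxE !eqxx mulr1n mulr1.
    by rewrite mxE eq_rlshift mulr0.
  rewrite Hu -[RHS]vsubmxK; congr col_mx.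
  by apply/matrixP => i j; rewrite !ord1 !mxE eqxx mulr1n.
(* S turns the first axis towards the second one by the right angle, and B then reflects the tail
   onto the tail of u; so B S and Q have the same first column, and M fixes the first axis. *)
have [M ME] : exists M, M = ((B *m S)^T *m Q)%R by eexists.
have BSBS : ((B *m S)^T *m (B *m S) = 1%:M)%R.
  by rewrite trmx_mul mulmxA -(mulmxA _ B^T) BB mulmx1.
have QE : (Q = B *m S *m M)%R by rewrite ME mulmxA (mulmx1C BSBS) mul1mx.
have MM : (M^T *m M = 1%:M)%R.
  rewrite ME trmx_mul trmxK mulmxA -(mulmxA _ (B *m S) _) (mulmx1C BSBS).
  by rewrite mulmx1.
have Mz i : (M i z = 1 * (i == z)%:R)%R.
  have : (M *m e)%R = e by rewrite ME -mulmxA -colE -/u -BSe mulmxA BSBS mul1mx.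
  by rewrite /e -colE => /(congr1 (fun v : 'cV[R]_(1 + (1 + k)) => v i 0)); rewrite !mxE andbT mul1r.
have Mzr j : (M z (rshift 1 j) = 0)%R.
  have := congr1 (fun M : 'M[R]_(1 + (1 + k)) => M z (rshift 1 j)) MM.
  rewrite [in RHS]mxE eq_lrshift mulr0n mxE (bigD1 z)//= big1; last first.
    by move=> i i0; rewrite mxE Mz (negbTE i0) mulr0 mul0r.
  by rewrite addr0 mxE Mz eqxx mulr1 mul1r.
have MB := block_mx_scalarl Mz Mzr.
have [M' M'E] : exists M', M' = drsubmx M by eexists.
rewrite -M'E in MB.
rewrite QE; apply: gvec_invariantM; first exact: gvec_invariantM.
rewrite MB; apply: gvec_invariant_block; apply: IHd.
move: MM; rewrite MB tr_block_mx mulmx_block !trmx0 !(mul0mx, mulmx0, add0r, addr0).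
by rewrite (scalar_mx_block 1 (1 + k)) => /eq_block_mx[].
Qed.

End vectors_orth.

(** * Expectations, product laws and moments *)

Section expectation.
Context d (T : measurableType d) {R : realType}.
Implicit Types (P Q : probability T R) (f g : T -> R) (k : R).

Definition L1 P f := P.-integrable setT (EFin \o f).
Definition Ex P f : R := fine (\int[P]_x (f x)%:E).

Lemma L1_measurable P f : L1 P f -> measurable_fun setT f.
Proof. by move=> /measurable_int /measurable_EFinP. Qed.

Lemma L1_fin P f : L1 P f -> (\int[P]_x (f x)%:E)%E = (Ex P f)%:E.
Proof. by move=> if_; rewrite fineK//; exact: integrable_fin_num. Qed.

Lemma L1_le P f g : measurable_fun setT f -> (forall x, `|f x| <= g x) ->
  L1 P g -> L1 P f.
Proof.
move=> mf fg; apply: le_integrable => //; first exact/measurable_EFinP.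
by move=> x _ /=; rewrite lee_fin (le_trans (fg x))// ler_norm.
Qed.

Lemma L1_cst P k : L1 P (fun=> k).
Proof. exact: finite_measure_integrable_cst. Qed.

Lemma L1_bounded P f k : measurable_fun setT f -> (forall x, `|f x| <= k) -> L1 P f.
Proof. by move=> mf fk; apply: (L1_le mf fk); exact: L1_cst. Qed.

Lemma L1D P f g : L1 P f -> L1 P g -> L1 P (fun x => f x + g x).
Proof. by move=> i1 i2; apply: (integrableD measurableT i1 i2). Qed.

Lemma L1Z P k f : L1 P f -> L1 P (fun x => k * f x).
Proof. by move=> i1; apply: (integrableZl measurableT k i1). Qed.

Lemma L1N P f : L1 P f -> L1 P (fun x => - f x).
Proof. by move=> i1; under eq_fun do rewrite -mulN1r; exact: L1Z. Qed.

Lemma L1B P f g : L1 P f -> L1 P g -> L1 P (fun x => f x - g x).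
Proof. by move=> i1 i2; apply: L1D => //; exact: L1N. Qed.

Lemma L1_norm P f : L1 P f -> L1 P (fun x => `|f x|).
Proof. exact: integrable_norm. Qed.

Lemma L1_sum P I (r : seq I) (p : pred I) (F : I -> T -> R) :
  (forall i, L1 P (F i)) -> L1 P (fun x => \sum_(i <- r | p i) F i x).
Proof.
move=> iF; elim: r => [|i r IHr].
  by under eq_fun do rewrite big_nil; exact: L1_cst.
have [Pi|Pi] := boolP (p i); last by under eq_fun do rewrite big_cons (negbTE Pi).
by under eq_fun do rewrite big_cons Pi; exact: L1D.
Qed.

Lemma eq_Ex P f g : f =1 g -> Ex P f = Ex P g.
Proof. by move=> /funext ->. Qed.

Lemma Ex_cst P k : Ex P (fun=> k) = k.
Proof. by rewrite /Ex (integral_cst_probability P). Qed.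

Lemma ExD P f g : L1 P f -> L1 P g -> Ex P (fun x => f x + g x) = Ex P f + Ex P g.
Proof. by move=> i1 i2; exact: (RintegralD measurableT i1 i2). Qed.

Lemma ExZ P k f : L1 P f -> Ex P (fun x => k * f x) = k * Ex P f.
Proof. by move=> i1; exact: (RintegralZl k measurableT i1). Qed.

Lemma ExN P f : L1 P f -> Ex P (fun x => - f x) = - Ex P f.
Proof.
move=> i1; rewrite -mulN1r -ExZ//; apply: eq_Ex => x; by rewrite mulN1r.
Qed.

Lemma ExB P f g : L1 P f -> L1 P g -> Ex P (fun x => f x - g x) = Ex P f - Ex P g.
Proof. by move=> i1 i2; exact: (RintegralB measurableT i1 i2). Qed.

Lemma Ex_sum P I (r : seq I) (p : pred I) (F : I -> T -> R) :
  (forall i, L1 P (F i)) ->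
  Ex P (fun x => \sum_(i <- r | p i) F i x) = \sum_(i <- r | p i) Ex P (F i).
Proof.
move=> iF; elim: r => [|i r IHr].
  by under eq_fun do rewrite big_nil; rewrite Ex_cst big_nil.
rewrite big_cons; have [Pi|Pi] := boolP (p i); last first.
  by under eq_fun do rewrite big_cons (negbTE Pi).
by under eq_fun do rewrite big_cons Pi; rewrite ExD ?IHr//; exact: L1_sum.
Qed.

Lemma Ex_le P f g : L1 P f -> L1 P g -> (forall x, f x <= g x) -> Ex P f <= Ex P g.
Proof. by move=> i1 i2 fg; exact: (le_Rintegral measurableT i1 i2). Qed.

Lemma Ex_ge0 P f : (forall x, 0 <= f x) -> 0 <= Ex P f.
Proof. by move=> f0; apply: Rintegral_ge0. Qed.

Lemma Ex_norm P f : L1 P f -> `|Ex P f| <= Ex P (fun x => `|f x|).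
Proof. by move=> i1; exact: (le_normr_Rintegral measurableT i1). Qed.

Lemma Ex_norm_le P f k : measurable_fun setT f -> (forall x, `|f x| <= k) ->
  `|Ex P f| <= k.
Proof.
move=> mf fk; have i1 := L1_bounded P mf fk.
apply: le_trans (Ex_norm i1) _; rewrite -[leRHS](Ex_cst P).
by apply: Ex_le => //; [exact: L1_norm|exact: L1_cst].
Qed.

Lemma L1_powS P f (n : nat) : measurable_fun setT f ->
  L1 P (fun x => `|f x| ^+ n.+1) -> L1 P (fun x => `|f x| ^+ n).
Proof.
move=> mf i1; apply: (@L1_le _ _ (fun x => 1 + `|f x| ^+ n.+1)).
- by apply: measurable_funX; exact: measurableT_comp.
- move=> x; rewrite ger0_norm ?exprn_ge0//.
  have [fx1|fx1] := leP `|f x| 1.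
    apply: (@le_trans _ _ 1); first exact: exprn_ile1.
    by rewrite lerDl exprn_ge0.
  by apply: le_trans (ler_weXn2l (ltW fx1) (leqnSn n)) _; rewrite lerDr.
- by apply: L1D => //; exact: L1_cst.
Qed.

Lemma eq_integral_measure P Q (F : T -> \bar R) :
  (forall A, measurable A -> P A = Q A) -> (\int[P]_x F x = \int[Q]_x F x)%E.
Proof.
by move=> PQ; apply: eq_measure_integral => A mA _; apply: PQ.
Qed.

Lemma L1_eq P Q f : (forall A, measurable A -> P A = Q A) -> L1 P f -> L1 Q f.
Proof.
move=> PQ /integrableP[mf foo]; apply/integrableP; split => //.
by rewrite -(eq_integral_measure _ PQ).
Qed.

Lemma Ex_eq P Q f : (forall A, measurable A -> P A = Q A) -> Ex P f = Ex Q f.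
Proof. by move=> PQ; congr fine; exact: eq_integral_measure. Qed.

End expectation.

Section expectation_law.
Context d d' (T : measurableType d) (T' : measurableType d') {R : realType}.

Lemma L1_law (P : probability T R) (X : {RV P >-> T'}) (f : T' -> R) :
  measurable_fun setT f -> L1 P (f \o X) -> L1 (distribution P X) f.
Proof.
by move=> mf i1; apply: integrable_pushforward => //; exact/measurable_EFinP.
Qed.

Lemma L1_lawP (P : probability T R) (X : {RV P >-> T'}) (f : T' -> R) :
  L1 (distribution P X) f -> L1 P (f \o X).
Proof.
move=> /integrableP[mf foo]; apply/integrableP; split.
  by apply: (measurableT_comp mf).
move: foo; rewrite ge0_integral_pushforward//.
exact: measurableT_comp.
Qed.

Lemma Ex_law (P : probability T R) (X : {RV P >-> T'}) (f : T' -> R) :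
  measurable_fun setT f -> L1 P (f \o X) ->
  Ex (distribution P X) f = Ex P (f \o X).
Proof.
move=> mf i1; congr fine.
by rewrite integral_pushforward//; exact/measurable_EFinP.
Qed.

End expectation_law.

Section expectation_product.
Context d1 d2 (T1 : measurableType d1) (T2 : measurableType d2) {R : realType}.
Variables (P : probability T1 R) (Q : probability T2 R).

HB.instance Definition _ := isMeasurableFun.Build _ _ _ _ (@fst T1 T2)
  (@measurable_fst _ _ T1 T2).
HB.instance Definition _ := isMeasurableFun.Build _ _ _ _ (@snd T1 T2)
  (@measurable_snd _ _ T1 T2).

Definition prodP : probability (T1 * T2)%type R := (P \x Q)%E.

Lemma Ex_prod (f : T1 * T2 -> R) : L1 prodP f ->
  (forall x, L1 Q (fun y => f (x, y))) ->
  Ex prodP f = Ex P (fun x => Ex Q (fun y => f (x, y))) /\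
  L1 P (fun x => Ex Q (fun y => f (x, y))).
Proof.
move=> if_ ix.
have E : fubini_F Q (EFin \o f) = EFin \o (fun x => Ex Q (fun y => f (x, y))).
  by apply/funext => x; exact: L1_fin.
split; last by rewrite /L1 -E; exact: integrable_fubini_F.
rewrite /Ex -(integral12_prod_meas1 if_) E.
by [].
Qed.

Lemma Ex_prod_swap (f : T1 * T2 -> R) : L1 prodP f ->
  (forall x, L1 Q (fun y => f (x, y))) -> (forall y, L1 P (fun x => f (x, y))) ->
  Ex P (fun x => Ex Q (fun y => f (x, y))) =
  Ex Q (fun y => Ex P (fun x => f (x, y))).
Proof.
move=> if_ ix iy; rewrite /Ex.
have E1 : fubini_F Q (EFin \o f) = EFin \o (fun x => Ex Q (fun y => f (x, y))).
  by apply/funext => x; exact: L1_fin.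
have E2 : fubini_G P (EFin \o f) = EFin \o (fun y => Ex P (fun x => f (x, y))).
  by apply/funext => x; exact: L1_fin.
have := Fubini if_; rewrite -/(fubini_F _ _) -/(fubini_G _ _) => H.
congr fine.
transitivity (\int[P]_x (fubini_F Q (EFin \o f) x))%E; first by rewrite E1.
by rewrite [LHS]H E2.
Qed.

Lemma L1_prod_bounded (f : T1 * T2 -> R) k : measurable_fun setT f ->
  (forall z, `|f z| <= k) ->
  [/\ L1 prodP f, forall x, L1 Q (fun y => f (x, y)) &
      forall y, L1 P (fun x => f (x, y))].
Proof.
move=> mf fk; split.
- exact: (@L1_bounded _ _ _ _ _ k).
- move=> x; apply: (@L1_bounded _ _ _ _ _ k) => //.
  exact: measurableT_comp mf (measurable_pair1 x).
- move=> y; apply: (@L1_bounded _ _ _ _ _ k) => //.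
  exact: measurableT_comp mf (measurable_pair2 y).
Qed.

Lemma prodP_fst (A : set T1) : measurable A -> distribution prodP (@fst T1 T2) A = P A.
Proof.
move=> mA; rewrite /distribution /pushforward/=.
rewrite (_ : _ @^-1` A = A `*` setT); last first.
  by apply/seteqP; split => -[x y]//= [].
by rewrite product_measure1E//= (probability_setT Q) mule1.
Qed.

Lemma prodP_snd (A : set T2) : measurable A -> distribution prodP (@snd T1 T2) A = Q A.
Proof.
move=> mA; rewrite /distribution /pushforward/=.
rewrite (_ : _ @^-1` A = setT `*` A); last first.
  by apply/seteqP; split => -[x y]//= [].
by rewrite product_measure1E//= (probability_setT P) mul1e.
Qed.

Lemma L1_fst (f : T1 -> R) : L1 P f -> L1 prodP (fun z => f z.1).
Proof.
move=> if_; apply: (@L1_lawP _ _ _ _ _ prodP (@fst T1 T2)).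
by apply: L1_eq if_ => A mA; exact/esym/prodP_fst.
Qed.

Lemma L1_snd (f : T2 -> R) : L1 Q f -> L1 prodP (fun z => f z.2).
Proof.
move=> if_; apply: (@L1_lawP _ _ _ _ _ prodP (@snd T1 T2)).
by apply: L1_eq if_ => A mA; exact/esym/prodP_snd.
Qed.

Lemma Ex_fst (f : T1 -> R) : L1 P f -> Ex prodP (fun z => f z.1) = Ex P f.
Proof.
move=> if_; rewrite -(@Ex_law _ _ _ _ _ prodP (@fst T1 T2)).
- by apply: Ex_eq => A mA; exact: prodP_fst.
- exact: L1_measurable if_.
- exact: L1_fst.
Qed.

Lemma Ex_snd (f : T2 -> R) : L1 Q f -> Ex prodP (fun z => f z.2) = Ex Q f.
Proof.
move=> if_; rewrite -(@Ex_law _ _ _ _ _ prodP (@snd T1 T2)).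
- by apply: Ex_eq => A mA; exact: prodP_snd.
- exact: L1_measurable if_.
- exact: L1_snd.
Qed.

End expectation_product.

(** Mean 0, variance v and a finite third absolute moment: what a summand must satisfy for Lindeberg
    replacement. *)
Definition centred d (T : measurableType d) (R : realType) (P : probability T R)
    (f : T -> R) (v : R) :=
  [/\ measurable_fun setT f, L1 P (fun x => `|f x| ^+ 3),
      Ex P f = 0 & Ex P (fun x => f x ^+ 2) = v].

Section centred.
Context d (T : measurableType d) {R : realType}.
Implicit Types (P Q : probability T R) (f g : T -> R).

Lemma centred_L2 P f v : centred P f v -> L1 P (fun x => f x ^+ 2).
Proof.
move=> [mf f3 _ _]; have := L1_powS mf f3.
by congr L1; apply/funext => x; rewrite real_normK ?num_real.
Qed.

Lemma centred_L1 P f v : centred P f v -> L1 P f.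
Proof.
move=> [mf f3 _ _]; have := L1_powS mf (L1_powS mf f3).
under eq_fun do rewrite expr1.
exact: L1_le.
Qed.

Lemma centred_eq P f g v : f =1 g -> centred P f v -> centred P g v.
Proof. by move=> /funext ->. Qed.

Lemma centred_measure P Q f v : (forall A, measurable A -> P A = Q A) ->
  centred P f v -> centred Q f v.
Proof.
move=> PQ [mf f3 f1 f2]; split => //; first exact: L1_eq f3.
- by rewrite -(Ex_eq _ PQ).
- by rewrite -(Ex_eq _ PQ).
Qed.

Lemma centredZ P f v k : centred P f v -> centred P (fun x => k * f x) (k ^+ 2 * v).
Proof.
move=> cf; have [m f3 f1 f2] := cf; split.
- exact: measurable_funM.
- by under eq_fun do rewrite normrM exprMn; exact: L1Z.
- by rewrite ExZ ?f1 ?mulr0//; exact: centred_L1 cf.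
- under eq_fun do rewrite exprMn.
  by rewrite ExZ ?f2//; exact: centred_L2 cf.
Qed.

End centred.

Section centred_prod.
Context d d' (T : measurableType d) (T' : measurableType d') {R : realType}.
Implicit Types (P : probability T R) (f : T -> R).

Lemma centred_law P (X : {RV P >-> T'}) (f : T' -> R) v : measurable_fun setT f ->
  centred P (f \o X) v <-> centred (distribution P X) f v.
Proof.
move=> mf; have m3 : measurable_fun setT (fun x => `|f x| ^+ 3).
  by apply: measurable_funX; exact: measurableT_comp.
have m2 : measurable_fun setT (fun x => f x ^+ 2) by exact: measurable_funX.
split=> cf; have [m f3 f1 f2] := cf.
  split => //; first by apply: L1_law.
    by rewrite Ex_law//; exact: centred_L1 cf.
  by rewrite Ex_law//; exact: centred_L2 cf.
have i1 : L1 P (f \o X) by apply: L1_lawP; exact: centred_L1 cf.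
split.
- exact: L1_measurable i1.
- by apply: (@L1_lawP _ _ _ _ _ _ X (fun x => `|f x| ^+ 3)).
- by rewrite -Ex_law.
- rewrite -f2 Ex_law//.
  by apply: (@L1_lawP _ _ _ _ _ _ X (fun x => f x ^+ 2)); exact: centred_L2 cf.
Qed.

Lemma centred_prod P (Q : probability T' R) f (g : T' -> R) v w :
  centred P f v -> centred Q g w ->
  centred (prodP P Q) (fun z => f z.1 + g z.2) (v + w).
Proof.
move=> cf cg; have [mf f3 f1 f2] := cf; have [mg g3 g1 g2] := cg.
have lf1 := centred_L1 cf; have lf2 := centred_L2 cf.
have lg1 := centred_L1 cg; have lg2 := centred_L2 cg.
have mfg : measurable_fun setT (fun z : T * T' => f z.1 + g z.2).
  by apply: measurable_funD; apply: measurableT_comp.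
split => //.
- apply: (@L1_le _ _ _ _ _ (fun z => 4 * (`|f z.1| ^+ 3 + `|g z.2| ^+ 3))).
  + by apply: measurable_funX; exact: measurableT_comp.
  + move=> [x y] /=; rewrite ger0_norm ?exprn_ge0//.
    apply: (@le_trans _ _ ((`|f x| + `|g y|) ^+ 3)).
      by rewrite ler_pXn2r ?nnegrE ?addr_ge0// ler_normD.
    have := normr_ge0 (f x); have := normr_ge0 (g y).
    set a := `|f x|; set b := `|g y| => b0 a0.
    rewrite -subr_ge0 (_ : _ - _ = 3 * (a + b) * (a - b) ^+ 2); last by ring.
    by rewrite mulr_ge0 ?sqr_ge0// mulr_ge0// addr_ge0.
  + apply: L1Z; apply: L1D.
      exact: (L1_fst _ f3).
    exact: (L1_snd _ g3).
- rewrite ExD; [|exact: L1_fst|exact: L1_snd].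
  by rewrite Ex_fst// Ex_snd// f1 g1 addr0.
- have lfg : L1 (prodP P Q) (fun z => f z.1 * g z.2).
    apply: (@L1_le _ _ _ _ _ (fun z => f z.1 ^+ 2 + g z.2 ^+ 2)).
    + by apply: measurable_funM; apply: measurableT_comp.
    + move=> [x y] /=; rewrite ler_norml; apply/andP; split; nra.
    + by apply: L1D; [exact: (L1_fst _ lf2)|exact: (L1_snd _ lg2)].
  have Efg : Ex (prodP P Q) (fun z => f z.1 * g z.2) = 0.
    have [||-> _] := @Ex_prod _ _ _ _ _ P Q (fun z => f z.1 * g z.2) => //.
      by move=> x; exact: (L1Z (f x) lg1).
    rewrite (_ : (fun x => _) = (fun=> 0)); last first.
      by apply/funext => x; rewrite /= ExZ// g1 mulr0.
    exact: Ex_cst.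
  rewrite (_ : (fun z => _) =
      (fun z => (f z.1 ^+ 2 + g z.2 ^+ 2) + 2 * (f z.1 * g z.2))); last first.
    by apply/funext => z; ring.
  rewrite ExD; last 2 first.
    by apply: L1D; [exact: (L1_fst _ lf2)|exact: (L1_snd _ lg2)].
    exact: L1Z.
  rewrite ExZ// Efg mulr0 addr0 ExD; last 2 first.
    exact: (L1_fst _ lf2).
    exact: (L1_snd _ lg2).
  by rewrite (Ex_fst _ lf2) (Ex_snd _ lg2) f2 g2.
Qed.

End centred_prod.

Lemma measurable_absX d (T : measurableType d) (R : realType) (f : T -> R) (k : nat) :
  measurable_fun setT f -> measurable_fun setT (fun x => `|f x| ^+ k).
Proof.
by move=> mf; apply: measurable_funX; exact: measurableT_comp (@normr_measurable R setT) mf.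
Qed.

Section normal_moments.
Context {R : realType}.
Local Notation mR := (measurableTypeR R).
Local Notation lambda := (@lebesgue_measure R).
Local Notation gamma := (@normal_prob R 0 1 : probability mR R).

(** The integrand is s times the density of N(0, s^2) with respect to N(0, 1). It serves both for
    the value of the second moment and, with s = 2, as an integrable majorant. *)
Lemma integral_normal_expR (s : R) : 0 < s ->
  (\int[gamma]_z (expR (- ((s ^- 2 - 1) * z ^+ 2 / 2)))%:E)%E = s%:E.
Proof.
move=> s0; have sn0 : s != 0 by rewrite gt_eqF.
have me : measurable_fun setT (fun z : mR => expR (- ((s ^- 2 - 1) * z ^+ 2 / 2))).
  apply: measurableT_comp => //; apply: measurableT_comp => //.
  by apply: measurable_funM => //; apply: measurable_funM => //; exact: measurable_funX.
rewrite ge0_integral_normal; last 2 first.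
- exact/measurable_EFinP.
- by move=> x; rewrite lee_fin expR_ge0.
transitivity (\int[lambda]_z (s%:E * (normal_pdf 0 s z)%:E))%E; last first.
  rewrite ge0_integralZl//; last 3 first.
  - by apply/measurable_EFinP; exact: measurable_normal_pdf.
  - by move=> z _; rewrite lee_fin normal_pdf_ge0.
  - by rewrite lee_fin ltW.
  by rewrite integral_normal_pdf// mule1.
apply: eq_integral => z _; rewrite -!EFinM; congr EFin.
rewrite !normal_pdfE ?oner_eq0// /normal_fun /normal_peak !subr0.
rewrite [LHS]mulrCA -expRD [RHS]mulrA; congr (_ * expR _).
  rewrite expr1n mul1r -[in RHS]mulrnAr sqrtrM ?sqr_ge0// sqrtr_sqr gtr0_norm//.
  by rewrite invfM mulrA mulfV// mul1r.
rewrite -mulr_natr; field.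
by [].
Qed.

Lemma gamma_L1_expR (s : R) : 0 < s ->
  L1 gamma (fun z => expR (- ((s ^- 2 - 1) * z ^+ 2 / 2))).
Proof.
move=> s0; apply/integrableP; split.
  apply/measurable_EFinP; apply: measurableT_comp => //; apply: measurableT_comp => //.
  by apply: measurable_funM => //; apply: measurable_funM => //; exact: measurable_funX.
under eq_integral do rewrite /= ger0_norm ?expR_ge0//.
by rewrite integral_normal_expR// ltry.
Qed.

Lemma gamma_L1_pow6 : L1 gamma (fun z : mR => `|z| ^+ 6).
Proof.
(* For s = 2 the integrable function is exp(3 z^2 / 8), the cube of exp(z^2 / 8), which dominates
   (z^2 / 8)^3. Sixth powers are needed for third moments of quadratic forms. *)
have h := @gamma_L1_expR 2 ltac:(by []).
apply: (L1_le _ _ (L1Z (8 ^+ 3) h)).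
  by apply: measurable_absX; exact: measurable_id.
move=> z; rewrite ger0_norm ?exprn_ge0//.
rewrite (_ : `|z| ^+ 6 = 8 ^+ 3 * (z ^+ 2 / 8) ^+ 3); last first.
  rewrite (_ : `|z| ^+ 6 = (`|z| ^+ 2) ^+ 3); last by rewrite -exprM.
  by rewrite real_normK ?num_real//; field.
rewrite ler_pM2l ?exprn_gt0//.
rewrite (_ : - _ = 3%:R * (z ^+ 2 / 8)); last by field.
rewrite expRM_natl ler_pXn2r ?nnegrE ?expR_ge0//.
  by apply: le_trans (expR_ge1Dx _); rewrite lerDr.
by rewrite divr_ge0// sqr_ge0.
Qed.

Lemma gamma_L1_pow (k : nat) : (k <= 6)%N -> L1 gamma (fun z : mR => z ^+ k).
Proof.
move=> k6; apply: (@L1_le _ _ _ _ _ (fun z : mR => 1 + `|z| ^+ 6)).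
- exact: measurable_funX.
- move=> z; rewrite normrX.
  have [z1|z1] := leP `|z| 1.
    apply: (@le_trans _ _ 1); first exact: exprn_ile1.
    by rewrite lerDl exprn_ge0.
  by apply: le_trans (ler_weXn2l (ltW z1) k6) _; rewrite lerDr.
- by apply: L1D; [exact: L1_cst|exact: gamma_L1_pow6].
Qed.

(** The tangent inequality exp x >= 1 + x inside [integral_normal_expR] gives 1 - (s^-2 - 1) m2 / 2
    <= s for all s > 0, with equality at s = 1. Comparing slopes at s = 1 forces m2 = 1, without
    integration by parts. *)
Lemma gamma_sqr : Ex gamma (fun z : mR => z ^+ 2) = 1.
Proof.
pose m2 := Ex gamma (fun z : mR => z ^+ 2); rewrite -/m2.
have l2 : L1 gamma (fun z : mR => z ^+ 2) := gamma_L1_pow (isT : (2 <= 6)%N).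
have m20 : 0 <= m2 by apply: Ex_ge0 => z; exact: sqr_ge0.
have tangent (s : R) : 0 < s -> 1 - (s ^- 2 - 1) / 2 * m2 <= s.
  move=> s0.
  have := L1_fin (gamma_L1_expR s0); rewrite integral_normal_expR// => -[sE]; rewrite [leRHS]sE.
  suff : Ex gamma (fun z : mR => 1 - (s ^- 2 - 1) / 2 * z ^+ 2) <=
      Ex gamma (fun z : mR => expR (- ((s ^- 2 - 1) * z ^+ 2 / 2))).
    by rewrite ExB ?ExZ ?Ex_cst//; [exact: L1_cst|exact: L1Z].
  apply: Ex_le; [|exact: gamma_L1_expR|].
    by apply: L1B; [exact: L1_cst|exact: L1Z].
  move=> z; apply: le_trans (expR_ge1Dx _).
  by rewrite mulrAC.
have key (s : R) : 0 < s -> 2 * s ^+ 2 * (1 - s) <= (1 - s) * (1 + s) * m2.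
  move=> s0; have := tangent _ s0.
  rewrite -(@ler_pM2l _ (2 * s ^+ 2)); last by rewrite mulr_gt0// exprn_gt0.
  rewrite (_ : 2 * s ^+ 2 * (1 - (s ^- 2 - 1) / 2 * m2) =
      2 * s ^+ 2 - (1 - s ^+ 2) * m2); last by field; exact: lt0r_neq0.
  nra.
apply/le_anti/andP; split; rewrite leNgt; apply/negP => m2_1.
(* A value of s on the same side of 1 as m2, close enough to 1 for the tangent bound to fail;
   likewise in the second case. *)
- have s0 : 0 < 1 + (m2 - 1) / 4 :> R by lra.
  have := key _ s0; set t := (m2 - 1) / 4 => kt.
  have t0 : 0 < t by rewrite /t; lra.
  have m2E : m2 = 1 + 4 * t by rewrite /t; field.
  have : t * (2 + t) * m2 <= t * (2 * (1 + t) ^+ 2) by nra.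
  by rewrite -mulrA ler_pM2l// m2E; nra.
- have s0 : 0 < 1 - (1 - m2) / 2 :> R by lra.
  have := key _ s0; set t := (1 - m2) / 2 => kt.
  have t0 : 0 < t by rewrite /t; lra.
  have m2E : m2 = 1 - 2 * t by rewrite /t; field.
  have : t * (2 * (1 - t) ^+ 2) <= t * ((2 - t) * m2) by nra.
  by rewrite ler_pM2l// m2E; nra.
Qed.

Lemma prodP_rot (c s : R) (A : set (mR * mR)) : c ^+ 2 + s ^+ 2 = 1 -> measurable A ->
  prodP gamma gamma (rot c s @^-1` A) = prodP gamma gamma A.
Proof.
move=> cs mA.
have mrA : measurable (rot c s @^-1` A).
  by rewrite -[X in measurable X]setTI; apply: measurable_rot.
have key (B : set (mR * mR)) : measurable B ->
    prodP gamma gamma B = (\int[gamma]_x \int[gamma]_y (\1_B (x, y))%:E)%E.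
  move=> mB; rewrite -[in LHS](setIT B) -integral_indic//.
  have mF : measurable_fun setT (fun z : mR * mR => (\1_B z)%:E : \bar R).
    exact/measurable_EFinP.
  by apply: (etrans (fubini_tonelli1 _ mF _)) => // z; rewrite lee_fin.
rewrite (key _ mrA) (key _ mA).
have := @ge0_integral_rot _ c s (fun z => (\1_A z)%:E) cs.
apply; first exact/measurable_EFinP.
by move=> z; rewrite lee_fin.
Qed.

HB.instance Definition _ (c s : R) := isMeasurableFun.Build _ _ _ _ (rot c s)
  (measurable_rot c s).

Lemma L1_rot c s (f : mR * mR -> R) : c ^+ 2 + s ^+ 2 = 1 -> L1 (prodP gamma gamma) f ->
  L1 (prodP gamma gamma) (f \o rot c s).
Proof.
move=> cs if_; apply: L1_lawP; apply: L1_eq if_ => A mA.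
exact/esym/prodP_rot.
Qed.

Lemma Ex_rot c s (f : mR * mR -> R) : c ^+ 2 + s ^+ 2 = 1 -> L1 (prodP gamma gamma) f ->
  Ex (prodP gamma gamma) (f \o rot c s) = Ex (prodP gamma gamma) f.
Proof.
move=> cs if_; rewrite -Ex_law.
- by apply: Ex_eq => A mA; exact: prodP_rot.
- exact: L1_measurable if_.
- exact: L1_rot.
Qed.

(** The half turn of the plane changes the sign of the first coordinate and preserves the law. *)
Lemma gamma_odd (k : nat) : (k <= 6)%N -> odd k -> Ex gamma (fun z : mR => z ^+ k) = 0.
Proof.
move=> k6 ok.
have cs : (-1) ^+ 2 + 0 ^+ 2 = 1 :> R by rewrite sqrrN expr1n expr0n addr0.
have lk := gamma_L1_pow k6.
have := @Ex_rot _ _ (fun z => z.1 ^+ k) cs (L1_fst _ lk).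
rewrite (Ex_fst _ lk).
rewrite (_ : _ \o _ = fun z => - (z.1 ^+ k)); last first.
  by apply/funext => z /=; rewrite mul0r subr0 mulN1r exprNn -signr_odd ok expr1 mulN1r.
rewrite ExN; last exact: (L1_fst _ lk).
rewrite (Ex_fst _ lk); lra.
Qed.

(** Rotation by pi/4 turns x^4 + y^4 into (x^4 + y^4) / 2 + 3 x^2 y^2, so the fourth moment m4
    satisfies 2 m4 = m4 + 3. *)
Lemma gamma_pow4 : Ex gamma (fun z : mR => z ^+ 4) = 3.
Proof.
have l4 := gamma_L1_pow (isT : (4 <= 6)%N).
have l2 := gamma_L1_pow (isT : (2 <= 6)%N).
pose c : R := (Num.sqrt 2)^-1.
have c2 : c ^+ 2 = 2^-1 by rewrite exprVn sqr_sqrtr.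
have cs : c ^+ 2 + c ^+ 2 = 1 by rewrite c2; field.
have l22 : L1 (prodP gamma gamma) (fun z => z.1 ^+ 2 * z.2 ^+ 2).
  apply: (@L1_le _ _ _ _ _ (fun z : mR * mR => z.1 ^+ 4 + z.2 ^+ 4)).
  - by apply: measurable_funM; apply: measurable_funX.
  - move=> [x y] /=; rewrite ger0_norm; last by apply: mulr_ge0; exact: sqr_ge0.
    have := sqr_ge0 (x ^+ 2 - y ^+ 2); have := sqr_ge0 (x ^+ 2 + y ^+ 2).
    set u := x ^+ 2; set v := y ^+ 2.
    rewrite (_ : x ^+ 4 = u ^+ 2); last by rewrite -exprM.
    rewrite (_ : y ^+ 4 = v ^+ 2); last by rewrite -exprM.
    nra.
  - by apply: L1D; [exact: (L1_fst _ l4)|exact: (L1_snd _ l4)].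
have E22 : Ex (prodP gamma gamma) (fun z => z.1 ^+ 2 * z.2 ^+ 2) = 1.
  have [||-> _] := @Ex_prod _ _ _ _ _ gamma gamma (fun z => z.1 ^+ 2 * z.2 ^+ 2) => //.
    by move=> x; exact: (L1Z (x ^+ 2) l2).
  rewrite (_ : (fun x => _) = (fun x => x ^+ 2)) ?gamma_sqr//.
  by apply/funext => x; rewrite /= (ExZ (x ^+ 2) l2) gamma_sqr mulr1.
have lF : L1 (prodP gamma gamma) (fun z => z.1 ^+ 4 + z.2 ^+ 4).
  by apply: L1D; [exact: (L1_fst _ l4)|exact: (L1_snd _ l4)].
have := Ex_rot cs lF.
rewrite (_ : _ \o _ = fun z =>
   2^-1 * (z.1 ^+ 4 + z.2 ^+ 4) + 3 * (z.1 ^+ 2 * z.2 ^+ 2)); last first.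
  apply/funext => z /=.
  have -> : (c * z.1 - c * z.2) ^+ 4 + (c * z.1 + c * z.2) ^+ 4 =
    (c ^+ 2) ^+ 2 * (2 * z.1 ^+ 4 + 12 * (z.1 ^+ 2 * z.2 ^+ 2) + 2 * z.2 ^+ 4) by ring.
  by rewrite c2; field.
rewrite ExD; [|exact: L1Z|exact: L1Z].
rewrite ExZ// ExZ// E22 ExD; [|exact: (L1_fst _ l4)|exact: (L1_snd _ l4)].
rewrite (Ex_fst _ l4) (Ex_snd _ l4); lra.
Qed.

Lemma gamma_centred (b m : R) :
  centred gamma (fun z => b * z + m * (z ^+ 2 - 1)) (b ^+ 2 + 2 * m ^+ 2).
Proof.
have lp k : (k <= 6)%N -> L1 gamma (fun z : mR => z ^+ k) := @gamma_L1_pow k.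
have l1 := lp 1%N isT; have l2 := lp 2 isT; have l3 := lp 3 isT; have l4 := lp 4 isT.
have e1 := gamma_odd (isT : (1 <= 6)%N) isT; have e3 := gamma_odd (isT : (3 <= 6)%N) isT.
split.
- apply: measurable_funD; first exact: measurable_funM.
  apply: measurable_funM => //; apply: measurable_funB => //.
- apply: (L1_le _ _ (L1Z ((`|b| + `|m|) ^+ 3 * 4) (L1D (L1_cst gamma 1) (lp 6 isT)))).
    apply: measurable_absX; apply: measurable_funD; first exact: measurable_funM.
    by apply: measurable_funM => //; apply: measurable_funB.
  move=> z; rewrite ger0_norm ?exprn_ge0// -mulrA.
  apply: (@le_trans _ _ (((`|b| + `|m|) * (1 + z ^+ 2)) ^+ 3)).
    rewrite ler_pXn2r ?nnegrE ?mulr_ge0 ?addr_ge0 ?sqr_ge0//.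
    apply: le_trans (ler_normD _ _) _; rewrite !normrM mulrDl lerD//.
      rewrite ler_wpM2l// ler_norml; apply/andP; split; nra.
    rewrite ler_wpM2l// ler_norml; apply/andP; split; nra.
  rewrite exprMn ler_wpM2l ?exprn_ge0 ?addr_ge0//.
  rewrite (_ : z ^+ 6 = (z ^+ 2) ^+ 3); last by rewrite -exprM.
  have := sqr_ge0 z; set u := z ^+ 2 => u0.
  rewrite -subr_ge0 (_ : _ - _ = 3 * (1 + u) * (1 - u) ^+ 2); last by ring.
  by rewrite mulr_ge0 ?sqr_ge0// mulr_ge0// addr_ge0.
- rewrite (_ : (fun z => _) = fun z => b * z ^+ 1 + (m * z ^+ 2 - m)); last first.
    by apply/funext => z; ring.
  rewrite ExD; [|exact: L1Z|by apply: L1B; [exact: L1Z|exact: L1_cst]].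
  rewrite ExB; [|exact: L1Z|exact: L1_cst].
  by rewrite !ExZ// e1 gamma_sqr Ex_cst; ring.
- rewrite (_ : (fun z => _) = fun z => ((m ^+ 2 * z ^+ 4 + (b ^+ 2 - 2 * m ^+ 2) * z ^+ 2)
     + (2 * b * m * z ^+ 3 + (- (2 * b * m)) * z ^+ 1)) + m ^+ 2); last first.
    by apply/funext => z; ring.
  rewrite ExD; [|by apply: L1D; apply: L1D; exact: L1Z|exact: L1_cst].
  rewrite ExD; [|by apply: L1D; exact: L1Z|by apply: L1D; exact: L1Z].
  rewrite ExD; [|exact: L1Z|exact: L1Z].
  rewrite ExD; [|exact: L1Z|exact: L1Z].
  rewrite (ExZ _ l4) (ExZ _ l2) (ExZ _ l3) (ExZ _ l1).
  rewrite e1 e3 gamma_sqr gamma_pow4 Ex_cst; ring.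
Qed.

End normal_moments.

Section gaussian_moments.
Context {R : realType}.
Local Notation mR := (measurableTypeR R).
Local Notation gamma := (@normal_prob R 0 1 : probability mR R).

Lemma measurable_dot d dT (T : measurableType dT) (f g : T -> 'cV[R]_d) :
  measurable_fun setT f -> measurable_fun setT g ->
  measurable_fun setT (fun x => dot (f x) (g x)).
Proof.
move=> /measurable_coordP mf /measurable_coordP mg; under eq_fun do rewrite dotE.
by apply: measurable_sum => i; exact: measurable_funM.
Qed.

Lemma gvec_centred_diag d (b m : 'I_d -> R) :
  centred (gvec d) (fun v => \sum_i (b i * v i 0 + m i * (v i 0 ^+ 2 - 1)))
    (\sum_i (b i ^+ 2 + 2 * m i ^+ 2)).
Proof.
elim: d => [|d IH] in b m *.
  rewrite big_ord0; under eq_fun do rewrite big_ord0.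
  split=> //.
  - under eq_fun do rewrite normr0 expr0n; exact: L1_cst.
  - exact: Ex_cst.
  - under eq_fun do rewrite expr0n; exact: Ex_cst.
rewrite -[d.+1]/(1 + d)%N in b m *.
apply: (@centred_measure _ _ _ (distribution (prodP gamma (gvec d)) (@consv R d))).
  by move=> A mA; rewrite gvecS.
apply/centred_law.
  apply: measurable_sum => i; apply: measurable_funD.
    by apply: measurable_funM => //; exact: measurable_coord.
  apply: measurable_funM => //; apply: measurable_funB => //.
  by apply: measurable_funX; exact: measurable_coord.
pose l := lshift d (@ord0 0); pose r (i : 'I_d) : 'I_(1 + d) := rshift 1 i.
have := centred_prod (gamma_centred (b l) (m l)) (IH (b \o r) (m \o r)).
rewrite big_split_ord big_ord1/=.
apply: centred_eq => -[x w] /=.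
rewrite big_split_ord big_ord1/= /consv/= col_mxEu mxE eqxx mulr1n.
by congr (_ + _); apply: eq_bigr => i _; rewrite col_mxEd.
Qed.

Section affine_vector_map.
Context {d : nat} (mu : 'cV[R]_d) (S : 'M[R]_d).

Definition affv (v : 'cV[R]_d) := mu + S *m v.

Lemma measurable_affv : measurable_fun setT affv.
Proof. by apply: measurable_addmx => //; exact: measurable_mulmx. Qed.

HB.instance Definition _ := isMeasurableFun.Build _ _ _ _ affv measurable_affv.

End affine_vector_map.

Lemma gvec_affv_orth d (Q : 'M[R]_d) (A : set 'cV[R]_d) : Q^T *m Q = 1%:M ->
  measurable A -> distribution (gvec d) (affv 0 Q) A = gvec d A.
Proof.
move=> Qo mA; rewrite /distribution /pushforward.
have mQA : measurable (affv 0 Q @^-1` A).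
  by rewrite -[X in measurable X]setTI; apply: measurable_affv.
transitivity (\int[gvec d]_x (\1_(affv 0 Q @^-1` A) x)%:E)%E.
  by rewrite integral_indic// setIT.
transitivity (\int[gvec d]_x (\1_A x)%:E)%E; last first.
  by rewrite integral_indic// setIT.
have := gvec_orth Qo (f := fun x => (\1_A x)%:E).
move=> <-//; last exact/measurable_EFinP.
by apply: eq_integral => v _; rewrite -[in RHS](add0r (Q *m v)) !indicE.
Qed.

Lemma gaussE d (mu : 'cV[R]_d) (Sigma : 'M[R]_d) (A : set 'cV[R]_d) :
  gauss mu Sigma A = distribution (gvec d) (affv mu (sqrtmx Sigma)) A.
Proof. by []. Qed.

(** By orthogonal invariance M may be taken diagonal, and the coordinates then contribute
    independently. The linear and quadratic parts are uncorrelated because odd moments vanish, hence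
    no mixed term in the variance. *)
Lemma gvec_centred d (b : 'cV[R]_d) (M : 'M[R]_d) : M^T = M ->
  centred (gvec d) (fun v => dot b v + (dot v (M *m v) - \tr M))
    (dot b b + 2 * \tr (M *m M)).
Proof.
move=> Ms; have [V [D [VV DE]]] := spectral Ms.
have VV' : V *m V^T = 1%:M by exact: mulmx1C.
have DM : V^T *m M *m V = diag_mx D.
  by rewrite DE !mulmxA VV mul1mx -mulmxA VV mulmx1.
have VTo : (V^T)^T *m V^T = 1%:M by rewrite trmxK.
apply: (@centred_measure _ _ _ (distribution (gvec d) (affv 0 V))).
  by move=> A mA; exact: gvec_affv_orth.
apply/centred_law.
  apply: measurable_funD; first exact: measurable_dot.
  apply: measurable_funB => //; apply: measurable_dot => //; exact: measurable_mulmx.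
have -> : dot b b + 2 * \tr (M *m M) =
    \sum_i ((V^T *m b) i 0 ^+ 2 + 2 * D 0 i ^+ 2).
  rewrite big_split/= -mulr_sumr; congr (_ + _ * _).
    rewrite -[LHS](_ : dot (V^T *m b) (V^T *m b) = _); last first.
      by rewrite -dot_trmx mulmxA VV' mul1mx.
    by rewrite dotE; apply: eq_bigr => i _; rewrite expr2.
  transitivity (\tr (diag_mx D *m diag_mx D)); last first.
    by rewrite mulmx_diag mxtrace_diag; apply: eq_bigr => i _; rewrite mxE expr2.
  rewrite -DM -!mulmxA (mulmxA V) VV' mul1mx [RHS]mxtrace_mulC -!mulmxA VV'.
  by rewrite mulmx1.

apply: centred_eq (gvec_centred_diag (fun i => (V^T *m b) i 0) (fun i => D 0 i)) => v.
rewrite /= /affv add0r big_split/=; congr (_ + _).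
  by rewrite dot_trmx dotE.
have -> : dot (V *m v) (M *m (V *m v)) = dot v (diag_mx D *m v).
  by rewrite -DM -!mulmxA [RHS]dot_trmx trmxK.
have -> : \tr M = \tr (diag_mx D) by rewrite -DM mxtrace_mulC mulmxA VV' mul1mx.
rewrite mxtrace_diag dotE -sumrB; apply: eq_bigr => i _.
by rewrite mul_diag_mx mxE; ring.
Qed.

Lemma gauss_centred d (mu b : 'cV[R]_d) (Sigma A : 'M[R]_d) :
  psdmx Sigma -> A^T = A ->
  centred (gauss mu Sigma)
    (fun x => dot b (x - mu) + (dot (x - mu) (A *m (x - mu)) - \tr (A *m Sigma)))
    (dot b (Sigma *m b) + 2 * \tr (A *m Sigma *m (A *m Sigma))).
Proof.
move=> Sp As; pose S := sqrtmx Sigma.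
have Ss : S^T = S by exact: sqrtmx_sym.
have SS : S *m S = Sigma by exact: sqrtmx_sqr.
apply: (@centred_measure _ _ _ (distribution (gvec d) (affv mu S))) => //.
apply/centred_law.
  have mmu : measurable_fun setT (fun x : 'cV[R]_d => x - mu) by exact: measurable_addmx.
  apply: measurable_funD; first exact: measurable_dot.
  apply: measurable_funB => //; apply: measurable_dot => //.
  exact: measurableT_comp (measurable_mulmx A) mmu.
have Sdot (x y : 'cV[R]_d) : dot (S *m x) y = dot x (S *m y).
  by rewrite [RHS]dot_trmx Ss.
have SAS : (S *m A *m S)^T = S *m A *m S by rewrite !trmx_mul Ss As mulmxA.
have := gvec_centred (S *m b) SAS.
have -> : dot (S *m b) (S *m b) = dot b (Sigma *m b).
  by rewrite Sdot mulmxA SS.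
have -> : \tr (S *m A *m S *m (S *m A *m S)) = \tr (A *m Sigma *m (A *m Sigma)).
  by rewrite -!mulmxA mxtrace_mulC -SS !mulmxA.
have -> : \tr (S *m A *m S) = \tr (A *m Sigma).
  by rewrite -mulmxA mxtrace_mulC -mulmxA SS.
apply: centred_eq => v.
rewrite /= /affv [mu + _]addrC addrK; congr (_ + (_ - _)).
  by rewrite Sdot.
by rewrite Sdot !mulmxA.
Qed.

End gaussian_moments.

(** * The Wasserstein distance between Gaussian laws *)

Section wasserstein_gaussian.
Context {R : realType} {d : nat}.
Implicit Types (x y mu nu : 'cV[R]_d) (Sigma Xi A : 'M[R]_d)
  (P Q : probability 'cV[R]_d R).

Lemma sqnorm_dot x : sqnorm x = dot x x.
Proof. by rewrite dotE; apply: eq_bigr => i _; rewrite expr2. Qed.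

Lemma young_dot A x y : psdmx A -> A \in unitmx ->
  2 * dot x y <= dot x (A *m x) + dot y (invmx A *m y).
Proof.
move=> pA uA; have := young_mx x y pA uA.
by rewrite !dot_mulmx /dot /mxtrace !big_ord1.
Qed.

Lemma coupling_fst P Q pi (f : 'cV[R]_d -> R) : couplings P Q pi -> L1 P f ->
  L1 pi (f \o fst) /\ Ex pi (f \o fst) = Ex P f.
Proof.
move=> cpi if_; have PE (A : set 'cV[R]_d) : measurable A -> P A =
    distribution pi (@fst 'cV[R]_d 'cV[R]_d) A.
  move=> mA; have [<- _] := cpi _ mA; congr (pi _).
  by apply/seteqP; split => -[x y]//= [].
have i1 : L1 pi (f \o fst).
  by apply: (@L1_lawP _ _ _ _ _ pi (@fst 'cV[R]_d 'cV[R]_d)); exact: L1_eq if_.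
split=> //; rewrite (Ex_eq _ PE) Ex_law//; exact: L1_measurable if_.
Qed.

Lemma coupling_snd P Q pi (f : 'cV[R]_d -> R) : couplings P Q pi -> L1 Q f ->
  L1 pi (f \o snd) /\ Ex pi (f \o snd) = Ex Q f.
Proof.
move=> cpi if_; have QE (A : set 'cV[R]_d) : measurable A -> Q A =
    distribution pi (@snd 'cV[R]_d 'cV[R]_d) A.
  move=> mA; have [_ <-] := cpi _ mA; congr (pi _).
  by apply/seteqP; split => -[x y]//= [].
have i1 : L1 pi (f \o snd).
  by apply: (@L1_lawP _ _ _ _ _ pi (@snd 'cV[R]_d 'cV[R]_d)); exact: L1_eq if_.
split=> //; rewrite (Ex_eq _ QE) Ex_law//; exact: L1_measurable if_.
Qed.

Definition gelbrich mu nu Sigma Xi : R :=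
  dot (mu - nu) (mu - nu) + \tr Sigma + \tr Xi - 2 * fidelity Sigma Xi.

(** A pair of quadratic Kantorovich potentials: the minorant is a function of x plus a function of
    y, so its integral is the same under every coupling. Writing it around the means makes
    [gauss_centred] applicable. *)
Lemma cost_ge A mu nu x y : psdmx A -> A \in unitmx ->
  dot (mu - nu) (mu - nu) +
    (dot (2 *: (mu - nu)) (x - mu) + dot (x - mu) ((1%:M - A) *m (x - mu))) +
    (dot (2 *: (nu - mu)) (y - nu) + dot (y - nu) ((1%:M - invmx A) *m (y - nu)))
  <= dot (x - y) (x - y).
Proof.
move=> pA uA; have := young_dot (x - mu) (y - nu) pA uA.
have -> : x - y = (mu - nu) + ((x - mu) - (y - nu)).
  by apply/colP => i; rewrite !mxE; ring.
have -> : nu - mu = - (mu - nu) by rewrite opprB.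
move: (mu - nu) (x - mu) (y - nu) => e u w.
rewrite !mulmxBl !mul1mx !dotDr !dotDl !dotZl !(dotNr, dotNl).
rewrite (dotC u e) (dotC w e) (dotC w u); lra.
Qed.

Lemma gelbrich_le_cost mu nu Sigma Xi pi : psdmx Sigma -> psdmx Xi ->
  couplings (gauss mu Sigma) (gauss nu Xi) pi ->
  ((gelbrich mu nu Sigma Xi)%:E <= \int[pi]_z (sqnorm (z.1 - z.2))%:E)%E.
Proof.
move=> pS pX cpi; set P := gauss mu Sigma; set Q := gauss nu Xi.
have mF : measurable_fun setT (fun z : 'cV[R]_d * 'cV[R]_d => sqnorm (z.1 - z.2)).
  under eq_fun do rewrite sqnorm_dot.
  have mB : measurable_fun setT (fun z : 'cV[R]_d * 'cV[R]_d => z.1 - z.2).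
    apply: measurable_addmx => //; apply: measurable_fun_vec => i.
    under eq_fun do rewrite mxE; apply: measurableT_comp => //.
    exact: measurableT_comp (measurable_coord i) (@measurable_snd _ _ _ _).
  exact: measurable_dot.
have F0 (z : 'cV[R]_d * 'cV[R]_d) : 0 <= sqnorm (z.1 - z.2).
  by rewrite sqnorm_dot dot_ge0.
have [Foo|Foo] := boolP (\int[pi]_z (sqnorm (z.1 - z.2))%:E == +oo)%E.
  by rewrite (eqP Foo) leey.
have iF : L1 pi (fun z => sqnorm (z.1 - z.2)).
  apply/integrableP; split; first exact/measurable_EFinP.
  under eq_integral do rewrite /= ger0_norm//.
  by rewrite ltey.
rewrite (L1_fin iF) lee_fin; apply/ler_addgt0Pr => eta eta0.
have [A [pA uA hA]] := fidelity_approx pS pX eta0.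
have sI (M : 'M[R]_d) : psdmx M -> (1%:M - M)^T = 1%:M - M.
  by move=> pM; rewrite linearB/= trmx1 pM.1.
have pV := psdmx_invmx pA.
have cf := gauss_centred mu (2 *: (mu - nu)) pS (sI _ pA).
have cg := gauss_centred nu (2 *: (nu - mu)) pX (sI _ pV).
have [_ _ f0 _] := cf; have [_ _ g0 _] := cg.
have [if1 ef1] := coupling_fst cpi (centred_L1 cf).
have [ig1 eg1] := coupling_snd cpi (centred_L1 cg).
pose k := dot (mu - nu) (mu - nu) + \tr ((1%:M - A) *m Sigma) + \tr ((1%:M - invmx A) *m Xi).
have : k <= Ex pi (fun z => sqnorm (z.1 - z.2)).
  rewrite -[leLHS]addr0 -f0 -ef1 -[leLHS]addr0 -g0 -eg1 -[k in leLHS](Ex_cst pi).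
  rewrite -ExD//; last exact: L1_cst.
  rewrite -ExD//; last by apply: L1D => //; exact: L1_cst.
  apply: Ex_le => //; first by apply: L1D => //; apply: L1D => //; exact: L1_cst.
  move=> [x y] /=; rewrite sqnorm_dot; apply: le_trans (cost_ge mu nu x y pA uA).
  by rewrite /k le_eqVlt; apply/orP; left; apply/eqP; ring.
rewrite /k !mulmxBl !mul1mx !mxtraceB /gelbrich; lra.
Qed.

(** Both marginals are driven by the same standard vector v. As U v is standard too, K U is an
    admissible root of [Xi], and [fidelity_polar] makes the cross term the fidelity. No inverse is
    taken, so singular covariances are covered. *)
Lemma gelbrich_attained mu nu Sigma Xi : psdmx Sigma -> psdmx Xi ->
  exists2 pi, couplings (gauss mu Sigma) (gauss nu Xi) pi &
    (\int[pi]_z (sqnorm (z.1 - z.2))%:E)%E = (gelbrich mu nu Sigma Xi)%:E.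
Proof.
move=> pS pX; have [U [UU UE]] := fidelity_polar pS pX.
have [S SE] : exists S, S = sqrtmx Sigma by eexists.
have [K KE] : exists K, K = sqrtmx Xi by eexists.
have Ss : S^T = S by rewrite SE sqrtmx_sym.
have SS : S *m S = Sigma by rewrite SE sqrtmx_sqr.
have Ks : K^T = K by rewrite KE sqrtmx_sym.
have KK : K *m K = Xi by rewrite KE sqrtmx_sqr.
pose f (v : 'cV[R]_d) := (affv mu S v, affv nu (K *m U) v).
have mf : measurable_fun setT f.
  by apply/measurable_fun_pair; exact: measurable_affv.
pose fm : {mfun 'cV[R]_d >-> ('cV[R]_d * 'cV[R]_d)%type} :=
  HB.pack f (isMeasurableFun.Build _ _ _ _ f mf).
exists (distribution (gvec d) fm).
  move=> A mA; split.
    rewrite gaussE -SE /distribution /pushforward; congr (gvec d _).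
    by apply/seteqP; split => v //= [].
  rewrite gaussE -KE.
  have mA' : measurable (affv nu K @^-1` A).
    by rewrite -[X in measurable X]setTI; exact: measurable_affv.
  have := gvec_affv_orth UU mA'.
  rewrite /distribution /pushforward => <-; congr (gvec d _).
  by apply/seteqP; split => v /=; rewrite /affv add0r mulmxA => // -[].
set F := fun z : 'cV[R]_d * 'cV[R]_d => sqnorm (z.1 - z.2).
pose D : 'M[R]_d := S - K *m U; have [e eE] : exists e : 'cV[R]_d, e = mu - nu by eexists.
have cD : (D^T *m D)^T = D^T *m D by rewrite trmx_mul trmxK.
have cq := gvec_centred (2 *: (D^T *m e)) cD.
have FE v : F (f v) = (dot (2 *: (D^T *m e)) v + (dot v (D^T *m D *m v) - \tr (D^T *m D)))
    + gelbrich mu nu Sigma Xi.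
  rewrite /F sqnorm_dot /f /affv/=.
  have -> : mu + S *m v - (nu + K *m U *m v) = e + D *m v.
    by rewrite eE /D mulmxBl opprD addrACA.
  have -> : gelbrich mu nu Sigma Xi = dot e e + \tr (D^T *m D).
    rewrite /gelbrich -UE -eE -addrA -addrA; congr (_ + _).
    rewrite /D [(_ - _)^T]linearB/= trmx_mul Ss Ks mulmxBl !mulmxBr !mxtraceB SS.
    rewrite -(mulmxA U^T K (K *m U)) (mulmxA K K U) KK mulmxA.
    have -> : \tr (U^T *m Xi *m U) = \tr Xi.
      by rewrite mxtrace_mulC mulmxA (mulmx1C UU) mul1mx.
    have -> : \tr (S *m (K *m U)) = \tr (U^T *m K *m S).
      by rewrite -mxtrace_tr !trmx_mul Ss Ks.
    by rewrite -KE -SE; ring.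
  rewrite dotDr !dotDl dotZl -mulmxA.
  have -> : dot (D^T *m e) v = dot e (D *m v) by rewrite dot_trmx.
  have -> : dot v (D^T *m (D *m v)) = dot (D *m v) (D *m v).
    by rewrite [LHS]dot_trmx trmxK.
  rewrite (dotC (D *m v) e); ring.
have [_ _ c0 _] := cq; have c1 := centred_L1 cq.
have iFf : L1 (gvec d) (F \o fm).
  rewrite (_ : _ \o _ = fun v => F (f v))//; under eq_fun do rewrite FE.
  by apply: L1D => //; exact: L1_cst.
have mF : measurable_fun setT F.
  rewrite /F; under eq_fun do rewrite sqnorm_dot.
  have mB : measurable_fun setT (fun z : 'cV[R]_d * 'cV[R]_d => z.1 - z.2).
    apply: measurable_addmx => //; apply: measurable_fun_vec => i.
    under eq_fun do rewrite mxE; apply: measurableT_comp => //.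
    exact: measurableT_comp (measurable_coord i) (@measurable_snd _ _ _ _).
  exact: measurable_dot.
rewrite (L1_fin (L1_law mF iFf)) Ex_law//; congr EFin.
rewrite (_ : _ \o _ = fun v => F (f v))//; under eq_fun do rewrite FE.
by rewrite ExD ?c0 ?add0r ?Ex_cst//; exact: L1_cst.
Qed.

Lemma W2sq_gauss mu nu Sigma Xi : psdmx Sigma -> psdmx Xi ->
  W2sq (gauss mu Sigma) (gauss nu Xi) = (gelbrich mu nu Sigma Xi)%:E.
Proof.
move=> pS pX; apply/le_anti/andP; split.
  have [pi cpi <-] := gelbrich_attained mu nu pS pX.
  by apply: ereal_inf_lbound; exists pi.
by apply: le_ereal_inf_tmp => _ [pi cpi <-]; exact: gelbrich_le_cost.
Qed.

End wasserstein_gaussian.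

(** * Measurability of the statistic *)

Section sqrtmx_iteration.
Context {R : realType}.

Lemma cvg_bigsum n (F : 'I_n -> nat -> R) (l : 'I_n -> R) :
  (forall i, F i k @[k --> \oo] --> l i) -> \sum_i F i k @[k --> \oo] --> \sum_i l i.
Proof.
move=> Fl; elim: n => [|n IH] in F l Fl *.
  by rewrite big_ord0; under eq_fun do rewrite big_ord0; exact: cvg_cst.
rewrite big_ord_recl; under eq_fun do rewrite big_ord_recl.
by apply: cvgD => //; exact: IH.
Qed.

Implicit Types (a s r : R).

Definition sqrt_step s a (y : R) : R := y + (2 * s)^-1 * (a - y * y).

Lemma sqrt_step_bounds s r (k : nat) : 0 <= r <= s -> 0 < s ->
  let y := iter k (sqrt_step s (r ^+ 2)) 0 in
  0 <= y <= r /\ r - y <= r * (1 - r / (2 * s)) ^+ k.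
Proof.
move=> /andP[r0 rs] s0; have s20 : 0 < (2 * s)^-1 by rewrite invr_gt0 mulr_gt0.
have sE : s = 2^-1 * (2 * s)^-1^-1 by rewrite invrK mulKf.
have q1 : r / (2 * s) <= 2^-1.
  by rewrite ler_pdivrMr ?mulr_gt0// mulKf.
elim: k => [|k]; first by rewrite /= lexx r0 subr0 expr0 mulr1.
rewrite iterS; set y := iter k _ _ => -[/andP[y0 yr] IH] /=.
have E : r - sqrt_step s (r ^+ 2) y = (r - y) * (1 - (r + y) / (2 * s)).
  by rewrite /sqrt_step; field; exact: lt0r_neq0.
have f0 : 0 <= 1 - (r + y) / (2 * s).
  by rewrite subr_ge0 ler_pdivrMr ?mulr_gt0// mul1r; lra.
have f1 : 1 - (r + y) / (2 * s) <= 1 - r / (2 * s).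
  by rewrite lerD2l lerN2 ler_pM2r// lerDl.
have d0 : 0 <= r - y by rewrite subr_ge0.
split; last first.
  by rewrite E exprSr mulrA ler_pM.
apply/andP; split; last by rewrite -subr_ge0 E mulr_ge0.
apply: addr_ge0 => //; apply: mulr_ge0; first exact: ltW.
by rewrite subr_ge0 expr2 ler_pM.
Qed.

Lemma cvg_sqrt_step s a : 0 <= a -> Num.sqrt a <= s -> 0 < s ->
  iter k (sqrt_step s a) 0 @[k --> \oo] --> Num.sqrt a.
Proof.
move=> a0; rewrite -{2}(sqr_sqrtr a0); set r := Num.sqrt a => rs s0.
have r0 : 0 <= r by exact: sqrtr_ge0.
have B k := @sqrt_step_bounds s r k; rewrite r0 rs in B.
pose q := 1 - r / (2 * s).
have s20 : 0 < 2 * s by rewrite mulr_gt0.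
have q12 : r / (2 * s) <= 2^-1 by rewrite ler_pdivrMr// mulKf.
(* For r = 0 the contraction factor is 1 and gives no convergence; there the bounds 0 <= y <= r
   already fix the iterates at 0. *)
have [r00|rn0] := eqVneq r 0.
  rewrite [X in X @ _ --> _](_ : _ = fun=> r); first exact: cvg_cst.
  apply/funext => k; have [/andP[y0 yr] _] := B k isT s0.
  by apply/eqP; rewrite eq_le yr {1}r00.
have rp : 0 < r by rewrite lt_neqAle eq_sym rn0.
have rq : 0 < r / (2 * s) by rewrite divr_gt0.
have q1 : `|q| < 1 by rewrite /q ger0_norm; lra.
have cq : (r - r * q ^+ k) @[k --> \oo] --> r.
  rewrite -[X in _ --> X]subr0 -[X in _ --> _ - X](mulr0 r).
  apply: cvgB; first exact: cvg_cst.
  by apply: cvgM; [exact: cvg_cst|exact: cvg_expr].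
apply: squeeze_cvgr cq (cvg_cst r).
apply: nearW => k; have [/andP[y0 yr] h] := B k isT s0.
by rewrite yr andbT lerBlDr -lerBlDl.
Qed.

End sqrtmx_iteration.

Section sqrtmx_measurable.
Context {R : realType} {n : nat}.
Implicit Types (A B : 'M[R]_n).

(* [sqrtmx] is obtained by choice from an eigendecomposition; on nonnegative matrices this
   polynomial iteration exhibits it as a limit of measurable functions. *)
Definition sqrtmx_step s A (Y : 'M[R]_n) := Y + (2 * s)^-1 *: (A - Y *m Y).

Lemma cvg_sqrtmx_step A i j : psdmx A ->
  (iter k (sqrtmx_step (1 + \tr A) A) 0) i j @[k --> \oo] --> sqrtmx A i j.
Proof.
move=> pA; have [V [f [VV f0 AE]]] := psdmx_spectral pA.
(* A constant at least as large as every root of an eigenvalue f, since sqrt f <= 1 + f <= 1 + tr A;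
   it is positive even for A = 0, and measurable in A. *)
set s := 1 + \tr A.
have fs k : Num.sqrt (f k) <= s.
  have fk : f k <= \tr A.
    by rewrite AE conjD_mxtrace// (bigD1 k)//= lerDl sumr_ge0.
  have := sqr_sqrtr (f0 k); have := sqrtr_ge0 (f k); rewrite /s.
  set r := Num.sqrt _ => r0 rr; have := f0 k; nra.
have s0 : 0 < s.
  by rewrite /s ltr_wpDr// AE conjD_mxtrace// sumr_ge0.
have YE k : iter k (sqrtmx_step s A) 0 = conjD V (fun l => iter k (sqrt_step s (f l)) 0).
  elim: k => [|k IH]; first by rewrite /= conjD_cst//; apply/matrixP => x y; rewrite !mxE mul0rn.
  rewrite !iterS IH /sqrtmx_step conjD_mul// {1}AE.
  rewrite -[conjD V f - _](_ : conjD V (fun l => f l + -1 * (iter k (sqrt_step s (f l)) 0 * iter k (sqrt_step s (f l)) 0)) = _); last first.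
    by rewrite -conjDD -conjDZ scaleN1r.
  rewrite conjDZ conjDD; apply: eq_conjD => l.
  by rewrite iterS /sqrt_step mulN1r.
have conjDE (g : 'I_n -> R) : conjD V g i j = \sum_l (V i l * V j l) * g l.
  rewrite conjD_sum summxE; apply: eq_bigr => l _.
  by rewrite !mxE big_ord1 !mxE mulrC.
rewrite AE sqrtmx_conjD// -AE conjDE.
under eq_fun do rewrite YE conjDE.
apply: cvg_bigsum => l; apply: cvgM; first exact: cvg_cst.
exact: cvg_sqrt_step.
Qed.

Context dT (T : measurableType dT).

Definition measurable_mx m (A : T -> 'M[R]_(n, m)) :=
  forall i j, measurable_fun setT (fun w => A w i j).

Lemma measurable_sqrtmx (A : T -> 'M[R]_n) : (forall w, psdmx (A w)) ->
  measurable_mx A -> measurable_mx (fun w => sqrtmx (A w)).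
Proof.
move=> pA mA i j.
have mtr : measurable_fun setT (fun w => (2 * (1 + \tr (A w)))^-1).
  have s0 w : 0 < 2 * (1 + \tr (A w)).
    have [V [f [VV f0 ->]]] := psdmx_spectral (pA w).
    by rewrite mulr_gt0// ltr_wpDr// conjD_mxtrace// sumr_ge0.
  (* The reciprocal of a positive function, written as a composition of measurable functions. *)
  rewrite (_ : (fun w => _) = fun w => expR (- ln (2 * (1 + \tr (A w))))); last first.
    by apply/funext => w; rewrite expRN lnK// posrE.
  do 2 apply: measurableT_comp => //; apply: measurableT_comp; first exact: measurable_ln.
  apply: measurable_funM => //; apply: measurable_funD => //.
  exact: measurable_sum.
apply: (@measurable_fun_cvg _ _ _ _
    (fun k w => (iter k (sqrtmx_step (1 + \tr (A w)) (A w)) 0) i j)); last first.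
  by move=> w _; exact: cvg_sqrtmx_step.
move=> k; elim: k i j => [|k IH] i j.
  by rewrite (_ : (fun w => _) = fun=> 0)//; apply/funext => w; rewrite /= mxE.
under eq_fun do rewrite /= /sqrtmx_step mxE mxE mxE mxE mxE.
apply: measurable_funD; first exact: IH.
apply: measurable_funM => //; apply: measurable_funB => //.
by apply: measurable_sum => l; apply: measurable_funM; exact: IH.
Qed.

Lemma measurable_mxM m (A : T -> 'M[R]_n) (B : T -> 'M[R]_(n, m)) :
  measurable_mx A -> measurable_mx B -> measurable_mx (fun w => A w *m B w).
Proof.
move=> mA mB i j; under eq_fun do rewrite mxE.
by apply: measurable_sum => l; exact: measurable_funM.
Qed.

Lemma measurable_gelbrich (mu nu : T -> 'cV[R]_n) (Sigma Xi : T -> 'M[R]_n) :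
  measurable_fun setT mu -> measurable_fun setT nu ->
  (forall w, psdmx (Sigma w)) -> (forall w, psdmx (Xi w)) ->
  measurable_mx Sigma -> measurable_mx Xi ->
  measurable_fun setT (fun w => gelbrich (mu w) (nu w) (Sigma w) (Xi w)).
Proof.
move=> mmu mnu pS pX mS mX.
have mtr (A : T -> 'M[R]_n) : measurable_mx A -> measurable_fun setT (fun w => \tr (A w)).
  by move=> mA; exact: measurable_sum.
have md : measurable_fun setT (fun w => mu w - nu w).
  apply/measurable_coordP => i; under eq_fun do rewrite !mxE.
  by apply: measurable_funB; apply: measurableT_comp (measurable_coord i) _.
apply: measurable_funB.
  apply: measurable_funD; last exact: mtr.
  by apply: measurable_funD; [exact: measurable_dot|exact: mtr].
apply: measurable_funM => //; apply: mtr.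
apply: measurable_sqrtmx; first by move=> w; exact: psdmx_sandwich.
have ms := measurable_sqrtmx pS mS.
by apply: measurable_mxM => //; exact: measurable_mxM.
Qed.

End sqrtmx_measurable.

(** * Empirical moments and linearisation of the statistic *)

Section empirical.
Context {R : realType} {d n : nat}.
Implicit Types x : 'I_n -> 'cV[R]_d.

Lemma psdmx_scov x : psdmx (scov x).
Proof.
(* For samples of size at most 1 the factor is the inverse of 0, that is 0, so the claim holds for
   every n. *)
rewrite /scov; apply: psdmxZ; first by rewrite invr_ge0.
elim/big_ind : _ => [||i _].
- by split=> [|y]; rewrite ?trmx0// mulmx0 mul0mx mxE.
- exact: psdmxD.
- by rewrite -{1}[x i - smean x]trmxK; exact: psdmx_gram.
Qed.

Context dT (T : measurableType dT).

Lemma measurable_smean (X : 'I_n -> T -> 'cV[R]_d) :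
  (forall i, measurable_fun setT (X i)) ->
  measurable_fun setT (fun w => smean (X ^~ w)).
Proof.
move=> mX; apply/measurable_coordP => k.
under eq_fun do rewrite /smean mxE summxE.
apply: measurable_funM => //; apply: measurable_sum => i.
exact: measurableT_comp (measurable_coord k) (mX i).
Qed.

Lemma measurable_scov (X : 'I_n -> T -> 'cV[R]_d) :
  (forall i, measurable_fun setT (X i)) ->
  measurable_mx (fun w => scov (X ^~ w)).
Proof.
move=> mX k l.
under eq_fun do rewrite /scov mxE summxE.
apply: measurable_funM => //; apply: measurable_sum => i.
have mc j : measurable_fun setT (fun w => X i w j 0 - smean (X ^~ w) j 0).
  apply: measurable_funB; first exact: measurableT_comp (measurable_coord j) (mX i).
  exact: measurableT_comp (measurable_coord j) (measurable_smean mX).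
rewrite (_ : (fun w => _) = fun w => (X i w k 0 - smean (X ^~ w) k 0) *
    (X i w l 0 - smean (X ^~ w) l 0)).
  by apply: measurable_funM.
by apply/funext => w; rewrite mxE big_ord1 !mxE.
Qed.

End empirical.

Lemma dot_young (R : realFieldType) n (x y : 'cV[R]_n) :
  2 * `|dot x y| <= dot x x + dot y y.
Proof.
have q1 := dot_ge0 (x - y); have q2 := dot_ge0 (x + y).
rewrite dotBr !dotBl in q1; rewrite dotDr !dotDl in q2.
rewrite (dotC y x) in q1 q2.
by case: (ger0P (dot x y)) => _; lra.
Qed.

Lemma dot_sumr (R : comPzRingType) n I (r : seq I) (P : pred I) (x : 'cV[R]_n) F :
  dot x (\sum_(i <- r | P i) F i) = \sum_(i <- r | P i) dot x (F i).
Proof. by rewrite /dot mulmx_sumr summxE. Qed.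

Section sample_moments.
Context {R : realType} {d n : nat}.
Variables (mu : 'cV[R]_d) (Sigma : 'M[R]_d) (x : 'I_n -> 'cV[R]_d).

Definition smom : 'M[R]_d := n%:R^-1 *: \sum_i (x i - mu) *m (x i - mu)^T.

(** The single quantity that controls all remainders: squared errors of the two empirical moments,
    plus 1/n for the passage from n to n - 1. Its expectation is of order 1/n by [Ex_deviation]. It
    uses [smom], centred at the true mean, because [smom] is an average over the observations. *)
Definition deviation : R :=
  frob (smom - Sigma) + dot (smean x - mu) (smean x - mu) + n%:R^-1.

Hypothesis n2 : (2 <= n)%N.

Let n0 : n%:R != 0 :> R.
Proof. by rewrite pnatr_eq0 -lt0n ltnW. Qed.

Let n1E : n.-1%:R = n%:R - 1 :> R.
Proof. by case: n n2 => // k _ /=; rewrite -natr1 addrK. Qed.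

Let n1 : n%:R - 1 != 0 :> R.
Proof. by rewrite -n1E pnatr_eq0 -lt0n -ltnS prednK// ltnW. Qed.

Lemma smean_dev : smean x - mu = n%:R^-1 *: \sum_i (x i - mu).
Proof.
rewrite /smean sumrB sumr_const card_ord scalerBr -[mu *+ n]scaler_nat scalerA.
by rewrite mulVf// scale1r.
Qed.

Lemma scov_smom : scov x = (n%:R / (n%:R - 1)) *:
  (smom - (smean x - mu) *m (smean x - mu)^T).
Proof.
have [a aE] : exists a, a = smean x - mu by eexists.
have sa : \sum_i (x i - mu) = n%:R *: a.
  by rewrite aE smean_dev scalerA mulfV// scale1r.
have xa i : (x i - smean x) *m (x i - smean x)^T =
    (x i - mu) *m (x i - mu)^T + a *m a^T - ((x i - mu) *m a^T + a *m (x i - mu)^T).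
  have -> : x i - smean x = (x i - mu) - a by rewrite aE opprB addrA subrK.
  move: (x i - mu) => u.
  rewrite [(u - a)^T]linearB/= mulmxBr !mulmxBl opprB.
  by apply/matrixP => k l; rewrite !mxE; ring.
rewrite /scov /smom -aE n1E; under eq_bigr do rewrite xa.
rewrite sumrB !big_split/=.
have -> : \sum_(i < n) a *m a^T = n%:R *: (a *m a^T).
  by rewrite sumr_const card_ord scaler_nat.
have -> : \sum_i (x i - mu) *m a^T = n%:R *: (a *m a^T).
  by rewrite -mulmx_suml sa scalemxAl.
have -> : \sum_i a *m (x i - mu)^T = n%:R *: (a *m a^T).
  by rewrite -mulmx_sumr -raddf_sum/= sa linearZ/= scalemxAr.
rewrite opprD addrA addrK !scalerBr !scalerA.
congr (_ *: _ - _ *: _); last exact: mulrC.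
by rewrite mulrAC mulfV// mul1r.
Qed.

Lemma scov_sub : scov x - Sigma = (n%:R / (n%:R - 1)) *: (smom - Sigma) +
  ((n%:R - 1)^-1 *: Sigma -
   (n%:R / (n%:R - 1)) *: ((smean x - mu) *m (smean x - mu)^T)).
Proof.
rewrite scov_smom !scalerBr; have -> : (n%:R - 1)^-1 *: Sigma =
    (n%:R / (n%:R - 1)) *: Sigma - Sigma.
  by rewrite -{3}[Sigma]scale1r -scalerBl; congr (_ *: _); field.
by rewrite addrA [in RHS]addrA subrK addrAC.
Qed.

Let c1_bounds : 0 <= (n%:R : R) / (n%:R - 1) <= 2.
Proof.
have h : 2 <= n%:R :> R by rewrite (ler_nat R 2).
have p : 0 < n%:R - 1 :> R by lra.
by rewrite divr_ge0 ?ler_pdivrMr//=; lra.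
Qed.

Let c2_bounds : 0 <= (n%:R - 1 : R)^-1 <= 2 * n%:R^-1 /\ (n%:R - 1 : R)^-1 <= 1.
Proof.
have h : 2 <= n%:R :> R by rewrite (ler_nat R 2).
have p : 0 < n%:R - 1 :> R by lra.
rewrite invr_ge0 (ltW p)/=; split; last by rewrite invf_le1//; lra.
by rewrite -div1r ler_pdivrMr// mulrAC ler_pdivlMr; lra.
Qed.

Let dev0 : [/\ 0 <= frob (smom - Sigma), 0 <= dot (smean x - mu) (smean x - mu) &
  0 <= n%:R^-1 :> R].
Proof. by rewrite frob_ge0 dot_ge0 invr_ge0. Qed.

Lemma frobZ m p k (A : 'M[R]_(m, p)) : frob (k *: A) = k ^+ 2 * frob A.
Proof.
rewrite !frob_sum mulr_sumr; apply: eq_bigr => i _; rewrite mulr_sumr.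
by apply: eq_bigr => j _; rewrite mxE exprMn.
Qed.

Lemma frob_outer p (a : 'cV[R]_p) : frob (a *m a^T) = dot a a ^+ 2.
Proof.
rewrite /frob trmx_mul trmxK mulmxA -(mulmxA a) trmx_mulmx mul_mx_scalar.
by rewrite -scalemxAl linearZ/= -dot_tr expr2.
Qed.

(** A deviation of at most 1 lets the squared norm of the outer product of the mean error, a fourth
    power, be bounded by the second power. The constants come from n / (n - 1) <= 2 and 1 / (n - 1)
    <= 2 / n. *)
Lemma frob_scov_sub : deviation <= 1 ->
  frob (scov x - Sigma) <= (16 + 8 * frob Sigma) * deviation.
Proof.
rewrite /deviation scov_sub => dev1; have [D0 a0 i0] := dev0.
have := c1_bounds; have := c2_bounds.
set c1 := n%:R / (n%:R - 1); set c2 := (n%:R - 1)^-1; move=> [/andP[c20 c2n] c21] /andP[c10 c12].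
apply: le_trans (frobD _ _) _; rewrite frobZ.
have := frobD (c2 *: Sigma) (- (c1 *: ((smean x - mu) *m (smean x - mu)^T))).
rewrite frobN !frobZ frob_outer.
move: D0 a0 i0 dev1 c2n; have := frob_ge0 Sigma.
set S := frob Sigma; set D := frob _; set u := dot _ _; set v := n%:R^-1.
set F := frob _ => S0 D0 u0 v0 dev1 c2n hF.
have h1 : c1 ^+ 2 * D <= 4 * D by rewrite ler_wpM2r//; nra.
have h2 : c2 ^+ 2 * S <= 2 * v * S.
  by rewrite ler_wpM2r//; apply: le_trans c2n; rewrite expr2 ler_piMl.
have h3 : c1 ^+ 2 * u ^+ 2 <= 4 * u.
  by rewrite ler_pM ?sqr_ge0//; nra.
have SD : 0 <= S * D by rewrite mulr_ge0.
have Su : 0 <= S * u by rewrite mulr_ge0.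
lra.
Qed.

(** In first-order terms [scov] may be replaced by [smom]: their difference consists of 1 / (n - 1)
    times bounded terms and a quadratic term in the mean error. *)
Lemma mxtrace_scov_smom (B : 'M[R]_d) :
  `|\tr (B *m (scov x - Sigma)) - \tr (B *m (smom - Sigma))| <=
  (2 + 3 * frob B + 2 * `|\tr (B *m Sigma)|) * deviation.
Proof.
rewrite scov_sub /deviation; have [D0 a0 i0] := dev0.
have := c1_bounds; have := c2_bounds.
have c1E : (n%:R : R) / (n%:R - 1) = 1 + (n%:R - 1)^-1 by field.
set c2 := (_ - 1)^-1 in c1E *; rewrite c1E; move=> [/andP[c20 c2n] c21] /andP[c10 c12].
set a := smean x - mu; set D := smom - Sigma.
have -> : \tr (B *m ((1 + c2) *: D + (c2 *: Sigma - (1 + c2) *: (a *m a^T)))) =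
    \tr (B *m D) + (c2 * \tr (B *m D) + (c2 * \tr (B *m Sigma) - (1 + c2) * dot a (B *m a))).
  rewrite mulmxDr mulmxBr -!scalemxAr mxtraceD mxtraceB !mxtraceZ.
  have -> : \tr (B *m (a *m a^T)) = dot a (B *m a) by rewrite mulmxA -dot_tr dotC.
  by ring.
rewrite addrAC subrr add0r.
have h1 : 2 * `|\tr (B *m D)| <= frob B + frob D.
  have := mxtrace_mul_frob (B^T) D ltr01.
  by rewrite trmxK invr1 !mul1r frob_tr.
have h2 : 2 * `|dot a (B *m a)| <= dot a a + frob B * dot a a.
  have := dot_young a (B *m a); have := dot_frob B a; lra.
move: h1 h2 D0 a0 i0 c2n; rewrite -/a -/D.
have := frob_ge0 B; have := normr_ge0 (\tr (B *m Sigma)).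
have h3 : `|c2 * \tr (B *m D) + (c2 * \tr (B *m Sigma) - (1 + c2) * dot a (B *m a))| <=
    c2 * `|\tr (B *m D)| + (c2 * `|\tr (B *m Sigma)| + (1 + c2) * `|dot a (B *m a)|).
  apply: le_trans (ler_normD _ _) _; rewrite lerD//.
    by rewrite normrM (ger0_norm c20).
  apply: le_trans (ler_normB _ _) _.
  by rewrite !normrM (ger0_norm c20) (ger0_norm c10).
move: h3; set S := `|\tr (B *m Sigma)|; set Y := `|\tr (B *m D)|; set Z := `|dot a (B *m a)|.
set F := frob D; set u := dot a a; set v := n%:R^-1; set G := frob B.
move=> h3 S0 G0 h1 h2 F0 u0 v0 c2n.
have Y0 : 0 <= Y := normr_ge0 _.
have Z0 : 0 <= Z := normr_ge0 _.
apply: le_trans h3 _.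
have k1 : c2 * Y <= F / 2 + v * G.
  apply: (@le_trans _ _ (c2 * (G + F) / 2)); first by rewrite -mulrA ler_wpM2l//; lra.
  rewrite mulrDr mulrDl addrC lerD//.
    by rewrite ler_pM2r// ler_piMl.
  by rewrite ler_pdivrMr// mulrAC ler_wpM2r//; lra.
have k2 : c2 * S <= 2 * v * S by rewrite ler_wpM2r.
have k3 : (1 + c2) * Z <= u + G * u.
  apply: (@le_trans _ _ (2 * Z)); last by lra.
  by rewrite ler_wpM2r//; lra.
have := mulr_ge0 S0 F0; have := mulr_ge0 S0 u0; have := mulr_ge0 G0 F0.
have := mulr_ge0 G0 u0; have := mulr_ge0 G0 v0; have := mulr_ge0 S0 v0.
lra.
Qed.

End sample_moments.

Section delta_method.
Context {R : realType} {d : nat}.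
Implicit Types (mu nu : 'cV[R]_d) (Sigma Xi T : 'M[R]_d).

(** The influence function of [gelbrich] for an observation of the first sample when T is the
    transport map. For the second sample the roles of the two laws are exchanged and T is replaced
    by its inverse. *)
Definition influence mu nu Sigma T (x : 'cV[R]_d) : R :=
  dot (2 *: (mu - nu)) (x - mu) +
  (dot (x - mu) ((1%:M - T) *m (x - mu)) - \tr ((1%:M - T) *m Sigma)).

Lemma mean_influence mu nu Sigma T n (x : 'I_n -> 'cV[R]_d) : (2 <= n)%N ->
  n%:R^-1 * \sum_i influence mu nu Sigma T (x i) =
  2 * dot (mu - nu) (smean x - mu) + \tr ((1%:M - T) *m (smom mu x - Sigma)).
Proof.
move=> n2; have nn0 : n%:R != 0 :> R by rewrite pnatr_eq0 -lt0n ltnW.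
rewrite (smean_dev mu x n2) /smom !dotZr mulmxBr mxtraceB -!scalemxAr mxtraceZ.
rewrite mulmx_sumr raddf_sum/= dot_sumr.
rewrite /influence big_split sumrB/= sumr_const card_ord -(mulr_natl (\tr _)).
rewrite mulrDr mulrBr !mulrA mulVf// mul1r; congr (_ + (_ - _)).
  rewrite [2 / _]mulrC -mulrA; congr (_ * _); rewrite mulr_sumr.
  by apply: eq_bigr => i _; rewrite dotZl.
congr (_ * _); apply: eq_bigr => i _.
by rewrite mulmxA -dot_tr dotC.
Qed.

Lemma gelbrich_expansion mu nu Sigma Xi : psdmx Sigma -> psdmx Xi ->
  Sigma \in unitmx -> Xi \in unitmx ->
  exists C eta : R, [/\ 0 < eta, 0 <= C &
    forall n m (x : 'I_n -> 'cV[R]_d) (y : 'I_m -> 'cV[R]_d),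
    (2 <= n)%N -> (2 <= m)%N ->
    deviation mu Sigma x <= eta -> deviation nu Xi y <= eta ->
    `|gelbrich (smean x) (smean y) (scov x) (scov y) - gelbrich mu nu Sigma Xi
      - n%:R^-1 * \sum_i influence mu nu Sigma (otmap Sigma Xi) (x i)
      - m%:R^-1 * \sum_i influence nu mu Xi (invmx (otmap Sigma Xi)) (y i)|
    <= C * (deviation mu Sigma x + deviation nu Xi y)].
Proof.
move=> pS pX uS uX.
have [C [eta [eta0 C0 H]]] := fidelity_expansion pS pX uS uX.
have [T TE] : exists T, T = otmap Sigma Xi by eexists.
rewrite -TE in H *.
pose K1 := 16 + 8 * frob Sigma; pose K2 := 16 + 8 * frob Xi.
have K10 : 0 < K1 by have := frob_ge0 Sigma; rewrite /K1; lra.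
have K20 : 0 < K2 by have := frob_ge0 Xi; rewrite /K2; lra.
pose B1 := 1%:M - T; pose B2 := 1%:M - invmx T.
pose L1 := 2 + 3 * frob B1 + 2 * `|\tr (B1 *m Sigma)|.
pose L2 := 2 + 3 * frob B2 + 2 * `|\tr (B2 *m Xi)|.
have L10 : 0 <= L1 by rewrite !addr_ge0// mulr_ge0// ?frob_ge0.
have L20 : 0 <= L2 by rewrite !addr_ge0// mulr_ge0// ?frob_ge0.
(* Deviations below [e] meet the condition of [frob_scov_sub] and bring both empirical covariances
   into the domain of [fidelity_expansion]. In the constant that follows, 2 pays for the square of
   the difference of the mean errors. *)
pose e := Num.min 1 (Num.min (eta / K1) (eta / K2)).
have e0 : 0 < e by rewrite /e !lt_min ltr01 !divr_gt0.
exists (2 + C * K1 + C * K2 + L1 + L2), e; split => //.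
  by have := mulr_ge0 C0 (ltW K10); have := mulr_ge0 C0 (ltW K20); lra.
move=> n m x y n2 m2; rewrite /e !le_min => /and3P[x1 xS _] /and3P[y1 _ yX].
have fS := frob_scov_sub n2 x1; have fX := frob_scov_sub m2 y1.
have tS := mxtrace_scov_smom mu Sigma x n2 B1.
have tX := mxtrace_scov_smom nu Xi y m2 B2.
rewrite -/K1 in fS; rewrite -/K2 in fX; rewrite -/L1 in tS; rewrite -/L2 in tX.
have hS : frob (scov x - Sigma) <= eta.
  by apply: le_trans fS _; rewrite mulrC -ler_pdivlMr.
have hX : frob (scov y - Xi) <= eta.
  by apply: le_trans fX _; rewrite mulrC -ler_pdivlMr.
have := H _ _ (psdmx_scov x) (psdmx_scov y) hS hX.
rewrite !mean_influence//.
rewrite -/B1 -/B2 /gelbrich.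
have -> : smean x - smean y = (mu - nu) + ((smean x - mu) - (smean y - nu)).
  by apply/colP => i; rewrite !mxE; ring.
have ax : dot (smean x - mu) (smean x - mu) <= deviation mu Sigma x.
  by rewrite /deviation; have := frob_ge0 (smom mu x - Sigma);
     have : 0 <= n%:R^-1 :> R by []; lra.
have ay : dot (smean y - nu) (smean y - nu) <= deviation nu Xi y.
  by rewrite /deviation; have := frob_ge0 (smom nu y - Xi);
     have : 0 <= m%:R^-1 :> R by []; lra.
have EB1 M : \tr (B1 *m M) = \tr M - \tr (T *m M) by rewrite /B1 mulmxBl mul1mx mxtraceB.
have EB2 M : \tr (B2 *m M) = \tr M - \tr (invmx T *m M).
  by rewrite /B2 mulmxBl mul1mx mxtraceB.
rewrite (EB1 (scov x - Sigma)) mxtraceB in tS.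
rewrite (EB2 (scov y - Xi)) mxtraceB in tX.
have -> : nu - mu = - (mu - nu) by rewrite opprB.
move: ax ay tS tX fS fX.
move: (mu - nu) (smean x - mu) (smean y - nu) => e' a b.
have ab := dot_ge0 (a + b); rewrite dotDr !dotDl in ab.
rewrite !dotDr !dotDl !(dotNr, dotNl) in ab *.
rewrite (dotC b a) in ab; rewrite (dotC b a) (dotC a e') (dotC b e').
have d10 : 0 <= deviation mu Sigma x.
  by rewrite /deviation !addr_ge0 ?frob_ge0 ?dot_ge0.
have d20 : 0 <= deviation nu Xi y.
  by rewrite /deviation !addr_ge0 ?frob_ge0 ?dot_ge0.
move: d10 d20; set D1 := deviation _ _ _; set D2 := deviation _ _ _ => d10 d20.
move=> ax ay tS tX fS fX h.
have {}fS : C * frob (scov x - Sigma) <= C * K1 * D1 by rewrite -mulrA ler_wpM2l.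
have {}fX : C * frob (scov y - Xi) <= C * K2 * D2 by rewrite -mulrA ler_wpM2l.
have aux : 0 <= dot a a + dot b b - 2 * dot a b.
  by have := dot_ge0 (a - b); rewrite dotBr !dotBl (dotC b a); lra.
have p1 : 0 <= C * K1 * D2 by rewrite !mulr_ge0// ltW.
have p2 : 0 <= C * K2 * D1 by rewrite !mulr_ge0// ltW.
have p3 : 0 <= L1 * D2 by rewrite mulr_ge0.
have p4 : 0 <= L2 * D1 by rewrite mulr_ge0.
rewrite mulrDr in h.
move: h tS tX; rewrite !ler_norml => /andP[h1 h2] /andP[s1 s2] /andP[t1 t2].
apply/andP; split; lra.
Qed.

End delta_method.

(** * Laws of samples *)

Section tuple_law.
Context dU (U : measurableType dU) {R : realType} (P : probability U R).

Section cons_tuple.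
Variable n : nat.

Definition cons_tup (z : U * n.-tuple U) : n.+1.-tuple U :=
  [the n.+1.-tuple U of z.1 :: z.2].

Lemma measurable_cons_tup : measurable_fun setT cons_tup.
Proof. by apply: measurable_cons; [exact: measurable_fst|exact: measurable_snd]. Qed.

HB.instance Definition _ := isMeasurableFun.Build _ _ _ _ cons_tup measurable_cons_tup.

End cons_tuple.

Fixpoint ptuple (n : nat) : probability (n.-tuple U) R :=
  match n with
  | 0 => dirac [tuple]
  | n'.+1 => distribution (prodP P (ptuple n')) (@cons_tup n')
  end.

Definition rectangle n (B : 'I_n -> set U) : set (n.-tuple U) :=
  [set t | forall i, B i (tnth t i)].

Lemma measurable_rectangle n (B : 'I_n -> set U) : (forall i, measurable (B i)) ->
  measurable (rectangle B).
Proof.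
move=> mB; rewrite (_ : rectangle B = \bigcap_(i in [set: 'I_n]) ((@tnth n U ^~ i) @^-1` B i)).
  apply: fin_bigcap_measurable; first exact: finite_finset.
  move=> i _; rewrite -[X in measurable X]setTI; exact: measurable_tnth.
by apply/seteqP; split => t /= h i => [_|]; [exact: h|exact: (h i I)].
Qed.

Lemma ptuple_rectangle n (B : 'I_n -> set U) : (forall i, measurable (B i)) ->
  ptuple n (rectangle B) = (\prod_(i < n) P (B i))%E.
Proof.
elim: n B => [|n IH] B mB.
  rewrite big_ord0 /= diracE mem_set//.
  by move=> -[].
rewrite big_ord_recl -(IH (fun i => B (lift ord0 i)))//=.
rewrite /distribution /pushforward.
rewrite (_ : @cons_tup n @^-1` rectangle B =
    B ord0 `*` rectangle (fun i => B (lift ord0 i))).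
  by rewrite /prodP product_measure1E//; exact: measurable_rectangle.
apply/seteqP; split => -[x t] /=.
  move=> h; split; first exact: (h ord0).
  by move=> i; have := h (lift ord0 i); rewrite tnthS.
move=> [h1 h2] i; case: (unliftP ord0 i) => [j ->|->]//=.
by rewrite /cons_tup tnthS; exact: h2.
Qed.

Lemma ptuple_unique n (Q : probability (n.-tuple U) R) :
  (forall B : 'I_n -> set U, (forall i, measurable (B i)) ->
     Q (rectangle B) = (\prod_(i < n) P (B i))%E) ->
  forall A, measurable A -> Q A = ptuple n A.
Proof.
move=> QB; apply: (measure_unique
  [set rectangle B | B in [set B : 'I_n -> set U | forall i, measurable (B i)]]
  (fun=> setT)).
(* The sigma-algebra of tuples is generated by preimages under the coordinates, and such a preimage
   is a rectangle whose other sides are the whole space. *)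
- apply/seteqP; split.
    apply: smallest_sub; first exact: smallest_sigma_algebra.
    move=> A hA; apply: sub_sigma_algebra; move: A hA.
    elim/big_ind : _ => [//|S1 S2 h1 h2 A [/h1|/h2]//|i _ A [B mB <-]].
    exists (fun j => if j == i then B else setT).
      by move=> j /=; case: ifP.
    apply/seteqP; split => t /=.
      by move=> h; split => //; have := h i; rewrite eqxx.
    by move=> [_ h] j; case: eqP => [->|].
  apply: smallest_sub; first exact: sigma_algebra_measurable.
  by move=> _ [B mB <-]; exact: measurable_rectangle.
- move=> _ _ [B mB <-] [C mC <-]; exists (fun i => B i `&` C i).
    by move=> i; exact: measurableI.
  apply/seteqP; split => t /=.
    by move=> h; split => i; have [] := h i.
  by move=> [h1 h2] i; split.
- move=> _; exists (fun=> setT) => //.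
  by apply/seteqP; split.
- by rewrite bigcup_const.
- by move=> _ [B mB <-]; exact: etrans (QB B mB) (esym (ptuple_rectangle mB)).
- move=> _; apply: (@le_lt_trans _ _ 1%E); last exact: ltry.
  exact: probability_le1.
Qed.

Lemma centred_ptuple (f : U -> R) (v : R) (n : nat) : centred P f v ->
  centred (ptuple n) (fun t => \sum_(i < n) f (tnth t i)) (n%:R * v).
Proof.
move=> cf; elim: n => [|n IH].
  under eq_fun do rewrite big_ord0.
  split=> //.
  - under eq_fun do rewrite normr0 expr0n; exact: L1_cst.
  - exact: Ex_cst.
  - by under eq_fun do rewrite expr0n; rewrite Ex_cst mul0r.
apply/centred_law.
  apply: measurable_sum => i; have [mf _ _ _] := cf.
  exact: measurableT_comp mf (measurable_tnth i).
rewrite -natr1 mulrDl mul1r addrC.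
apply: centred_eq (centred_prod cf IH) => -[x t] /=.
rewrite big_ord_recl /=; congr (_ + _).
by apply: eq_bigr => i _; rewrite /cons_tup tnthS.
Qed.

End tuple_law.

Section sample_law.
Context dT (T : measurableType dT) dU (U : measurableType dU) {R : realType}.
Variable Pr : probability T R.

Section sample_tuple.
Variables (n : nat) (X : 'I_n -> {RV Pr >-> U}).

Definition sample_tup (w : T) : n.-tuple U := [tuple X i w | i < n].

Lemma measurable_sample_tup : measurable_fun setT sample_tup.
Proof.
apply/measurable_fun_tnthP => i.
rewrite (_ : _ \o _ = X i)//.
by apply/funext => w /=; rewrite tnth_mktuple.
Qed.

HB.instance Definition _ := isMeasurableFun.Build _ _ _ _ sample_tup measurable_sample_tup.

(** [independent_samples] is stated on the sigma-algebras generated by the samples; this places the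
    events of the tuples in them. *)
Lemma sample_tup_sigma A : measurable A -> g_sigma_preimage X (sample_tup @^-1` A).
Proof.
move=> mA.
have -> : g_sigma_preimage X = g_sigma_preimage (fun i => @tnth n U ^~ i \o sample_tup).
  congr g_sigma_preimage; apply/funext => i; apply/funext => w /=.
  by rewrite tnth_mktuple.
by rewrite g_sigma_preimage_comp; exists A => //; rewrite setTI.
Qed.

Lemma iid_law (P : probability U R) : iid X P ->
  forall A, measurable A -> distribution Pr sample_tup A = ptuple P n A.
Proof.
move=> [indep same]; apply: ptuple_unique => B mB.
rewrite /distribution /pushforward.
have := indep [set: 'I_n]%SET B mB.
rewrite [X in Pr X](_ : _ = sample_tup @^-1` rectangle B); last first.
  apply/seteqP; split => w /= h i; first by rewrite tnth_mktuple; apply: h; rewrite inE.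
  by move=> _; have := h i; rewrite tnth_mktuple.
move=> prB; apply: etrans prB _; apply: eq_big => [i|i _]; first by rewrite inE.
exact: (same i (B i) (mB i)).
Qed.

End sample_tuple.

Section two_samples.
Variables (n m : nat) (X : 'I_n -> {RV Pr >-> U}) (Y : 'I_m -> {RV Pr >-> U}).

Definition two_samples (w : T) := (sample_tup X w, sample_tup Y w).

Lemma measurable_two_samples : measurable_fun setT two_samples.
Proof. by apply/measurable_fun_pair; exact: measurable_sample_tup. Qed.

HB.instance Definition _ := isMeasurableFun.Build _ _ _ _ two_samples
  measurable_two_samples.

(** The point where the given probability space disappears: what follows depends on the laws and the
    sample sizes alone. *)
Lemma two_samples_law (P Q : probability U R) : iid X P -> iid Y Q ->
  independent_samples Pr X Y ->
  forall A, measurable A -> distribution Pr two_samples A = prodP (ptuple P n) (ptuple Q m) A.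
Proof.
move=> iX iY iXY A mA; apply/esym; apply: product_measure_unique => // B C mB mC.
transitivity (distribution Pr (sample_tup X) B * distribution Pr (sample_tup Y) C)%E.
  exact: (iXY _ _ (sample_tup_sigma mB) (sample_tup_sigma mC)).
by congr (_ * _)%E; exact: iid_law.
Qed.

End two_samples.

End sample_law.

(** * Lindeberg replacement *)

Section exp_taylor.
Context {R : realType}.
Implicit Types (x : R) (n : nat).

(** In the tail of the series, (i + 3)! >= i! bounds the terms by |x|^3 times those of the series of
    exp |x|. *)
Lemma expR_taylor2 x :
  `|expR x - (1 + x + x ^+ 2 / 2)| <= `|x| ^+ 3 * expR `|x|.
Proof.
have partial n : `|series (exp_coeff x) n.+3 - (1 + x + x ^+ 2 / 2)| <=
    `|x| ^+ 3 * series (exp_coeff `|x|) n.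
  have -> : series (exp_coeff x) n.+3 - (1 + x + x ^+ 2 / 2) =
      \sum_(i < n) x ^+ i.+3 / (i.+3)`!%:R.
    rewrite seriesEord/= !big_ord_recl /= /exp_coeff/= /bump/=.
    rewrite expr0 fact0 divr1 expr1 (_ : 1`! = 1)%N// divr1.
    rewrite -[(1 + (1 + 0))%N]/2%N (_ : 2`! = 2)%N//.
    transitivity (\sum_(i < n) x ^+ (1 + (1 + (1 + i))) / (1 + (1 + (1 + i)))`!%:R).
      by set T := \sum_(i < n) _; ring.
    by apply: eq_bigr => i _; rewrite !add1n.
  apply: le_trans (ler_norm_sum _ _ _) _.
  rewrite seriesEord/= mulr_sumr ler_sum// => i _; rewrite /exp_coeff/=.
  rewrite normrM normfV normr_nat normrX -[i.+3]/(3 + i)%N exprD -mulrA ler_wpM2l ?exprn_ge0//.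
  rewrite ler_wpM2l ?exprn_ge0// lef_pV2 ?posrE ?ltr0n ?fact_gt0// ler_nat.
  elim: (3)%N => [//|k IH]; rewrite addSn factS; apply: leq_trans IH _.
  by rewrite leq_pmull.
have bound n : `|series (exp_coeff x) n.+3 - (1 + x + x ^+ 2 / 2)| <= `|x| ^+ 3 * expR `|x|.
  apply: le_trans (partial n) _; rewrite ler_wpM2l ?exprn_ge0//.
  apply: nondecreasing_cvgn_le; last exact: is_cvg_series_exp_coeff.
  apply/nondecreasing_seqP => k; rewrite seriesSr lerDl.
  exact: exp_coeff_ge0.
apply: (@cvgr_to_le _ (n @[n --> \oo])
    _ _ (fun n => `|series (exp_coeff x) n.+3 - (1 + x + x ^+ 2 / 2)|)); last exact: nearW.
apply: cvg_norm; apply: cvgB; last exact: cvg_cst.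
have h : series (exp_coeff x) @ \oo --> expR x by exact: is_cvg_series_exp_coeff.
rewrite -(cvg_shiftn 3) in h; apply: cvg_trans h; apply: near_eq_cvg.
by apply: nearW => n; rewrite /= addn3.
Qed.

End exp_taylor.

Section gaussian_smoothing.
Context {R : realType}.
Local Notation mR := (measurableTypeR R).
Local Notation lambda := (@lebesgue_measure R).
Local Notation gamma := (@normal_prob R 0 1 : probability mR R).

(* The density of [N(u, 1)] with respect to [N(0, 1)]: shifting the argument of a Gaussian
   average moves the dependence on the shift to a smooth weight. *)
Definition tilt (u z : R) : R := expR (z * u - u ^+ 2 / 2).

Lemma measurable_tilt u : measurable_fun setT (tilt u : mR -> R).
Proof.
apply: measurableT_comp => //; apply: measurable_funB => //.
exact: measurable_funM.
Qed.

Lemma ge0_integral_tilt (u : R) (g : mR -> R) : measurable_fun setT g ->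
  (forall z, 0 <= g z) ->
  (\int[gamma]_z (g (z + u)%R)%:E = \int[gamma]_z (g z * tilt u z)%:E)%E.
Proof.
move=> mg g0.
have msh : measurable_fun setT (fun z : mR => z + u : mR) by exact: measurable_funD.
have mgs : measurable_fun setT (fun z : mR => g (z + u)) by exact: measurableT_comp mg msh.
have mp : measurable_fun setT (normal_pdf 0 1 : mR -> R) by exact: measurable_normal_pdf.
rewrite ge0_integral_normal; last 2 first.
- exact/measurable_EFinP.
- by move=> z; rewrite lee_fin.
rewrite ge0_integral_normal; last 2 first.
- by apply/measurable_EFinP; exact: measurable_funM mg (measurable_tilt u).
- by move=> z; rewrite lee_fin mulr_ge0// expR_ge0.
have := @ge0_integral_shift R u (fun z => (g z * (tilt u z * normal_pdf 0 1 z))%:E).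
move=> H; transitivity (\int[lambda]_x (g x * (tilt u x * normal_pdf 0 1 x))%:E)%E; last first.
  by apply: eq_integral => z _; rewrite -EFinM mulrA.
rewrite -H; last 2 first.
- apply/measurable_EFinP; apply: (measurable_funM mg).
  exact: measurable_funM (measurable_tilt u) mp.
- move=> z; rewrite lee_fin; apply: mulr_ge0; first exact: g0.
  by apply: mulr_ge0; [exact: expR_ge0|exact: normal_pdf_ge0].
apply: eq_integral => z _; rewrite -EFinM; congr (_%:E); congr (_ * _).
rewrite /tilt !normal_pdfE ?oner_eq0// /normal_fun !subr0 mulrCA -expRD.
congr (_ * expR _); rewrite expr1n -mulr_natr mul1r; field.
by [].
Qed.

Lemma L1_tilt u : L1 gamma (tilt u).
Proof.
apply/integrableP; split; first by apply/measurable_EFinP; exact: measurable_tilt.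
under eq_integral do rewrite /= ger0_norm ?expR_ge0// -[tilt u _]mul1r.
rewrite -(@ge0_integral_tilt u (fun=> 1))//.
by rewrite (integral_cst_probability gamma) ltry.
Qed.

Lemma L1_tilt_bounded u (g : mR -> R) B : measurable_fun setT g ->
  (forall z, `|g z| <= B) -> L1 gamma (fun z => g z * tilt u z).
Proof.
move=> mg gB; apply: (L1_le _ _ (L1Z B (L1_tilt u))).
  by apply: measurable_funM => //; exact: measurable_tilt.
by move=> z; rewrite normrM (ger0_norm (expR_ge0 _)) ler_wpM2r ?expR_ge0.
Qed.

Lemma Ex_tilt u (g : mR -> R) B : measurable_fun setT g -> (forall z, `|g z| <= B) ->
  Ex gamma (fun z => g (z + u)) = Ex gamma (fun z => g z * tilt u z).
Proof.
move=> mg gB.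
have msh : measurable_fun setT (fun z : mR => z + u : mR) by exact: measurable_funD.
have mgs : measurable_fun setT (fun z : mR => g (z + u)) by exact: measurableT_comp mg msh.
have B0 : 0 <= B by apply: le_trans (gB 0).
have h1 : Ex gamma (fun z => g (z + u) + B) = Ex gamma (fun z => (g z + B) * tilt u z).
  congr fine; apply: (@ge0_integral_tilt u (fun z => g z + B)).
    exact: measurable_funD.
  by move=> z; have := gB z; rewrite ler_norml => /andP[]; lra.
have h2 : Ex gamma (fun z => B * tilt u z) = B.
  rewrite -[RHS](Ex_cst gamma); congr fine.
  by rewrite -(@ge0_integral_tilt u (fun=> B)).
move: h1; rewrite ExD ?Ex_cst; [|exact: (L1_bounded _ mgs (fun z => gB (z + u)))|exact: L1_cst].
under [X in _ = Ex _ X]eq_fun do rewrite mulrDl.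
rewrite ExD ?h2; [|exact: L1_tilt_bounded gB|exact: L1Z (L1_tilt u)].
by move/addIr.
Qed.

(** [tilt] is the generating function of the Hermite polynomials; 1, z and z^2 - 1 are its first
    coefficients. *)
Definition tilt_rem (w z : R) : R :=
  tilt w z - (1 + w * z + w ^+ 2 / 2 * (z ^+ 2 - 1)).

Let q (z : R) : R := 1 + `|z|.

Let measurable_q : measurable_fun setT (q : mR -> R).
Proof.
exact: measurable_funD.
Qed.

Let L1_dom : L1 gamma (fun z => q z ^+ 3 * expR (q z)).
Proof.
have h := @gamma_L1_expR R 2 ltac:(by []).
(* From q^3 <= 6 exp q it remains to dominate exp(2 q), and 2 q <= 5 + 3 z^2 / 8 by completing the
   square at |z| = 8/3. *)
apply: (L1_le _ _ (L1Z (6 * expR 5) h)).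
  apply: measurable_funM; first exact: measurable_funX.
  exact: measurableT_comp.
move=> z; have q0 : 0 <= q z by rewrite /q addr_ge0.
rewrite ger0_norm ?mulr_ge0 ?exprn_ge0 ?expR_ge0// -mulrA -expRD.
have h3 : q z ^+ 3 <= 6 * expR (q z).
  have := @expR_ge1Dxn _ (q z) 2 q0; rewrite (_ : 3`! = 6)%N// => h3.
  rewrite -ler_pdivrMl//; apply: le_trans h3.
  by rewrite mulrC lerDr.
apply: (@le_trans _ _ (6 * (expR (q z) * expR (q z)))).
  by rewrite mulrA ler_wpM2r// expR_ge0.
rewrite ler_wpM2l// -expRD ler_expR /q.
have := sqr_ge0 (`|z| - 8 / 3); have -> : z ^+ 2 = `|z| ^+ 2 by rewrite real_normK ?num_real.
set a := `|z|; rewrite (_ : 2 ^- 2 = 4^-1); last by field.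
lra.
Qed.

Lemma tilt_rem_small w z : `|w| <= 1 ->
  `|tilt_rem w z| <= `|w| ^+ 3 * (2 * (q z ^+ 3 * expR (q z))).
Proof.
move=> w1; pose W := z * w - w ^+ 2 / 2.
have w0 := normr_ge0 w; have z0 := normr_ge0 z.
have ww : w ^+ 2 = `|w| ^+ 2 by rewrite real_normK ?num_real.
have Wle : `|W| <= `|w| * q z.
  apply: le_trans (ler_normB _ _) _; rewrite normrM /q mulrDr mulr1 addrC [`|z| * _]mulrC lerD2r.
  rewrite ger0_norm; last by apply: mulr_ge0 => //; exact: sqr_ge0.
  by rewrite ww; nra.
have q0 : 0 <= q z by rewrite /q addr_ge0.
(* The quadratic polynomial in W also contains terms in w^3 and w^4, collected in the last
   summand. *)
have -> : tilt_rem w z = (expR W - (1 + W + W ^+ 2 / 2)) + w ^+ 3 * (w / 8 - z / 2).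
  by rewrite /tilt_rem /tilt -/W [in RHS]/W; field.
have h1 : `|expR W - (1 + W + W ^+ 2 / 2)| <= `|w| ^+ 3 * (q z ^+ 3 * expR (q z)).
  apply: le_trans (expR_taylor2 W) _; rewrite mulrA -exprMn.
  rewrite ler_pM ?exprn_ge0 ?expR_ge0//.
    by rewrite lerXn2r ?nnegrE ?mulr_ge0.
  by rewrite ler_expR (le_trans Wle)// ler_piMl.
have h2 : `|w ^+ 3 * (w / 8 - z / 2)| <= `|w| ^+ 3 * (q z ^+ 3 * expR (q z)).
  rewrite normrM normrX ler_wpM2l ?exprn_ge0//.
  apply: (@le_trans _ _ (q z)).
    apply: le_trans (ler_normB _ _) _; rewrite !normrM !normfV !normr_nat /q; lra.
  have q1 : 1 <= q z by rewrite /q lerDl.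
  rewrite -[leLHS]mulr1 ler_pM//.
    by rewrite -[leLHS]expr1 ler_weXn2l.
  by apply: le_trans (expR_ge1Dx _); rewrite lerDl.
apply: le_trans (ler_normD _ _) _; apply: le_trans (lerD h1 h2) _.
by rewrite -mulrDr ler_wpM2l ?exprn_ge0//; lra.
Qed.

Lemma tilt_rem_large w z : 1 < `|w| ->
  `|tilt_rem w z| <= `|w| ^+ 3 * (2 + `|z| + z ^+ 2 + tilt w z).
Proof.
move=> w1; have z0 := normr_ge0 z.
have ww : w ^+ 2 = `|w| ^+ 2 by rewrite real_normK ?num_real.
have w3 (k : nat) : (k <= 3)%N -> `|w| ^+ k <= `|w| ^+ 3.
  by move=> k3; rewrite ler_weXn2l// ltW.
have t0 : 0 <= tilt w z by exact: expR_ge0.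
have h0 := w3 0%N isT; have h1 := w3 1%N isT; have h2 := w3 2%N isT.
rewrite expr0 in h0; rewrite expr1 in h1.
apply: le_trans (ler_normB _ _) _; rewrite (ger0_norm t0).
have : `|1 + w * z + w ^+ 2 / 2 * (z ^+ 2 - 1)| <= 1 + `|w| * `|z| + `|w| ^+ 2 * (z ^+ 2 + 1).
  apply: le_trans (ler_normD _ _) _; rewrite lerD//.
    by apply: le_trans (ler_normD _ _) _; rewrite normr1 normrM.
  rewrite normrM ww ger0_norm ?mulr_ge0 ?exprn_ge0//.
  have zz := sqr_ge0 z.
  rewrite ler_pM ?exprn_ge0 ?mulr_ge0 ?exprn_ge0//.
    by rewrite ler_piMr ?exprn_ge0//; lra.
  by rewrite ler_norml; apply/andP; split; lra.
have k1 : tilt w z <= `|w| ^+ 3 * tilt w z by rewrite ler_peMl.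
have k2 : `|w| * `|z| <= `|w| ^+ 3 * `|z| by rewrite ler_wpM2r.
have k3 : `|w| ^+ 2 * (z ^+ 2 + 1) <= `|w| ^+ 3 * (z ^+ 2 + 1).
  by rewrite ler_wpM2r// addr_ge0// sqr_ge0.
lra.
Qed.

Lemma L1_tilt_rem w : L1 gamma (tilt_rem w).
Proof.
apply: L1B; first exact: L1_tilt.
apply: L1D; first apply: L1D; first exact: L1_cst.
  by apply: L1Z; exact: (gamma_L1_pow (isT : (1 <= 6)%N)).
apply: L1Z; apply: L1B; last exact: L1_cst.
exact: (gamma_L1_pow (isT : (2 <= 6)%N)).
Qed.

(** Two regimes: for |w| <= 1 the Taylor bound has an integrable majorant independent of w; for |w|
    > 1 each term is bounded separately, using that [tilt w] has expectation 1 for every w. *)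
Lemma Ex_tilt_rem : exists2 K : R, 0 <= K &
  forall w, Ex gamma (fun z => `|tilt_rem w z|) <= K * `|w| ^+ 3.
Proof.
have lz : L1 gamma (fun z : mR => `|z|).
  exact: (L1_norm (gamma_L1_pow (isT : (1 <= 6)%N))).
have lz2 : L1 gamma (fun z : mR => z ^+ 2) := gamma_L1_pow (isT : (2 <= 6)%N).
have l3 : L1 gamma (fun z : mR => 2 + `|z| + z ^+ 2).
  by apply: L1D => //; apply: L1D => //; exact: L1_cst.
pose k1 := Ex gamma (fun z => 2 * (q z ^+ 3 * expR (q z))).
pose k2 := Ex gamma (fun z : mR => 2 + `|z| + z ^+ 2).
have k10 : 0 <= k1.
  apply: Ex_ge0 => z; apply: mulr_ge0 => //; apply: mulr_ge0; last exact: expR_ge0.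
  by apply: exprn_ge0; rewrite /q addr_ge0.
have k20 : 0 <= k2.
  by apply: Ex_ge0 => z; rewrite !addr_ge0// sqr_ge0.
exists (k1 + k2 + 1) => [|w]; first by rewrite !addr_ge0.
have w0 : 0 <= `|w| ^+ 3 by rewrite exprn_ge0.
have [w1|w1] := leP `|w| 1.
  apply: (@le_trans _ _ (k1 * `|w| ^+ 3)); last by rewrite ler_wpM2r// -addrA lerDl addr_ge0.
  have -> : k1 * `|w| ^+ 3 = Ex gamma (fun z => `|w| ^+ 3 * (2 * (q z ^+ 3 * expR (q z)))).
    by rewrite (ExZ _ (L1Z 2 L1_dom)) mulrC.
  apply: Ex_le; [exact: L1_norm (L1_tilt_rem w)|by apply: L1Z; exact: L1Z|].
  by move=> z; exact: tilt_rem_small.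
apply: (@le_trans _ _ ((k2 + 1) * `|w| ^+ 3)); last by rewrite ler_wpM2r// -addrA lerDr.
have -> : (k2 + 1) * `|w| ^+ 3 = Ex gamma (fun z => `|w| ^+ 3 * (2 + `|z| + z ^+ 2 + tilt w z)).
  rewrite ExZ; last by apply: L1D => //; exact: L1_tilt.
  rewrite ExD//; last exact: L1_tilt.
  rewrite mulrC; congr (_ * (_ + _)); rewrite -[LHS](Ex_cst gamma) (@Ex_tilt w (fun=> 1) 1)//.
    by apply: eq_Ex => z; rewrite mul1r.
  by move=> z; rewrite normr1.
apply: Ex_le; [exact: L1_norm (L1_tilt_rem w)| |].
  by apply: L1Z; apply: L1D => //; exact: L1_tilt.
by move=> z; exact: tilt_rem_large.
Qed.

End gaussian_smoothing.

Section lindeberg.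
Context {R : realType}.
Local Notation mR := (measurableTypeR R).
Local Notation gamma := (@normal_prob R 0 1 : probability mR R).

Lemma Ex_dist d (T : measurableType d) (P : probability T R) (f g : T -> R) e :
  L1 P f -> L1 P g -> (forall x, `|f x - g x| <= e) -> `|Ex P f - Ex P g| <= e.
Proof.
move=> lf lg fg; rewrite -ExB//; apply: Ex_norm_le => //.
by apply: measurable_funB; [exact: L1_measurable lf|exact: L1_measurable lg].
Qed.

Lemma L1_bounded_mul d (T : measurableType d) (P : probability T R) (f g : T -> R) B :
  measurable_fun setT f -> (forall x, `|f x| <= B) -> L1 P g ->
  L1 P (fun x => f x * g x).
Proof.
move=> mf fB lg; apply: (L1_le _ _ (L1Z B (L1_norm lg))).
  by apply: measurable_funM => //; exact: L1_measurable lg.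
by move=> x; rewrite normrM ler_wpM2r.
Qed.

Definition lipschitz_cst (L : R) (g : R -> R) := forall x y, `|g x - g y| <= L * `|x - y|.

Lemma lipschitz_continuous L g : 0 <= L -> lipschitz_cst L g -> continuous g.
Proof.
move=> L0 gL x; apply/cvgrPdist_le => e e0.
have e1 : 0 < e / (L + 1) by rewrite divr_gt0//; lra.
have /cvgrPdist_le/(_ _ e1) := @cvg_id _ (nbhs x).
apply: filterS => y xy; apply: le_trans (gL x y) _.
apply: (@le_trans _ _ (L * (e / (L + 1)))); first by rewrite ler_wpM2l.
by rewrite mulrA ler_pdivrMr; nra.
Qed.

Lemma lipschitz_measurable L g : 0 <= L -> lipschitz_cst L g ->
  measurable_fun setT (g : mR -> R).
Proof.
move=> L0 gL; apply: continuous_measurable_fun; exact: lipschitz_continuous gL.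
Qed.

(** Rotating the plane so that (a, b) lies on the first axis; the case a = b = 0, which defines no
    angle, is separate. *)
Lemma gaussian_convolution (h : R -> R) B s a b : measurable_fun setT (h : mR -> R) ->
  (forall x, `|h x| <= B) ->
  Ex gamma (fun z => Ex gamma (fun y => h (s + a * z + b * y))) =
  Ex gamma (fun z => h (s + Num.sqrt (a ^+ 2 + b ^+ 2) * z)).
Proof.
move=> mh hB; set r := Num.sqrt _.
have ab0 : 0 <= a ^+ 2 + b ^+ 2 by rewrite addr_ge0 ?sqr_ge0.
have rr : r ^+ 2 = a ^+ 2 + b ^+ 2 by rewrite sqr_sqrtr.
have [r0|r0] := eqVneq r 0.
  have : a ^+ 2 + b ^+ 2 = 0 by rewrite -rr r0 expr0n.
  move=> /eqP; rewrite paddr_eq0 ?sqr_ge0// !sqrf_eq0 => /andP[/eqP -> /eqP ->].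
  rewrite r0; under eq_fun do under eq_fun do rewrite !mul0r !addr0.
  by under eq_fun do rewrite Ex_cst; under [RHS]eq_Ex do rewrite mul0r addr0.
pose F (z : mR * mR) := h (s + r * z.1).
have mF : measurable_fun setT F.
  apply: measurableT_comp mh _; apply: measurable_funD => //.
  by apply: measurable_funM => //; exact: measurable_fst.
have lF : L1 (prodP gamma gamma) F by apply: (L1_bounded _ mF (k := B)) => z; exact: hB.
have cs : (a / r) ^+ 2 + (- (b / r)) ^+ 2 = 1.
  by rewrite sqrrN !expr_div_n -mulrDl -rr divff// expf_neq0.
have := Ex_rot cs lF.
have -> : F \o rot (a / r) (- (b / r)) = fun z => h (s + a * z.1 + b * z.2).
  apply/funext => z; rewrite /F /rot/=; congr h; field; exact: r0.
have mG : measurable_fun setT (fun z : mR * mR => h (s + a * z.1 + b * z.2)).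
  apply: measurableT_comp mh _; apply: measurable_funD.
    apply: measurable_funD => //; apply: measurable_funM => //; exact: measurable_fst.
  by apply: measurable_funM => //; exact: measurable_snd.
have [lG lGx _] := L1_prod_bounded gamma gamma mG (fun z => hB _).
rewrite (Ex_prod lG lGx).1 => ->.
rewrite -(@Ex_fst _ _ _ _ _ gamma gamma)//.
have mr : measurable_fun setT (fun z : mR => h (s + r * z)).
  apply: measurableT_comp mh _; apply: measurable_funD => //.
by apply: (L1_bounded _ mr (k := B)).
Qed.

Section mollifier.
Variables (g : R -> R) (B L delta : R).
Hypotheses (gB : forall x, `|g x| <= B) (L0 : 0 <= L) (gL : lipschitz_cst L g)
  (delta0 : 0 < delta).

Let mg : measurable_fun setT (g : mR -> R) := lipschitz_measurable L0 gL.

Definition mollify (s : R) : R := Ex gamma (fun z => g (s + delta * z)).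

Let mgs s : measurable_fun setT (fun z : mR => g (s + delta * z)).
Proof.
apply: measurableT_comp mg _; exact: measurable_funD.
Qed.

Let lgs s : L1 gamma (fun z => g (s + delta * z)).
Proof. by apply: (L1_bounded _ (mgs s) (k := B)). Qed.

Lemma mollify_bounded s : `|mollify s| <= B.
Proof. exact: Ex_norm_le (mgs s) _. Qed.

Lemma mollify_lipschitz : lipschitz_cst L mollify.
Proof.
move=> x y; apply: Ex_dist => // z.
by apply: le_trans (gL _ _) _; rewrite opprD addrACA subrr addr0.
Qed.

Lemma mollify_near s : `|mollify s - g s| <= L * delta * Ex gamma (fun z => `|z|).
Proof.
have lz : L1 gamma (fun z : mR => `|z|).
  exact: (L1_norm (gamma_L1_pow (isT : (1 <= 6)%N))).
rewrite /mollify -[g s](Ex_cst gamma) -ExB//; last exact: L1_cst.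
apply: le_trans (Ex_norm _) _; first by apply: L1B => //; exact: L1_cst.
rewrite -ExZ//; apply: Ex_le; [by apply/L1_norm/L1B => //; exact: L1_cst|exact: L1Z|].
move=> z; apply: le_trans (gL _ _) _.
by rewrite [s + _]addrC addrK normrM (gtr0_norm delta0) mulrA.
Qed.

(** By [Ex_tilt] the shift u acts on the weight only, and the expansion of the weight gives that of
    [mollify]: the coefficients are averages of g against Hermite polynomials. The bound is uniform
    in s although g is merely Lipschitz. *)
Lemma mollify_taylor : exists K (a b : R -> R), 0 <= K /\
  forall s u, `|mollify (s + u) - (mollify s + a s * u + b s * u ^+ 2)| <= K * `|u| ^+ 3.
Proof.
have [K3 K30 hK3] := @Ex_tilt_rem R.
have lz : L1 gamma (fun z : mR => z) := gamma_L1_pow (isT : (1 <= 6)%N).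
have lz2 : L1 gamma (fun z : mR => z ^+ 2 - 1).
  by apply: L1B; [exact: (gamma_L1_pow (isT : (2 <= 6)%N))|exact: L1_cst].
have B0 : 0 <= B by apply: le_trans (gB 0).
exists (B * K3 / delta ^+ 3), (fun s => Ex gamma (fun z => g (s + delta * z) * z) / delta),
  (fun s => Ex gamma (fun z => g (s + delta * z) * (z ^+ 2 - 1)) / (2 * delta ^+ 2)).
split => [|s u]; first by apply: divr_ge0; [exact: mulr_ge0|apply: exprn_ge0; exact: ltW].
pose G (z : mR) := g (s + delta * z); pose w := u / delta.
have mG : measurable_fun setT G by exact: mgs.
have GB z : `|G z| <= B by exact: gB.
have dn0 : delta != 0 by rewrite gt_eqF.
have -> : mollify (s + u) = Ex gamma (fun z => G (z + w)).
  apply: eq_Ex => z; rewrite /G /w; congr g; field; exact: dn0.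
rewrite (Ex_tilt w mG GB).
have lG1 : L1 gamma (fun z => G z * z) := L1_bounded_mul mG GB lz.
have lG2 : L1 gamma (fun z => G z * (z ^+ 2 - 1)) := L1_bounded_mul mG GB lz2.
have lG0 : L1 gamma G := lgs s.
have lGr : L1 gamma (fun z => G z * tilt_rem w z).
  exact: L1_bounded_mul mG GB (L1_tilt_rem w).
have -> : Ex gamma (fun z => G z * tilt w z) =
    mollify s + w * Ex gamma (fun z => G z * z) +
    w ^+ 2 / 2 * Ex gamma (fun z => G z * (z ^+ 2 - 1)) +
    Ex gamma (fun z => G z * tilt_rem w z).
  rewrite -!ExZ// /mollify -/G -!ExD//.
  - by apply: eq_Ex => z; rewrite /tilt_rem; ring.
  - by apply: L1D; [apply: L1D => //; exact: L1Z|exact: L1Z].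
  - by apply: L1D => //; exact: L1Z.
  - exact: L1Z.
  - exact: L1Z.
set X := Ex gamma (fun z => G z * z); set Y := Ex gamma (fun z => G z * (_ - _)).
set Z := Ex gamma (fun z => G z * tilt_rem w z).
have -> : mollify s + w * X + w ^+ 2 / 2 * Y + Z -
    (mollify s + X / delta * u + Y / (2 * delta ^+ 2) * u ^+ 2) = Z.
  by rewrite /w; field; exact: dn0.
have -> : B * K3 / delta ^+ 3 * `|u| ^+ 3 = B * (K3 * `|w| ^+ 3).
  rewrite /w normrM normfV (gtr0_norm delta0); field; exact: dn0.
apply: (@le_trans _ _ (B * Ex gamma (fun z => `|tilt_rem w z|))); last by rewrite ler_wpM2l.
apply: le_trans (Ex_norm lGr) _; rewrite -ExZ; last exact: L1_norm (L1_tilt_rem w).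
apply: Ex_le; [exact: L1_norm|by apply: L1Z; exact: L1_norm (L1_tilt_rem w)|].
by move=> z; rewrite normrM ler_wpM2r.
Qed.

End mollifier.

Section swap.
Variables (h a b : R -> R) (B K : R).
Hypotheses (mh : measurable_fun setT (h : mR -> R)) (hB : forall x, `|h x| <= B)
  (K0 : 0 <= K)
  (hK : forall s u, `|h (s + u) - (h s + a s * u + b s * u ^+ 2)| <= K * `|u| ^+ 3).

Let L1h d (T : measurableType d) (P : probability T R) (f : T -> R) :
  measurable_fun setT f -> L1 P (fun x => h (f x)).
Proof.
move=> mf; have mhf : measurable_fun setT (fun x => h (f x)).
  exact: measurableT_comp mh mf.
by apply: (L1_bounded _ mhf (k := B)).
Qed.

(** Centring kills the linear coefficient, and the quadratic one sees only the variance. Up to third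
    moments the value is thus the same for all laws with variance v, in particular for the normal
    one. *)
Lemma swap_one d (T : measurableType d) (P : probability T R) f v s c :
  0 <= c -> centred P f v ->
  `|Ex P (fun x => h (s + c * f x)) - (h s + b s * c ^+ 2 * v)| <=
  K * c ^+ 3 * Ex P (fun x => `|f x| ^+ 3).
Proof.
move=> c0 cf; have [mf l3 f1 f2] := cf.
have l1 := centred_L1 cf; have l2 := centred_L2 cf.
have mcf : measurable_fun setT (fun x => s + c * f x).
  by apply: measurable_funD => //; exact: measurable_funM.
have lh := L1h P mcf.
have lq : L1 P (fun x => h s + a s * c * f x + b s * c ^+ 2 * f x ^+ 2).
  by apply: L1D; [apply: L1D; [exact: L1_cst|exact: L1Z]|exact: L1Z].
have -> : h s + b s * c ^+ 2 * v =
    Ex P (fun x => h s + a s * c * f x + b s * c ^+ 2 * f x ^+ 2).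
  rewrite ExD; [|by apply: L1D; [exact: L1_cst|exact: L1Z]|exact: L1Z].
  rewrite ExD; [|exact: L1_cst|exact: L1Z].
  by rewrite !ExZ// Ex_cst f1 f2 mulr0 addr0.
rewrite -ExB//; apply: le_trans (Ex_norm _) _; first exact: L1B.
rewrite -ExZ//; apply: Ex_le; [exact/L1_norm/L1B|exact: L1Z|].
move=> x; have := hK s (c * f x).
have -> : `|c * f x| ^+ 3 = c ^+ 3 * `|f x| ^+ 3 by rewrite normrM (ger0_norm c0) exprMn.
by rewrite [(c * f x) ^+ 2]exprMn !mulrA.
Qed.

Lemma gamma_centred_sqrt v : 0 <= v -> centred gamma (fun z => Num.sqrt v * z) v.
Proof.
move=> v0; have := gamma_centred (Num.sqrt v) 0.
rewrite expr0n mulr0 addr0 sqr_sqrtr//; apply: centred_eq => z.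
by rewrite mul0r addr0.
Qed.

Definition third_moments d (T : measurableType d) (P : probability T R) (f : T -> R) (v : R) :=
  Ex P (fun x => `|f x| ^+ 3) + Ex gamma (fun z => `|Num.sqrt v * z| ^+ 3).

Lemma swap_gauss d (T : measurableType d) (P : probability T R) f v s c :
  0 <= c -> centred P f v ->
  `|Ex P (fun x => h (s + c * f x)) - Ex gamma (fun z => h (s + c * (Num.sqrt v * z)))| <=
  K * c ^+ 3 * third_moments P f v.
Proof.
move=> c0 cf; have v0 : 0 <= v.
  by have [_ _ _ <-] := cf; apply: Ex_ge0 => x; exact: sqr_ge0.
have h1 := swap_one s c0 cf; have h2 := swap_one s c0 (gamma_centred_sqrt v0).
rewrite /third_moments mulrDr; apply: le_trans (lerD h1 h2).
rewrite [X in _ <= _ + X]distrC; apply: le_trans (ler_normD _ _).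
by rewrite addrA subrK.
Qed.

(** Induction on n. The first observation is absorbed in the shift s while the others are replaced
    by one normal variable; then the first is replaced in turn, and the two normal variables are
    merged by [gaussian_convolution]. *)
Lemma lindeberg d (U : measurableType d) (P : probability U R) f v s c n :
  0 <= c -> centred P f v ->
  `|Ex (ptuple P n) (fun t => h (s + c * \sum_(i < n) f (tnth t i))) -
    Ex gamma (fun z => h (s + c * Num.sqrt (n%:R * v) * z))| <=
  n%:R * (K * c ^+ 3 * third_moments P f v).
Proof.
move=> c0 cf; have [mf _ _ _] := cf.
have v0 : 0 <= v.
  by have [_ _ _ <-] := cf; apply: Ex_ge0 => x; exact: sqr_ge0.
have mS k : measurable_fun setT (fun t : k.-tuple U => \sum_(i < k) f (tnth t i)).
  by apply: measurable_sum => i; exact: measurableT_comp mf (measurable_tnth i).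
elim: n s => [|n IH] s.
  rewrite !mul0r sqrtr0 mulr0.
  under eq_fun do rewrite big_ord0 mulr0.
  by under [X in _ - Ex _ X]eq_fun do rewrite mul0r; rewrite !Ex_cst subrr normr0.
set tau := c * Num.sqrt (n%:R * v); set rho := K * c ^+ 3 * _.
have mcs (x : R) : measurable_fun setT (fun t : n.-tuple U => x + c * \sum_(i < n) f (tnth t i)).
  by apply: measurable_funD => //; apply: measurable_funM => //; exact: mS.
have m1 : measurable_fun setT (fun z : U * n.-tuple U =>
    s + c * f z.1 + c * \sum_(i < n) f (tnth z.2 i)).
  apply: measurable_funD.
    apply: measurable_funD => //; apply: measurable_funM => //.
    exact: measurableT_comp mf measurable_fst.
  apply: measurable_funM => //; exact: measurableT_comp (mS n) measurable_snd.
have m2 : measurable_fun setT (fun z : U * mR => s + c * f z.1 + tau * z.2).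
  apply: measurable_funD.
    apply: measurable_funD => //; apply: measurable_funM => //.
    exact: measurableT_comp mf measurable_fst.
  by apply: measurable_funM => //; exact: measurable_snd.
have -> : Ex (ptuple P n.+1) (fun t => h (s + c * \sum_(i < n.+1) f (tnth t i))) =
    Ex P (fun x => Ex (ptuple P n) (fun t => h (s + c * f x + c * \sum_(i < n) f (tnth t i)))).
  rewrite /= Ex_law.
  - rewrite -(Ex_prod (L1h (prodP P (ptuple P n)) m1) _).1.
      apply: eq_Ex => -[x t]; rewrite /= big_ord_recl/= mulrDr addrA.
      by congr (h (_ + _ * _)); apply: eq_bigr => i _; rewrite /cons_tup tnthS.
    by move=> x; apply: L1h; exact: measurableT_comp m1 (measurable_pair1 x).
  - apply: measurableT_comp mh _; apply: measurable_funD => //.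
    by apply: measurable_funM => //; exact: mS.
  - apply: (L1h (prodP P (ptuple P n)) (f := fun z => s + c * \sum_(i < n.+1) f (tnth (cons_tup z) i))).
    apply: measurable_funD => //; apply: measurable_funM => //.
    exact: measurableT_comp (mS n.+1) (@measurable_cons_tup _ _ _).
have i1 (x : U) : L1 (ptuple P n) (fun t => h (s + c * f x + c * \sum_(i < n) f (tnth t i))).
  by apply: L1h; exact: mcs.
have mtau (x : R) : measurable_fun setT (fun z : mR => x + tau * z).
  by apply: measurable_funD => //; exact: measurable_funM.
have i2 (x : U) : L1 gamma (fun z => h (s + c * f x + tau * z)) by apply: L1h; exact: mtau.
have [_ l1] := Ex_prod (L1h (prodP P (ptuple P n)) m1) i1.
have [_ l2] := Ex_prod (L1h (prodP P gamma) m2) i2.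
have step1 := Ex_dist l1 l2 (fun x => IH (s + c * f x)).
have mcf (z : R) : measurable_fun setT (fun x => s + c * f x + tau * z).
  apply: measurable_funD => //; apply: measurable_funD => //; exact: measurable_funM.
have i3 z : L1 P (fun x => h (s + c * f x + tau * z)) by apply: L1h; exact: mcf.
(* Exchanging the integrals puts the normal variable outside, where it plays the role of the shift
   for the remaining observation. *)
have swap := Ex_prod_swap (L1h (prodP P gamma) m2) i2 i3.
rewrite /= in swap.
have gconv := @gaussian_convolution h B s tau (c * Num.sqrt v) mh hB.
have tauE : Num.sqrt (tau ^+ 2 + (c * Num.sqrt v) ^+ 2) = c * Num.sqrt (n.+1%:R * v).
  rewrite /tau !exprMn !sqr_sqrtr ?mulr_ge0// -mulrDr -[X in _ + X]mul1r -mulrDl natr1.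
  by rewrite sqrtrM ?sqr_ge0// sqrtr_sqr ger0_norm.
rewrite tauE in gconv; rewrite -gconv.
rewrite -natr1 mulrDl mul1r.
have m3 : measurable_fun setT (fun z : mR * U => s + tau * z.1 + c * f z.2).
  apply: measurable_funD.
    by apply: measurable_funD => //; apply: measurable_funM => //; exact: measurable_fst.
  apply: measurable_funM => //; exact: measurableT_comp mf measurable_snd.
have m4 : measurable_fun setT (fun z : mR * mR => s + tau * z.1 + c * Num.sqrt v * z.2).
  apply: measurable_funD.
    by apply: measurable_funD => //; apply: measurable_funM => //; exact: measurable_fst.
  by apply: measurable_funM => //; exact: measurable_snd.
have i4 (z : R) : L1 P (fun x => h (s + tau * z + c * f x)).
  by apply: L1h; apply: measurable_funD => //; exact: measurable_funM.
have i5 (z : R) : L1 gamma (fun y => h (s + tau * z + c * Num.sqrt v * y)).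
  by apply: L1h; apply: measurable_funD => //; exact: measurable_funM.
have [_ l3] := Ex_prod (L1h (prodP gamma P) m3) i4.
have [_ l4] := Ex_prod (L1h (prodP gamma gamma) m4) i5.
have dist2 (z : mR) : `|Ex P (fun x => h (s + tau * z + c * f x)) -
    Ex gamma (fun y => h (s + tau * z + c * Num.sqrt v * y))| <= rho.
  have := swap_gauss (s + tau * z) c0 cf; rewrite -/rho.
  by under [X in _ - Ex _ X]eq_fun do rewrite mulrA.
have step2 := Ex_dist l3 l4 dist2.
apply: le_trans (lerD step1 step2); rewrite /= swap.
rewrite [X in _ <= `|_ - X| + _](_ : _ =
  Ex gamma (fun z => Ex P (fun x => h (s + tau * z + c * f x)))); last first.
  by apply: eq_Ex => z; apply: eq_Ex => x; rewrite addrAC.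
by apply: le_trans (ler_normD _ _); rewrite addrA subrK.
Qed.

(** [lindeberg] twice: for the second sample with the first sum as shift, then for the first sample
    with the normal variable just obtained as shift. *)
Lemma lindeberg2 d (U : measurableType d) (P Q : probability U R) f g v w c e n m :
  0 <= c -> 0 <= e -> centred P f v -> centred Q g w ->
  `|Ex (prodP (ptuple P n) (ptuple Q m)) (fun z =>
      h (c * \sum_(i < n) f (tnth z.1 i) + e * \sum_(i < m) g (tnth z.2 i))) -
    Ex gamma (fun z => h (Num.sqrt (c ^+ 2 * (n%:R * v) + e ^+ 2 * (m%:R * w)) * z))| <=
  n%:R * (K * c ^+ 3 * third_moments P f v) + m%:R * (K * e ^+ 3 * third_moments Q g w).
Proof.
move=> c0 e0 cf cg; have [mf _ _ _] := cf; have [mg _ _ _] := cg.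
have v0 : 0 <= v.
  by have [_ _ _ <-] := cf; apply: Ex_ge0 => x; exact: sqr_ge0.
have w0 : 0 <= w.
  by have [_ _ _ <-] := cg; apply: Ex_ge0 => x; exact: sqr_ge0.
have mS (f' : U -> R) k : measurable_fun setT f' ->
    measurable_fun setT (fun t : k.-tuple U => \sum_(i < k) f' (tnth t i)).
  by move=> mf'; apply: measurable_sum => i; exact: measurableT_comp mf' (measurable_tnth i).
have mSf := mS _ n mf; have mSg := mS _ m mg.
set Sf := fun t : n.-tuple U => \sum_(i < n) f (tnth t i) in mSf *.
set Sg := fun t : m.-tuple U => \sum_(i < m) g (tnth t i) in mSg *.
set tau := c * Num.sqrt (n%:R * v); set tau' := e * Num.sqrt (m%:R * w).
have m1 : measurable_fun setT (fun z : n.-tuple U * m.-tuple U => c * Sf z.1 + e * Sg z.2).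
  apply: measurable_funD; apply: measurable_funM => //.
    exact: measurableT_comp mSf measurable_fst.
  exact: measurableT_comp mSg measurable_snd.
have m2 : measurable_fun setT (fun z : n.-tuple U * mR => c * Sf z.1 + tau' * z.2).
  apply: measurable_funD; apply: measurable_funM => //.
  exact: measurableT_comp mSf measurable_fst.
have m3 : measurable_fun setT (fun z : mR * n.-tuple U => 0 + tau' * z.1 + c * Sf z.2).
  apply: measurable_funD.
    by apply: measurable_funD => //; apply: measurable_funM => //; exact: measurable_fst.
  apply: measurable_funM => //; exact: measurableT_comp mSf measurable_snd.
have m4 : measurable_fun setT (fun z : mR * mR => 0 + tau' * z.1 + tau * z.2).
  apply: measurable_funD.
    by apply: measurable_funD => //; apply: measurable_funM => //; exact: measurable_fst.
  by apply: measurable_funM => //; exact: measurable_snd.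
have i1 (t : n.-tuple U) : L1 (ptuple Q m) (fun u => h (c * Sf t + e * Sg u)).
  by apply: L1h; apply: measurable_funD => //; exact: measurable_funM.
have i2 (t : n.-tuple U) : L1 gamma (fun z => h (c * Sf t + tau' * z)).
  by apply: L1h; apply: measurable_funD => //; exact: measurable_funM.
have i2' (z : R) : L1 (ptuple P n) (fun t => h (c * Sf t + tau' * z)).
  by apply: L1h; apply: measurable_funD => //; exact: measurable_funM.
have i3 (z : R) : L1 (ptuple P n) (fun t => h (0 + tau' * z + c * Sf t)).
  by apply: L1h; apply: measurable_funD => //; exact: measurable_funM.
have i4 (z : R) : L1 gamma (fun y => h (0 + tau' * z + tau * y)).
  by apply: L1h; apply: measurable_funD => //; exact: measurable_funM.
have [E1 l1] := Ex_prod (L1h (prodP (ptuple P n) (ptuple Q m)) m1) i1.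
have [_ l2] := Ex_prod (L1h (prodP (ptuple P n) gamma) m2) i2.
have [_ l3] := Ex_prod (L1h (prodP gamma (ptuple P n)) m3) i3.
have [_ l4] := Ex_prod (L1h (prodP gamma gamma) m4) i4.
have swap := Ex_prod_swap (L1h (prodP (ptuple P n) gamma) m2) i2 i2'.
rewrite /= in E1 swap.
have step1 := Ex_dist l1 l2 (fun t => lindeberg (c * Sf t) m e0 cg).
have step2 := Ex_dist l3 l4 (fun z => lindeberg (0 + tau' * z) n c0 cf).
have tauE : Num.sqrt (tau' ^+ 2 + tau ^+ 2) =
    Num.sqrt (c ^+ 2 * (n%:R * v) + e ^+ 2 * (m%:R * w)).
  by rewrite /tau /tau' !exprMn !sqr_sqrtr ?mulr_ge0// addrC.
have gconv := @gaussian_convolution h B 0 tau' tau mh hB.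
rewrite tauE in gconv.
have -> : Ex gamma (fun z => h (Num.sqrt (c ^+ 2 * (n%:R * v) + e ^+ 2 * (m%:R * w)) * z)) =
    Ex gamma (fun z => Ex gamma (fun y => h (0 + tau' * z + tau * y))).
  by rewrite gconv; apply: eq_Ex => z; rewrite add0r.
rewrite [leRHS]addrC; apply: le_trans _ (lerD step1 step2).
rewrite E1 /= swap.
rewrite [X in _ <= `|_ - X| + _](_ : _ =
  Ex gamma (fun z => Ex (ptuple P n) (fun t => h (0 + tau' * z + c * Sf t)))); last first.
  by apply: eq_Ex => z; apply: eq_Ex => x; rewrite add0r addrC.
by apply: le_trans (ler_normD _ _); rewrite addrA subrK.
Qed.

End swap.

End lindeberg.

Section clt_lipschitz.
Context {R : realType}.
Local Notation mR := (measurableTypeR R).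
Local Notation gamma := (@normal_prob R 0 1 : probability mR R).

(** The width of the mollifier is fixed by eps before the sample sizes appear, so K does not depend
    on them nor on the weights c and e. *)
Lemma clt_lipschitz d (U : measurableType d) (P Q : probability U R)
    (f g : U -> R) (v w : R) (G : R -> R) (B L eps : R) :
  centred P f v -> centred Q g w -> (forall x, `|G x| <= B) -> 0 <= L ->
  lipschitz_cst L G -> 0 < eps ->
  exists2 K, 0 <= K & forall c e n m, 0 <= c -> 0 <= e ->
  `|Ex (prodP (ptuple P n) (ptuple Q m)) (fun z =>
      G (c * \sum_(i < n) f (tnth z.1 i) + e * \sum_(i < m) g (tnth z.2 i))) -
    Ex gamma (fun z => G (Num.sqrt (c ^+ 2 * (n%:R * v) + e ^+ 2 * (m%:R * w)) * z))|
  <= eps + K * (n%:R * c ^+ 3 + m%:R * e ^+ 3).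
Proof.
move=> cf cg GB L0 GL eps0; have [mf _ _ _] := cf; have [mg _ _ _] := cg.
pose kappa := Ex gamma (fun z => `|z|).
have kappa0 : 0 <= kappa by apply: Ex_ge0 => z; exact: normr_ge0.
have Lk0 : 0 <= L * kappa by rewrite mulr_ge0.
(* Mollifying costs L delta kappa for the sample and as much for the normal limit, together at most
   eps; adding 1 keeps the denominator positive. *)
pose delta := eps / (2 * L * kappa + 1).
have den0 : 0 < 2 * L * kappa + 1 by lra.
have delta0 : 0 < delta by rewrite divr_gt0.
have Ldk : 2 * (L * delta * kappa) <= eps.
  have -> : 2 * (L * delta * kappa) = eps * ((2 * L * kappa) / (2 * L * kappa + 1)).
    by rewrite /delta; ring.
  by rewrite (ler_piMr (ltW eps0))// ler_pdivrMr//; lra.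
have mG := lipschitz_measurable L0 GL.
have mh := lipschitz_measurable L0 (mollify_lipschitz delta GB L0 GL).
have hB := mollify_bounded delta GB L0 GL.
have hG := mollify_near GB L0 GL delta0.
have [K [a [b [K0 hK]]]] := mollify_taylor GB L0 GL delta0.
set h := mollify G delta in mh hB hG hK.
have Ex0 d' (T' : measurableType d') (P' : probability T' R) (f' : T' -> R) :
    0 <= Ex P' (fun x => `|f' x| ^+ 3).
  by apply: Ex_ge0 => x; rewrite exprn_ge0.
have r10 : 0 <= third_moments P f v by rewrite addr_ge0.
have r20 : 0 <= third_moments Q g w by rewrite addr_ge0.
exists (K * (third_moments P f v + third_moments Q g w)) => [|c e n m c0 e0].
  by rewrite mulr_ge0// addr_ge0.
have := lindeberg2 mh hB hK n m c0 e0 cf cg.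
pose S (z : n.-tuple U * m.-tuple U) :=
  c * \sum_(i < n) f (tnth z.1 i) + e * \sum_(i < m) g (tnth z.2 i).
set tau := Num.sqrt _.
have mS : measurable_fun setT S.
  apply: measurable_funD; apply: measurable_funM => //; apply: measurable_sum => i.
    apply: measurableT_comp mf _.
    exact: measurableT_comp (measurable_tnth i) measurable_fst.
  apply: measurableT_comp mg _.
  exact: measurableT_comp (measurable_tnth i) measurable_snd.
have mt : measurable_fun setT (fun z : mR => tau * z) by exact: measurable_funM.
have d1 : `|Ex (prodP (ptuple P n) (ptuple Q m)) (fun z => h (S z)) -
    Ex (prodP (ptuple P n) (ptuple Q m)) (fun z => G (S z))| <= L * delta * kappa.
  apply: Ex_dist => [||z]; last exact: hG.
    by apply: (L1_bounded _ (measurableT_comp mh mS) (k := B)) => z; exact: hB.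
  by apply: (L1_bounded _ (measurableT_comp mG mS) (k := B)) => z; exact: GB.
have d2 : `|Ex gamma (fun z => h (tau * z)) - Ex gamma (fun z => G (tau * z))| <= L * delta * kappa.
  apply: Ex_dist => [||z]; last exact: hG.
    by apply: (L1_bounded _ (measurableT_comp mh mt) (k := B)) => z; exact: hB.
  by apply: (L1_bounded _ (measurableT_comp mG mt) (k := B)) => z; exact: GB.
move: d1 d2; set Eh := Ex (prodP _ _) (fun z => h (S z)); set EG := Ex (prodP _ _) (fun z => G (S z)).
set gh := Ex gamma (fun z => h (tau * z)); set gG := Ex gamma (fun z => G (tau * z)).
move=> d1 d2; rewrite -/Eh -/EG => d3.
have c3 : 0 <= n%:R * c ^+ 3 by rewrite mulr_ge0// exprn_ge0.
have e3 : 0 <= m%:R * e ^+ 3 by rewrite mulr_ge0// exprn_ge0.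
move: r10 r20 d3; set r1 := third_moments _ _ _; set r2 := third_moments _ _ _.
move=> r10 r20 d3.
have p1 : 0 <= K * r1 * (m%:R * e ^+ 3) by apply: mulr_ge0 => //; exact: mulr_ge0.
have p2 : 0 <= K * r2 * (n%:R * c ^+ 3) by apply: mulr_ge0 => //; exact: mulr_ge0.
have d3' : `|Eh - gh| <= K * r1 * (n%:R * c ^+ 3) + K * r2 * (m%:R * e ^+ 3).
  by apply: le_trans d3 _; rewrite le_eqVlt; apply/orP; left; apply/eqP; ring.
move: d1 d2 d3' p1 p2.
rewrite !ler_norml => /andP[a1 a2] /andP[b1 b2] /andP[c1 c2] p1 p2.
apply/andP; split; lra.
Qed.

End clt_lipschitz.

Section deviation_moment.
Context {R : realType} {d : nat}.
Variables (mu : 'cV[R]_d) (Sigma : 'M[R]_d).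
Hypothesis pS : psdmx Sigma.
Let P := gauss mu Sigma.

Lemma gauss_centred_coord k : exists v,
  centred P (fun x => (x - mu) k 0) v.
Proof.
have T0 : (0 : 'M[R]_d)^T = 0 by rewrite trmx0.
have := gauss_centred mu (delta_mx k 0) pS T0.
move=> H; eexists; apply: centred_eq H => x.
by rewrite dot_delta !mul0mx dot0r linear0 subr0 addr0.
Qed.

Lemma gauss_centred_product k l : exists v,
  centred P (fun x => (x - mu) k 0 * (x - mu) l 0 - Sigma k l) v.
Proof.
(* Polarisation: against symmetric matrices, the trace with A reads off the entry (k, l), so
   [gauss_centred] covers products of two coordinates. *)
pose A : 'M[R]_d := 2^-1 *: (delta_mx k l + delta_mx l k).
have AT : A^T = A by rewrite /A linearZ linearD/= !trmx_delta addrC.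
have E (M : 'M[R]_d) : M^T = M -> \tr (A *m M) = M k l.
  move=> MT; have tE i j : \tr (delta_mx i j *m M) = M j i.
    rewrite /mxtrace (bigD1 i)//= big1 ?addr0 => [|s si].
      rewrite mxE (bigD1 j)//= big1 ?addr0 => [|s sj].
        by rewrite mxE !eqxx mul1r.
      by rewrite mxE (negbTE sj) andbF mul0r.
    by rewrite mxE big1// => t _; rewrite mxE (negbTE si) mul0r.
  rewrite /A -scalemxAl mxtraceZ mulmxDl mxtraceD !tE.
  have -> : M l k = M k l by rewrite -{1}MT mxE.
  by field.
have := gauss_centred mu 0 pS AT.
move=> H; eexists; apply: centred_eq H => x.
rewrite dot0l add0r (E _ pS.1); congr (_ - _).
have outer : ((x - mu) *m (x - mu)^T)^T = (x - mu) *m (x - mu)^T by rewrite trmx_mul trmxK.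
by rewrite dotC dot_tr -mulmxA (E _ outer) mxE big_ord1 [_^T _ _]mxE.
Qed.

(** Each entry of the moment errors is an average of n independent centred variables, so its square
    has expectation v/n. Summing gives an exact multiple of 1/n; the 1 in D is the last term of
    [deviation]. *)
Lemma Ex_deviation : exists2 D, 0 <= D & forall n, (0 < n)%N ->
  L1 (ptuple P n) (fun t => deviation mu Sigma (tnth t)) /\
  Ex (ptuple P n) (fun t => deviation mu Sigma (tnth t)) = D / n%:R.
Proof.
pose u k (x : 'cV[R]_d) := (x - mu) k 0.
pose psi k l x := u k x * u l x - Sigma k l.
pose vc k := Ex P (fun x => u k x ^+ 2).
pose vp k l := Ex P (fun x => psi k l x ^+ 2).
have cc k : centred P (u k) (vc k).
  by have [v c] := gauss_centred_coord k; have [_ _ _ E] := c; rewrite /vc E.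
have cp k l : centred P (psi k l) (vp k l).
  by have [v c] := gauss_centred_product k l; have [_ _ _ E] := c; rewrite /vp E.
have v0 f v : centred P f v -> 0 <= v.
  by move=> [_ _ _ <-]; apply: Ex_ge0 => x; exact: sqr_ge0.
exists (\sum_k \sum_l vp k l + \sum_k vc k + 1) => [|n n0].
  rewrite !addr_ge0 ?sumr_ge0// => k _; last exact: v0 (cc k).
  by apply: sumr_ge0 => l _; exact: v0 (cp k l).
have nn0 : n%:R != 0 :> R by rewrite pnatr_eq0 -lt0n.
have sq f v : centred P f v ->
    L1 (ptuple P n) (fun t => (n%:R^-1 * \sum_(i < n) f (tnth t i)) ^+ 2) /\
    Ex (ptuple P n) (fun t => (n%:R^-1 * \sum_(i < n) f (tnth t i)) ^+ 2) = v / n%:R.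
  move=> cf; have c := centredZ n%:R^-1 (centred_ptuple n cf); split.
    exact: (centred_L2 c).
  have [_ _ _ ->] := c; field; exact: nn0.
have devE t : deviation mu Sigma (tnth t) =
    \sum_k \sum_l (n%:R^-1 * \sum_(i < n) psi k l (tnth t i)) ^+ 2 +
    \sum_k (n%:R^-1 * \sum_(i < n) u k (tnth t i)) ^+ 2 + n%:R^-1.
  rewrite /deviation frob_sum; congr (_ + _ + _).
    apply: eq_bigr => k _; apply: eq_bigr => l _; congr (_ ^+ 2).
    rewrite mxE [(- Sigma) k l]mxE /smom mxE summxE /psi sumrB sumr_const card_ord.
    rewrite -(mulr_natl (Sigma k l)) mulrBr mulKf//.
    by congr (_ * _ - _); apply: eq_bigr => i _; rewrite mxE big_ord1 [_^T _ _]mxE.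
  rewrite dotE; apply: eq_bigr => k _; rewrite -expr2; congr (_ ^+ 2).
  have -> : smean (tnth t) - mu = n%:R^-1 *: \sum_i (tnth t i - mu).
    rewrite /smean sumrB sumr_const card_ord scalerBr -[mu *+ n]scaler_nat scalerA.
    by rewrite mulVf// scale1r.
  by rewrite mxE summxE.
have L1p : L1 (ptuple P n) (fun t =>
    \sum_k \sum_l (n%:R^-1 * \sum_(i < n) psi k l (tnth t i)) ^+ 2).
  by apply: L1_sum => k; apply: L1_sum => l; exact: (sq _ _ (cp k l)).1.
have L1c : L1 (ptuple P n) (fun t =>
    \sum_k (n%:R^-1 * \sum_(i < n) u k (tnth t i)) ^+ 2).
  by apply: L1_sum => k; exact: (sq _ _ (cc k)).1.
split.
  under eq_fun do rewrite devE.
  by apply: L1D; [exact: L1D|exact: L1_cst].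
under eq_Ex do rewrite devE.
rewrite ExD; [|exact: L1D|exact: L1_cst].
rewrite ExD// Ex_cst Ex_sum; last first.
  by move=> k; apply: L1_sum => l; exact: (sq _ _ (cp k l)).1.
rewrite Ex_sum; last by move=> k; exact: (sq _ _ (cc k)).1.
rewrite !mulrDl mul1r !mulr_suml; congr (_ + _ + _).
  apply: eq_bigr => k _; rewrite Ex_sum; last by move=> l; exact: (sq _ _ (cp k l)).1.
  by rewrite mulr_suml; apply: eq_bigr => l _; exact: (sq _ _ (cp k l)).2.
by apply: eq_bigr => k _; exact: (sq _ _ (cc k)).2.
Qed.

End deviation_moment.

(** * The limit law *)

Section gelbrich_clt.
Context {R : realType} {d : nat}.
Local Notation mR := (measurableTypeR R).
Local Notation gamma := (@normal_prob R 0 1 : probability mR R).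
Local Notation V := 'cV[R]_d.
Variables (mu nu : 'cV[R]_d) (Sigma Xi : 'M[R]_d).
Hypotheses (pS : psdmx Sigma) (pX : psdmx Xi)
  (uS : Sigma \in unitmx) (uX : Xi \in unitmx).

Definition gstat n m (z : n.-tuple V * m.-tuple V) : R :=
  gelbrich (smean (tnth z.1)) (smean (tnth z.2)) (scov (tnth z.1)) (scov (tnth z.2)).

Lemma measurable_gstat n m : measurable_fun setT (@gstat n m).
Proof.
have m1 (i : 'I_n) : measurable_fun setT (fun z : n.-tuple V * m.-tuple V => tnth z.1 i).
  exact: measurableT_comp (measurable_tnth i) measurable_fst.
have m2 (i : 'I_m) : measurable_fun setT (fun z : n.-tuple V * m.-tuple V => tnth z.2 i).
  exact: measurableT_comp (measurable_tnth i) measurable_snd.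
apply: measurable_gelbrich.
- exact: (measurable_smean m1).
- exact: (measurable_smean m2).
- by move=> z; exact: psdmx_scov.
- by move=> z; exact: psdmx_scov.
- exact: (measurable_scov m1).
- exact: (measurable_scov m2).
Qed.

Definition influence_var (mu nu : V) (Sigma T : 'M[R]_d) : R :=
  dot (2 *: (mu - nu)) (Sigma *m (2 *: (mu - nu))) +
  2 * \tr ((1%:M - T) *m Sigma *m ((1%:M - T) *m Sigma)).

Lemma influence_centred (a b : V) (S T : 'M[R]_d) : psdmx S -> psdmx T ->
  centred (gauss a S) (influence a b S T) (influence_var a b S T).
Proof.
move=> pS' pT; apply: gauss_centred => //.
by rewrite linearB/= trmx1 pT.1.
Qed.

Let T := otmap Sigma Xi.

(** The statistic is replaced by its linearisation. The remainder is s times a deviation of mean of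
    order s^-2, hence of order 1/s, and [clt_lipschitz] treats the linear part. *)
Lemma gelbrich_clt_lipschitz (G : R -> R) (B L eps : R) :
  (forall x, `|G x| <= B) -> 0 <= L -> lipschitz_cst L G -> 0 < eps ->
  exists2 K, 0 <= K & forall (s : R) n m, (2 <= n)%N -> (2 <= m)%N -> 1 <= s ->
  s ^+ 2 = n%:R * m%:R / (n%:R + m%:R) ->
  `|Ex (prodP (ptuple (gauss mu Sigma) n) (ptuple (gauss nu Xi) m))
      (fun z => G (s * (gstat z - gelbrich mu nu Sigma Xi))) -
    Ex gamma (fun z => G (Num.sqrt (s ^+ 2 / n%:R * influence_var mu nu Sigma T +
      s ^+ 2 / m%:R * influence_var nu mu Xi (invmx T)) * z))|
  <= eps + K / s.
Proof.
move=> GB L0 GL eps0.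
have pT : psdmx T by exact: otmap_psd.
have cf := influence_centred mu nu pS pT.
have cg := influence_centred nu mu pX (psdmx_invmx pT).
have [mf _ _ _] := cf; have [mg _ _ _] := cg.
have mG := lipschitz_measurable L0 GL.
have B0 : 0 <= B by apply: le_trans (GB 0).
have [C [eta [eta0 C0 hC]]] := gelbrich_expansion mu nu pS pX uS uX.
have [D D0 hD] := Ex_deviation mu pS; have [D' D'0 hD'] := Ex_deviation nu pX.
have eps2 : 0 < eps / 2 by rewrite divr_gt0.
have [K1 K10 hK1] := clt_lipschitz cf cg GB L0 GL eps2.
pose r := eps / (2 * (L + 1)).
have r0 : 0 < r by rewrite divr_gt0// mulr_gt0//; lra.
have Lr : L * r <= eps / 2.
  by rewrite /r mulrCA ler_wpM2l ?(ltW eps0)// ler_pdivrMr; lra.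
(* The constant in front of the deviations will be [W], which grows like s; since s >= 1 it is at
   most [W0] s. *)
pose W0 := 2 * B * (eta^-1 + C / r).
have W00 : 0 <= W0.
  by rewrite /W0 !mulr_ge0// addr_ge0 ?invr_ge0 ?(ltW eta0)// divr_ge0// ltW.
exists (2 * K1 + W0 * (D + D')) => [|s n m n2 m2 s1 s2].
  apply: addr_ge0; first exact: mulr_ge0.
  by apply: mulr_ge0 => //; exact: addr_ge0.
have n0 : 0 < n%:R :> R by rewrite ltr0n ltnW.
have m0 : 0 < m%:R :> R by rewrite ltr0n ltnW.
have nm0 : 0 < n%:R + m%:R :> R by rewrite addr_gt0.
have s0 : 0 < s by apply: lt_le_trans s1.
have sn : s ^+ 2 <= n%:R.
  by rewrite s2 ler_pdivrMr// ler_pM2l// lerDr ltW.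
have sm : s ^+ 2 <= m%:R.
  by rewrite s2 ler_pdivrMr// mulrC ler_pM2l// lerDl ltW.
have s20 : 0 < s ^+ 2 by rewrite exprn_gt0.
(* The Lyapunov ratio of each sample: k summands with weight s/k, and s^2 is at most either sample
   size. *)
have cube (k : R) : 0 < k -> s ^+ 2 <= k -> k * (s / k) ^+ 3 <= s^-1.
  move=> k0 sk; have -> : k * (s / k) ^+ 3 = (s ^+ 2 / k) ^+ 2 * s^-1.
    by field; rewrite !gt_eqF.
  rewrite ler_piMl ?invr_ge0 ?(ltW s0)// exprn_ile1 ?divr_ge0 ?(ltW s20) ?(ltW k0)//.
  by rewrite ler_pdivrMr// mul1r.
set PP := prodP _ _.
pose Lin (z : n.-tuple V * m.-tuple V) :=
  s / n%:R * \sum_(i < n) influence mu nu Sigma T (tnth z.1 i) +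
  s / m%:R * \sum_(i < m) influence nu mu Xi (invmx T) (tnth z.2 i).
pose Z (z : n.-tuple V * m.-tuple V) := s * (gstat z - gelbrich mu nu Sigma Xi).
pose dX (t : n.-tuple V) := deviation mu Sigma (tnth t).
pose dY (t : m.-tuple V) := deviation nu Xi (tnth t).
have [lX EX] := hD n (ltnW n2); have [lY EY] := hD' m (ltnW m2).
have dX0 t : 0 <= dX t by rewrite /dX /deviation !addr_ge0 ?frob_ge0 ?dot_ge0.
have dY0 t : 0 <= dY t by rewrite /dY /deviation !addr_ge0 ?frob_ge0 ?dot_ge0.
pose W := 2 * B * (eta^-1 + C * s / r).
(* Markov's inequality in pointwise form. Where the expansion is valid with error at most r, the
   Lipschitz bound applies; elsewhere the difference is at most 2 B, paid by a ratio that exceeds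
   1. *)
have ptw z : `|G (Z z) - G (Lin z)| <= L * r + W * (dX z.1 + dY z.2).
  have G2 : `|G (Z z) - G (Lin z)| <= 2 * B.
    by apply: le_trans (ler_normB _ _) _; have := GB (Z z); have := GB (Lin z); lra.
  have Lr0 : 0 <= L * r by rewrite mulr_ge0// ltW.
  have WE : W * (dX z.1 + dY z.2) = 2 * B * ((dX z.1 + dY z.2) / eta) +
      2 * B * (C * s * (dX z.1 + dY z.2) / r) by rewrite /W; ring.
  have dXY0 : 0 <= dX z.1 + dY z.2 by apply: addr_ge0.
  have h1 : 0 <= (dX z.1 + dY z.2) / eta by apply: divr_ge0 => //; exact: ltW.
  have h2 : 0 <= C * s * (dX z.1 + dY z.2) / r.
    apply: divr_ge0; last exact: ltW.
    by apply: mulr_ge0 => //; apply: mulr_ge0 => //; exact: ltW.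
  have B2 : 0 <= 2 * B by rewrite mulr_ge0.
  have big : 1 <= (dX z.1 + dY z.2) / eta + C * s * (dX z.1 + dY z.2) / r ->
      `|G (Z z) - G (Lin z)| <= L * r + W * (dX z.1 + dY z.2).
    move=> h; rewrite WE -mulrDr; apply: le_trans G2 _.
    apply: (@le_trans _ _ (2 * B * ((dX z.1 + dY z.2) / eta + C * s * (dX z.1 + dY z.2) / r))).
      by rewrite ler_peMr.
    by rewrite lerDr.
  have [dXe|dXe] := leP (dX z.1) eta; last first.
    apply: big; apply: (@le_trans _ _ ((dX z.1 + dY z.2) / eta)); last by rewrite lerDl.
    by rewrite ler_pdivlMr// mul1r (le_trans (ltW dXe))// lerDl.
  have [dYe|dYe] := leP (dY z.2) eta; last first.
    apply: big; apply: (@le_trans _ _ ((dX z.1 + dY z.2) / eta)); last by rewrite lerDl.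
    by rewrite ler_pdivlMr// mul1r (le_trans (ltW dYe))// lerDr.
  have [qr|qr] := leP (C * s * (dX z.1 + dY z.2)) r; last first.
    apply: big; apply: (@le_trans _ _ (C * s * (dX z.1 + dY z.2) / r)); last by rewrite lerDr.
    by rewrite ler_pdivlMr// mul1r ltW.
  apply: (@le_trans _ _ (L * r)); last first.
    by rewrite lerDl WE; apply: addr_ge0; exact: mulr_ge0.
  apply: le_trans (GL _ _) _; rewrite ler_wpM2l//; apply: le_trans qr.
  have := hC n m (tnth z.1) (tnth z.2) n2 m2 dXe dYe.
  have -> : Z z - Lin z = s * (gstat z - gelbrich mu nu Sigma Xi -
     n%:R^-1 * \sum_(i < n) influence mu nu Sigma T (tnth z.1 i) -
     m%:R^-1 * \sum_(i < m) influence nu mu Xi (invmx T) (tnth z.2 i)).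
    by rewrite /Z /Lin; ring.
  rewrite normrM (gtr0_norm s0) => h.
  by rewrite [C * s]mulrC -mulrA ler_pM2l.
have mZ : measurable_fun setT Z.
  by apply: measurable_funM => //; apply: measurable_funB => //; exact: measurable_gstat.
have mLin : measurable_fun setT Lin.
  apply: measurable_funD; apply: measurable_funM => //; apply: measurable_sum => i.
    apply: measurableT_comp mf _.
    exact: measurableT_comp (measurable_tnth i) measurable_fst.
  apply: measurableT_comp mg _.
  exact: measurableT_comp (measurable_tnth i) measurable_snd.
have lGZ : L1 PP (fun z => G (Z z)).
  by apply: (L1_bounded _ (measurableT_comp mG mZ) (k := B)) => z; exact: GB.
have lGL : L1 PP (fun z => G (Lin z)).
  by apply: (L1_bounded _ (measurableT_comp mG mLin) (k := B)) => z; exact: GB.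
have lXY : L1 PP (fun z => dX z.1 + dY z.2).
  by apply: L1D; [exact: (L1_fst _ lX)|exact: (L1_snd _ lY)].
have EXY : Ex PP (fun z => dX z.1 + dY z.2) = D / n%:R + D' / m%:R.
  rewrite ExD; [|exact: (L1_fst _ lX)|exact: (L1_snd _ lY)].
  by rewrite (Ex_fst _ lX) (Ex_snd _ lY) EX EY.
have rem : `|Ex PP (fun z => G (Z z)) - Ex PP (fun z => G (Lin z))| <=
    L * r + W * (D / n%:R + D' / m%:R).
  rewrite -ExB//; apply: le_trans (Ex_norm (L1B lGZ lGL)) _.
  rewrite -EXY -ExZ// -[L * r](Ex_cst PP) -ExD; [|exact: L1_cst|exact: L1Z].
  apply: Ex_le; [exact/L1_norm/L1B|by apply: L1D; [exact: L1_cst|exact: L1Z]|].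
  exact: ptw.
(* [W] is of order s and the mean deviations of order s^-2, since n and m are at least s^2. *)
have Wle : W * (D / n%:R + D' / m%:R) <= W0 * (D + D') / s.
  have W_0 : 0 <= W.
    apply: mulr_ge0; first exact: mulr_ge0.
    apply: addr_ge0; first by rewrite invr_ge0 ltW.
    by apply: divr_ge0; [apply: mulr_ge0 => //; exact: ltW|exact: ltW].
  apply: (@le_trans _ _ (W * ((D + D') / s ^+ 2))).
    rewrite ler_wpM2l// mulrDl lerD// ler_wpM2l// lef_pV2 ?posrE//.
  have -> : W0 * (D + D') / s = (W0 * s) * ((D + D') / s ^+ 2).
    by field; rewrite gt_eqF.
  rewrite ler_wpM2r//; first by apply: divr_ge0; [exact: addr_ge0|exact: ltW].
  have -> : W0 * s = 2 * B * (eta^-1 * s + C * s / r) by rewrite /W0; ring.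
  apply: ler_wpM2l; first exact: mulr_ge0.
  by rewrite lerD2r ler_peMr// invr_ge0 ltW.
have := hK1 (s / n%:R) (s / m%:R) n m.
rewrite !divr_ge0 ?(ltW s0) ?(ltW n0) ?(ltW m0)//.
move=> /(_ isT isT).
have -> : (s / n%:R) ^+ 2 * (n%:R * influence_var mu nu Sigma T) =
    s ^+ 2 / n%:R * influence_var mu nu Sigma T by field; rewrite gt_eqF.
have -> : (s / m%:R) ^+ 2 * (m%:R * influence_var nu mu Xi (invmx T)) =
    s ^+ 2 / m%:R * influence_var nu mu Xi (invmx T) by field; rewrite gt_eqF.
have k1 : K1 * (n%:R * (s / n%:R) ^+ 3 + m%:R * (s / m%:R) ^+ 3) <= 2 * K1 / s.
  have := lerD (cube _ n0 sn) (cube _ m0 sm); move=> /(ler_wpM2l K10)/le_trans; apply.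
  by rewrite le_eqVlt; apply/orP; left; apply/eqP; ring.
move: rem; rewrite -/PP -/(Z _).
set E1 := Ex PP (fun z => G (Z z)); set E2 := Ex PP (fun z => G (Lin z)).
set E3 := Ex gamma _.
rewrite !ler_norml => /andP[a1 a2] /andP[b1 b2].
have -> : (2 * K1 + W0 * (D + D')) / s = 2 * K1 / s + W0 * (D + D') / s by rewrite mulrDl.
apply/andP; split; lra.
Qed.

End gelbrich_clt.

(** * From Lipschitz to continuous test functions *)

Section inf_convolution.
Context {R : realType}.
Local Notation mR := (measurableTypeR R).
Variables (f : R -> R) (B : R).
Hypotheses (cf : continuous f) (fB : forall x, `|f x| <= B).

(** The Pasch-Hausdorff envelope, the largest k-Lipschitz minorant of f. *)
Definition inf_conv (k : nat) (x : R) : R := inf (range (fun y => f y + k%:R * `|x - y|)).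

Let lb k x : lbound (range (fun y => f y + k%:R * `|x - y|)) (- B).
Proof.
move=> _ [y _ <-]; have := fB y; rewrite ler_norml => /andP[h _].
by rewrite (le_trans h)// lerDl mulr_ge0.
Qed.

Let has_lb k x : has_lbound (range (fun y => f y + k%:R * `|x - y|)).
Proof. by exists (- B); exact: lb. Qed.

Let ne k x : range (fun y => f y + k%:R * `|x - y|) !=set0.
Proof. by eexists; exists 0. Qed.

Lemma inf_conv_le k x : inf_conv k x <= f x.
Proof. by apply: ge_inf => //; exists x => //; rewrite subrr normr0 mulr0 addr0. Qed.

Lemma inf_conv_bounded k x : `|inf_conv k x| <= B.
Proof.
rewrite ler_norml; apply/andP; split; first exact: lb_le_inf.
by apply: le_trans (inf_conv_le k x) (le_trans (ler_norm _) _).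
Qed.

Lemma inf_conv_lipschitz k : lipschitz_cst k%:R (inf_conv k).
Proof.
have half x y : inf_conv k x - k%:R * `|x - y| <= inf_conv k y.
  apply: lb_le_inf => // _ [z _ <-]; rewrite lerBlDr.
  apply: (@le_trans _ _ (f z + k%:R * `|x - z|)); first by apply: ge_inf => //; exists z.
  by rewrite -addrA lerD2l -mulrDr ler_wpM2l// [_ + `|x - y|]addrC ler_distD.
move=> x y; have := half x y; have := half y x.
by rewrite (distrC y x) ler_norml => h1 h2; apply/andP; split; lra.
Qed.

Lemma cvg_inf_conv x : inf_conv k x @[k --> \oo] --> f x.
Proof.
apply/cvgrPdist_le => e e0.
have /cvgrPdist_le/(_ _ e0) : f y @[y --> x] --> f x by exact: cf.
move=> /nbhs_ballP[eta /= eta0 h].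
have B0 : 0 <= B by apply: le_trans (fB 0).
near=> k; rewrite ger0_norm ?subr_ge0 ?inf_conv_le// lerBlDr -lerBlDl.
apply: lb_le_inf => // _ [y _ <-].
have [xy|xy] := ltP `|x - y| eta.
  have := h y xy; rewrite ler_norml => /andP[_ h1].
  have : 0 <= k%:R * `|x - y| by rewrite mulr_ge0.
  lra.
have := fB x; have := fB y; rewrite !ler_norml => /andP[h1 _] /andP[_ h2].
(* For y at distance at least eta the penalty then exceeds the oscillation 2 B of f; nearer points
   are handled by continuity at x. *)
have h3 : 2 * B <= k%:R * eta.
  by rewrite -ler_pdivrMr//; near: k; exact: nbhs_infty_ger.
have : k%:R * eta <= k%:R * `|x - y| by rewrite ler_wpM2l.
lra.
Unshelve. all: by end_near. Qed.

End inf_convolution.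

Section portmanteau.
Context {R : realType}.
Local Notation mR := (measurableTypeR R).
Context (dT : nat -> measure_display) (T : forall n, measurableType (dT n))
  (Pr : forall n, probability (T n) R) (Z : forall n, T n -> R)
  (dW : measure_display) (W : measurableType dW) (Q : probability W R) (Y : W -> R).
Arguments Pr : clear implicits.
Arguments Z : clear implicits.
Hypotheses (mZ : forall n, measurable_fun setT (Z n)) (mY : measurable_fun setT Y).
Hypothesis lip : forall (G : R -> R) (B L : R), (forall x, `|G x| <= B) -> 0 <= L ->
  lipschitz_cst L G -> Ex (Pr n) (fun w => G (Z n w)) @[n --> \oo] --> Ex Q (fun w => G (Y w)).

(** Minorants only give a lower bound on the expectations along the sequence; applying it to f and
    to - f yields the limit in [portmanteau]. The index k is chosen under the limit law by dominated
    convergence, before n. *)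
Let half (f : R -> R) B e : continuous f -> (forall x, `|f x| <= B) -> 0 < e ->
  \forall n \near \oo, Ex Q (fun w => f (Y w)) - e <= Ex (Pr n) (fun w => f (Z n w)).
Proof.
move=> cf fB e0.
have mf : measurable_fun setT (f : mR -> R) by exact: continuous_measurable_fun.
have ficB k x : `|inf_conv f k x| <= B by exact: inf_conv_bounded.
have mic k : measurable_fun setT (inf_conv f k : mR -> R).
  exact: lipschitz_measurable (ler0n R k) (inf_conv_lipschitz fB k).
have L1c d' (T' : measurableType d') (P' : probability T' R) (Z' : T' -> R) (g : R -> R) :
    measurable_fun setT Z' -> measurable_fun setT (g : mR -> R) -> (forall x, `|g x| <= B) ->
    L1 P' (fun w => g (Z' w)).
  move=> mZ' mg gB.
  by apply: (L1_bounded _ (measurableT_comp mg mZ') (k := B)) => w; exact: gB.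
have cic : Ex Q (fun w => inf_conv f k (Y w)) @[k --> \oo] --> Ex Q (fun w => f (Y w)).
  suff H : (\int[Q]_w (inf_conv f k (Y w))%:E)%E @[k --> \oo] -->
      (Ex Q (fun w => f (Y w)))%:E by exact: fine_cvg H.
  rewrite -L1_fin; last exact: L1c.
  apply: (@dominated_cvg _ _ _ Q setT measurableT
    (fun k w => (inf_conv f k (Y w))%:E) (fun w => (f (Y w))%:E) (fun=> B%:E)) => //.
  - by move=> k; apply/measurable_EFinP; exact: measurableT_comp (mic k) mY.
  - by move=> w _; apply: cvg_EFin; [exact: nearW|exact: (cvg_inf_conv cf fB)].
  - exact: (L1_cst Q B).
  - by move=> k w _ /=; rewrite lee_fin.
have e2 : 0 < e / 2 by rewrite divr_gt0.
have /cvgrPdist_le/(_ _ e2)[k _ /(_ k (leqnn k))/=] := cic.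
rewrite ler_norml => /andP[_ hk].
have := lip (ficB k) (ler0n _ k) (inf_conv_lipschitz fB k).
move=> /cvgrPdist_le/(_ _ e2); apply: filterS => n.
rewrite ler_norml => /andP[_ hn].
have : Ex (Pr n) (fun w => inf_conv f k (Z n w)) <= Ex (Pr n) (fun w => f (Z n w)).
  apply: Ex_le; [exact: L1c|exact: L1c|].
  by move=> w; exact: inf_conv_le fB _ _.
lra.
Qed.

Lemma portmanteau (f : R -> R) B : continuous f -> (forall x, `|f x| <= B) ->
  Ex (Pr n) (fun w => f (Z n w)) @[n --> \oo] --> Ex Q (fun w => f (Y w)).
Proof.
move=> cf fB; apply/cvgrPdist_le => e e0.
have mf : measurable_fun setT (f : mR -> R) by exact: continuous_measurable_fun.
have cN : continuous (fun x => - f x) by move=> x; apply: cvgN; exact: cf.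
have NB x : `|- f x| <= B by rewrite normrN.
have L1c d' (T' : measurableType d') (P' : probability T' R) (Z' : T' -> R) :
    measurable_fun setT Z' -> L1 P' (fun w => f (Z' w)).
  move=> mZ'.
  by apply: (L1_bounded _ (measurableT_comp mf mZ') (k := B)) => w; exact: fB.
have h1 := half cf fB e0; have h2 := half cN NB e0.
near=> n.
have k1 : Ex Q (fun w => f (Y w)) - e <= Ex (Pr n) (fun w => f (Z n w)) by near: n.
have k2 : Ex Q (fun w => - f (Y w)) - e <= Ex (Pr n) (fun w => - f (Z n w)) by near: n.
rewrite !ExN in k2; [|exact: L1c|exact: L1c].
by rewrite ler_norml; apply/andP; split; lra.
Unshelve. all: by end_near. Qed.

End portmanteau.

Section normal_scale.
Context {R : realType}.
Local Notation mR := (measurableTypeR R).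
Local Notation lambda := (@lebesgue_measure R).
Local Notation gamma := (@normal_prob R 0 1 : probability mR R).
Variables (s : R) (s0 : 0 < s).

Let ms : measurable_fun setT (fun x : mR => s * x : mR).
Proof. exact: measurable_funM. Qed.

Lemma normal_pdf_scale (x : R) : s * normal_pdf 0 s (s * x) = normal_pdf 0 1 x.
Proof.
have sn0 : s != 0 by rewrite gt_eqF.
rewrite !normal_pdfE ?oner_eq0// /normal_fun !subr0 mulrA.
have -> : s * normal_peak s = normal_peak 1.
  rewrite /normal_peak expr1n mul1r -[in LHS]mulrnAr sqrtrM ?sqr_ge0// sqrtr_sqr.
  by rewrite gtr0_norm// invfM mulrA mulfV// mul1r.
have -> : - (s * x) ^+ 2 / (s ^+ 2 *+ 2) = - x ^+ 2 / (1 ^+ 2 *+ 2) :> R; last by [].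
have -> : - (s * x) ^+ 2 = s ^+ 2 * - x ^+ 2 by rewrite exprMn mulrN.
have -> : s ^+ 2 *+ 2 = s ^+ 2 * (1 ^+ 2 *+ 2) by rewrite expr1n mulr_natr.
by rewrite -mulf_div divff ?mul1r// expf_neq0.
Qed.

Lemma lebesgue_measure_scale (A : set mR) : measurable A ->
  (lambda A = s%:E * lambda ((fun x => s * x)%R @^-1` A))%E.
Proof.
move=> mA; have ms' := ms.
rewrite -[RHS]/(pushforward (mscale (NngNum (ltW s0)) lambda) (fun x : mR => s * x : mR) A).
apply: lebesgue_measure_unique => // _ [[a b]] _ <- /=.
rewrite /pushforward /mscale/= (_ : _ @^-1` _ = `]a / s, b / s]%classic); last first.
  by apply/seteqP; split => x /=; rewrite !in_itv/= ltr_pdivrMr// ler_pdivlMr// mulrC.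
rewrite !lebesgue_measure_itv/= !lte_fin ltr_pM2r ?invr_gt0//.
case: ifP => // _; last by rewrite mule0.
by rewrite -!EFinB -EFinM -mulrBl mulrCA divff ?mulr1// gt_eqF.
Qed.

Lemma ge0_integral_scale (f : mR -> R) : measurable_fun setT f -> (forall x, 0 <= f x) ->
  (\int[lambda]_x (f x)%:E = s%:E * \int[lambda]_x (f (s * x))%:E)%E.
Proof.
move=> mf f0.
have mf' : measurable_fun setT (EFin \o f) by exact/measurable_EFinP.
have ms' := ms.
rewrite (eq_measure_integral
  (pushforward (mscale (NngNum (ltW s0)) lambda) (fun x : mR => s * x : mR))); last first.
  by move=> A mA _; exact: lebesgue_measure_scale.
have mfs : measurable_fun setT (fun x : mR => (f (s * x))%:E).
  by apply/measurable_EFinP; exact: measurableT_comp mf ms.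
rewrite ge0_integral_pushforward//; last by move=> x _; rewrite lee_fin.
by rewrite preimage_setT ge0_integral_mscale// => x _; rewrite lee_fin.
Qed.

Lemma ge0_integral_normal_scale (g : mR -> R) : measurable_fun setT g ->
  (forall x, 0 <= g x) ->
  (\int[normal_prob 0 s]_x (g x)%:E = \int[gamma]_x (g (s * x))%:E)%E.
Proof.
move=> mg g0.
have mp : measurable_fun setT (normal_pdf 0 s : mR -> R) by exact: measurable_normal_pdf.
have mgs : measurable_fun setT (fun z : mR => g (s * z)) by exact: measurableT_comp mg ms.
transitivity (\int[lambda]_x ((g x)%:E * (normal_pdf 0 s x)%:E))%E.
  apply: ge0_integral_density => //; first exact: normal_pdf_ge0.
  exact/measurable_EFinP.
rewrite ge0_integral_normal; last 2 first.
- exact/measurable_EFinP.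
- by move=> x; rewrite lee_fin.
transitivity (\int[lambda]_x (g x * normal_pdf 0 s x)%:E)%E; first by [].
rewrite ge0_integral_scale; last 2 first.
- exact: measurable_funM mg mp.
- by move=> x; rewrite mulr_ge0// normal_pdf_ge0.
rewrite -ge0_integralZl//; last 3 first.
- apply/measurable_EFinP; apply: (measurable_funM mgs).
  exact: measurableT_comp mp ms.
- by move=> x _; rewrite lee_fin mulr_ge0// normal_pdf_ge0.
- by rewrite lee_fin ltW.
by apply: eq_integral => x _; rewrite -!EFinM mulrCA normal_pdf_scale.
Qed.

Lemma Ex_normal_scale (f : mR -> R) B : measurable_fun setT f -> (forall x, `|f x| <= B) ->
  Ex (normal_prob 0 s : probability mR R) f = Ex gamma (fun z => f (s * z)).
Proof.
move=> mf fB; have B0 : 0 <= B by apply: le_trans (fB 0).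
have mfs : measurable_fun setT (fun z : mR => f (s * z)) by exact: measurableT_comp mf ms.
have mfB : measurable_fun setT (fun z : mR => f z + B) by exact: measurable_funD.
have fB0 (z : mR) : 0 <= f z + B by have := fB z; rewrite ler_norml => /andP[]; lra.
have h : Ex (normal_prob 0 s : probability mR R) (fun x => f x + B) =
    Ex gamma (fun z => f (s * z) + B).
  by rewrite /Ex (ge0_integral_normal_scale mfB fB0).
have l1 : L1 gamma (fun z => f (s * z)).
  by apply: (L1_bounded _ mfs (k := B)) => z; exact: fB.
have l2 : L1 (normal_prob 0 s : probability mR R) f.
  by apply: (L1_bounded _ mf (k := B)).
move: h; rewrite (ExD l2 (L1_cst _ B)) (ExD l1 (L1_cst _ B)) !Ex_cst.
by move/addIr.
Qed.

End normal_scale.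

(** * The asymptotic variance *)

Section asymptotic_variance.
Context {R : realType} {d : nat}.
Variables (mu nu : 'cV[R]_d) (Sigma Xi : 'M[R]_d).
Hypotheses (pS : psdmx Sigma) (pX : psdmx Xi)
  (uS : Sigma \in unitmx) (uX : Xi \in unitmx).
Let S := sqrtmx Sigma.
Let K := sqrtmx (S *m Xi *m S).
Let T := otmap Sigma Xi.

Lemma influence_var_ge0 (a b : 'cV[R]_d) (M N : 'M[R]_d) : psdmx M -> psdmx N ->
  0 <= influence_var a b M N.
Proof.
move=> pM pN; have [_ _ _ <-] := influence_centred a b pM pN.
by apply: Ex_ge0 => x; exact: sqr_ge0.
Qed.

(** Both terms of the variance are nonnegative. If they vanish, coercivity of [Sigma] gives mu = nu,
    and the trace term gives T = 1, so that T Sigma T = Xi reads Sigma = Xi. A positive variance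
    makes the limit a normal law to which [Ex_normal_scale] applies. *)
Lemma influence_var_gt0 : ~ (mu = nu /\ Sigma = Xi) -> 0 < influence_var mu nu Sigma T.
Proof.
move=> neq; have pT : psdmx T by exact: otmap_psd.
rewrite lt_neqAle influence_var_ge0// andbT eq_sym; apply/eqP => v0; apply: neq.
have [c c0 cS] := psdmx_coercive pS uS.
have uR := sqrtmx_unit pS uS; rewrite -/S in uR.
have Ss : S^T = S by exact: sqrtmx_sym.
have SS : S *m S = Sigma by exact: sqrtmx_sqr.
have [A AE] : exists A : 'M[R]_d, A = 1%:M - T by eexists.
have AT : A^T = A by rewrite AE [(_ - _)^T]linearB/= trmx1 pT.1.
have q0 : 0 <= dot (2 *: (mu - nu)) (Sigma *m (2 *: (mu - nu))).
  by move/psdmxP: pS => [_]; apply.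
have t0 : \tr (A *m Sigma *m (A *m Sigma)) = \tr ((A *m S)^T *m Sigma *m (A *m S)).
  by rewrite trmx_mul Ss AT [RHS]mxtrace_mulC -SS !mulmxA.
have f0 := psdmx_mxtrace_conj (A *m S) pS; rewrite -t0 in f0.
move: v0; rewrite /influence_var -AE => v0.
have /dot_eq0 d0 : dot (2 *: (mu - nu)) (2 *: (mu - nu)) = 0.
  apply/le_anti; rewrite dot_ge0 andbT -(@ler_pM2l _ c)// mulr0.
  by apply: le_trans (cS _) _; lra.
have eqmn : mu = nu.
  apply/eqP; rewrite -subr_eq0; apply/eqP.
  by move: d0 => /eqP; rewrite scaler_eq0 pnatr_eq0/= => /eqP.
split => //.
have fr0 : \tr (A *m Sigma *m (A *m Sigma)) = 0 by lra.
rewrite t0 in fr0; have := psdmx_trace_ker pS fr0.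
move=> /(congr1 (mulmx (invmx Sigma))); rewrite mulKmx// mulmx0.
move=> /(congr1 (mulmx^~ (invmx S))); rewrite mulmxK// mul0mx AE => /eqP.
rewrite subr_eq0 => /eqP T1.
by have := otmap_sandwich pS pX uS; rewrite -/T -T1 mul1mx mulmx1.
Qed.

Lemma eigen_mxtrace (M A : 'M[R]_d) (l : 'I_d -> R) (q : 'I_d -> 'cV[R]_d) :
  psdmx A -> eigendecomp A l q ->
  \sum_k Num.sqrt (l k) * dot (q k) (M *m q k) = \tr (sqrtmx A *m M).
Proof.
move=> pA eA; have [V [VV AE qE]] := eigendecompE eA.
have l0 : forall i, 0 <= l i by apply: (psdmx_conjD_ge0 VV); rewrite -AE.
rewrite AE sqrtmx_conjD// conjD_sum mulmx_suml raddf_sum/=.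
apply: eq_bigr => k _; rewrite -qE -scalemxAl mxtraceZ; congr (_ * _).
by rewrite dotC dot_tr mxtrace_mulC mulmxA mxtrace_mulC -mulmxA.
Qed.

Lemma eigen_form (A : 'M[R]_d) (l : 'I_d -> R) (q : 'I_d -> 'cV[R]_d) (x y : 'cV[R]_d) :
  psdmx A -> eigendecomp A l q ->
  \sum_k Num.sqrt (l k) * (dot (q k) x * dot (q k) y) = dot x (sqrtmx A *m y).
Proof.
move=> pA eA; have [V [VV AE qE]] := eigendecompE eA.
have l0 : forall i, 0 <= l i by apply: (psdmx_conjD_ge0 VV); rewrite -AE.
rewrite AE sqrtmx_conjD// conjD_sum mulmx_suml dot_sumr.
apply: eq_bigr => k _; rewrite -qE -scalemxAl dotZr -mulmxA trmx_mulmx mul_mx_scalar dotZr.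
by rewrite (dotC x) [_ * dot (q k) y]mulrC.
Qed.

(** By cyclicity the traces of T Sigma Sigma and T^-1 Xi Xi are those of K Sigma and K S^-1 Xi S,
    which form the sum over k. The traces of the squares of T Sigma and T^-1 Xi both equal tr(Sigma
    Xi); their weights 1 - a and a add up to the coefficient of that term, which is free of a. *)
Lemma varpi2_influence a kappa q lambda p :
  eigendecomp (S *m Xi *m S) kappa q ->
  (forall i j, j != i -> lambda i = lambda j -> dot (p i) (K *m p j) = 0) ->
  varpi2 a mu nu Sigma Xi kappa q lambda p =
  (1 - a) * influence_var mu nu Sigma T + a * influence_var nu mu Xi (invmx T).
Proof.
move=> eq hp; have pM : psdmx (S *m Xi *m S) by exact: psdmx_sandwich.
have uR := sqrtmx_unit pS uS; rewrite -/S in uR.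
have uT : T \in unitmx by exact: otmap_unit.
have pT : psdmx T by exact: otmap_psd.
have SS : S *m S = Sigma by exact: sqrtmx_sqr.
have Ss : S^T = S by exact: sqrtmx_sym.
have TST : T *m Sigma *m T = Xi by exact: otmap_sandwich.
have TM : T *m Sigma = invmx S *m K *m S by exact: otmapM.
have Ks : K^T = K by exact: sqrtmx_sym.
have t1 : \tr (T *m Sigma *m Sigma) = \tr (K *m Sigma).
  have SiS : S *m Sigma *m invmx S = Sigma.
    by rewrite -SS mulmxA mulmxK.
  by rewrite TM -!mulmxA mxtrace_mulC -!mulmxA (mulmxA S Sigma) SiS.
have t2 : \tr (invmx T *m Xi *m Xi) = \tr (K *m (invmx S *m Xi *m S)).
  have -> : invmx T *m Xi = S *m K *m invmx S.
    have -> : invmx T *m Xi = (T *m Sigma)^T.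
      by rewrite trmx_mul pT.1 pS.1 -[X in _ *m X = _]TST -mulmxA mulKmx.
    by rewrite TM !trmx_mul trmx_inv Ss Ks mulmxA.
  by rewrite -!mulmxA mxtrace_mulC !mulmxA.
have t3 : \tr (T *m Sigma *m (T *m Sigma)) = \tr (Sigma *m Xi).
  by rewrite mulmxA TST mxtrace_mulC.
have t4 : \tr (invmx T *m Xi *m (invmx T *m Xi)) = \tr (Sigma *m Xi).
  by rewrite mulmxA otmap_inv_sandwich.
have vE (b c : 'cV[R]_d) (M N : 'M[R]_d) : influence_var b c M N =
   4 * dot (b - c) (M *m (b - c)) +
   2 * (\tr (M *m M) - 2 * \tr (N *m M *m M) + \tr (N *m M *m (N *m M))).
  rewrite /influence_var -scalemxAr dotZr dotZl mulmxBl mul1mx mulmxBl !mulmxBr !mxtraceB.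
  rewrite (mxtrace_mulC M (N *m M)); ring.
have -> : varpi2 a mu nu Sigma Xi kappa q lambda p =
    4 * dot (nu - mu) (((1 - a) *: Sigma + a *: Xi) *m (nu - mu))
    + 2 * \tr ((1 - a) *: (Sigma *m Sigma) + a *: (Xi *m Xi))
    + 2 * \tr (Sigma *m Xi)
    - 4 * (\sum_k Num.sqrt (kappa k) *
        dot (q k) (((1 - a) *: Sigma + a *: (invmx S *m Xi *m S)) *m q k))
    - 2 * (1 - a) * (\sum_k \sum_l Num.sqrt (kappa l) * Num.sqrt (kappa k) *
        \sum_i \sum_(j | (j != i) && (lambda i == lambda j))
          dot (q l) (p i) * dot (p i) (q k) * dot (q l) (p j) * dot (p j) (q k)) by [].
rewrite (eigen_mxtrace _ pM eq) -/K.
rewrite [X in _ - 2 * (1 - a) * X](_ : _ = 0); last first.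
  apply: big1 => k _; under eq_bigr do rewrite mulr_sumr.
  rewrite exchange_big/=; apply: big1 => i _.
  under eq_bigr do rewrite mulr_sumr.
  rewrite exchange_big/=; apply: big1 => j /andP[ji /eqP lij].
  (* For fixed i, j and k the sum over l is the bilinear form of K at p i and p j, assumed to vanish
     on pairs from one eigenspace. *)
  transitivity (\sum_l Num.sqrt (kappa k) * dot (p i) (q k) * dot (p j) (q k) *
      (Num.sqrt (kappa l) * (dot (q l) (p i) * dot (q l) (p j)))).
    by apply: eq_bigr => l _; ring.
  by rewrite -mulr_sumr (eigen_form _ _ pM eq) hp// mulr0.
rewrite !vE t1 t2 t3 t4; have -> : nu - mu = - (mu - nu) by rewrite opprB.
move: (mu - nu) => e; rewrite mulmxDl -!scalemxAl !mulmxN !dotNl !dotDr !dotZr !dotNr.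
rewrite mulmxDr -!scalemxAr !mxtraceD !mxtraceZ.
ring.
Qed.

(* The last sum in the variance vanishes in a basis of eigenvectors of [Sigma] that
   diagonalises the compression of [M] to each eigenspace of [Sigma]. *)
Lemma block_diagonal_basis (M : 'M[R]_d) (lambda : 'I_d -> R) (p0 : 'I_d -> 'cV[R]_d) :
  M^T = M -> eigendecomp Sigma lambda p0 ->
  exists p, [/\ eigendecomp Sigma lambda p,
    forall i, (forall j, j != i -> lambda j != lambda i) -> p i = p0 i &
    forall i j, j != i -> lambda i = lambda j -> dot (p i) (M *m p j) = 0].
Proof.
move=> MT e0; have [V0 [VV0 SE pE]] := eigendecompE e0.
have [K0 K0E] : exists K0, K0 = V0^T *m M *m V0 by eexists.
have K0T : K0^T = K0 by rewrite K0E !trmx_mul trmxK MT mulmxA.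
(* The diagonal blocks of M in the basis p0, one per eigenspace. Coloured by [lambda], a
   diagonalising V1 preserves the eigenspaces of [Sigma], so the new basis still consists of
   eigenvectors for the same [lambda]. *)
pose B := \matrix_(i, j) (if lambda i == lambda j then K0 i j else 0).
have BT : B^T = B.
  by apply/matrixP => i j; rewrite !mxE eq_sym -{1}K0T mxE.
have cB : coloured lambda B by move=> i j; rewrite mxE => /negbTE ->.
have [V1 [D [VV1 cV1 BD]]] := coloured_spectral BT cB.
have [W WE] : exists W, W = V0 *m V1 by eexists.
have WW : W^T *m W = 1%:M.
  by rewrite WE trmx_mul mulmxA -(mulmxA V1^T) VV0 mulmx1.
have dotcol i j : dot (col i W) (M *m col j W) = (V1^T *m K0 *m V1) i j.
  have colWE k : col k W = W *m delta_mx k 0 by rewrite colE.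
  rewrite (colWE i) (colWE j) dotC dot_trmx dotC dot_delta.
  by rewrite WE K0E trmx_mul !mulmxA -colE mxE.
have offdiag i j : i != j -> lambda i = lambda j -> (V1^T *m K0 *m V1) i j = 0.
  move=> ij lij; transitivity ((V1^T *m B *m V1) i j); last first.
    by rewrite BD mxE (negbTE ij) mulr0n.
  rewrite !mxE; apply: eq_bigr => k _; rewrite !mxE.
  have [lkj|lkj] := eqVneq (lambda k) (lambda j); last by rewrite cV1// !mulr0.
  congr (_ * _); apply: eq_bigr => l _; rewrite !mxE.
  have [lli|lli] := eqVneq (lambda l) (lambda i); last by rewrite cV1// !mul0r.
  by rewrite lli lij lkj eqxx.
pose simple i := [forall j, (j != i) ==> (lambda j != lambda i)].
have simple0 i : simple i -> forall k, k != i -> V1 k i = 0.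
  by move=> /forallP si k ki; apply: cV1; move: (si k); rewrite ki.
(* On a simple eigenvalue V1 acts as a sign; multiplying by that sign restores p0 i exactly. *)
pose s i := if simple i then V1 i i else 1.
have ss i : s i * s i = 1.
  rewrite /s; case: ifP => [si|_]; last exact: mulr1.
  have := congr1 (fun M : 'M[R]_d => M i i) VV1; rewrite !mxE eqxx.
  rewrite (bigD1 i)//= big1 ?addr0 ?mxE// => k ki.
  by rewrite (simple0 _ si _ ki) mulr0.
have SW : Sigma = conjD W lambda.
  have comm : diag_mx (\row_i lambda i) *m V1 = V1 *m diag_mx (\row_i lambda i).
    apply/matrixP => i j; rewrite mul_diag_mx mul_mx_diag !mxE.
    by have [->|/cV1 ->] := eqVneq (lambda i) (lambda j); rewrite ?mulr0 ?mul0r// mulrC.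
  rewrite SE /conjD WE trmx_mul -!mulmxA; congr (_ *m _).
  by rewrite [RHS]mulmxA -comm -mulmxA (mulmxA V1) (mulmx1C VV1) mul1mx.
have [eW oW] := conjD_eigendecomp lambda WW; rewrite -SW in eW.
exists (fun i => s i *: col i W); split.
- split=> [i|i j]; first by rewrite -scalemxAr eW scalerA mulrC -scalerA.
  rewrite -/(dot _ _) dotZl dotZr [dot _ _]oW.
  by have [->|_] := eqVneq i j; rewrite ?mulr1 ?ss// !mulr0.
- move=> i hi; have si : simple i by apply/forallP => j; apply/implyP; exact: hi.
  have -> : col i W = s i *: p0 i.
    rewrite pE WE /s si; apply/colP => k; rewrite !mxE (bigD1 i)//= big1 ?addr0 => [|l li].
      by rewrite mulrC.
    by rewrite (simple0 _ si _ li) mulr0.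
  by rewrite scalerA ss scale1r.
- move=> i j ji lij; rewrite -scalemxAr dotZl dotZr dotcol offdiag ?mulr0//.
  by rewrite eq_sym.
Qed.

End asymptotic_variance.

Section gelbrich_limit.
Context {R : realType} {d : nat}.
Local Notation mR := (measurableTypeR R).
Local Notation gamma := (@normal_prob R 0 1 : probability mR R).
Variables (mu nu : 'cV[R]_d) (Sigma Xi : 'M[R]_d).
Hypotheses (pS : psdmx Sigma) (pX : psdmx Xi)
  (uS : Sigma \in unitmx) (uX : Xi \in unitmx).
Variables (a : R) (m : nat -> nat).
Hypotheses (a01 : 0 < a < 1)
  (cm : (n%:R / (m n)%:R : R) @[n --> \oo] --> a / (1 - a)).
Let T := otmap Sigma Xi.
Let vX := influence_var mu nu Sigma T.
Let vY := influence_var nu mu Xi (invmx T).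

Definition scaling n : R := Num.sqrt ((m n * n)%:R / (m n + n)%:R).

(** With rho = n/m, the two ratios are 1 / (1 + rho) and rho / (1 + rho). These expressions converge
    without any condition on the sample sizes, and agree with the ratios for large n. *)
Lemma scaling_limit : exists A B : nat -> R,
  [/\ A n @[n --> \oo] --> 1 - a, B n @[n --> \oo] --> a &
    \forall n \near \oo, [/\ (0 < n)%N, (0 < m n)%N,
      scaling n ^+ 2 / n%:R = A n & scaling n ^+ 2 / (m n)%:R = B n]].
Proof.
have [a0 a1] := andP a01.
pose rho n : R := n%:R / (m n)%:R.
have al0 : 0 < a / (1 - a) by rewrite divr_gt0// subr_gt0.
have b0 : 1 - a != 0 by rewrite gt_eqF// subr_gt0.
have alE : (1 + a / (1 - a))^-1 = 1 - a.
  have -> : 1 + a / (1 - a) = (1 - a)^-1 by field; rewrite b0.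
  exact: invrK.
have cA : (1 + rho n)^-1 @[n --> \oo] --> 1 - a.
  rewrite -[X in _ --> X]alE; apply: cvgV; first by rewrite gt_eqF// ltr_wpDl.
  by apply: cvgD => //; exact: cvg_cst.
exists (fun n => (1 + rho n)^-1), (fun n => rho n * (1 + rho n)^-1); split => //.
  rewrite [X in _ --> X](_ : a = a / (1 - a) * (1 - a)); last by rewrite divfK.
  exact: cvgM.
(* The radius is the limit itself, so rho is eventually positive; this excludes an empty sample, for
   which the quotient would be 0 by convention. *)
have /cvgrPdist_lt/(_ _ al0) := cm; apply: filterS => n.
rewrite ltr_norml => /andP[_ h].
have r0 : 0 < rho n by rewrite /rho; lra.
have m0 : (0 < m n)%N.
  by rewrite lt0n; apply/eqP => m0; move: r0; rewrite /rho m0 invr0 mulr0 ltxx.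
have n0 : (0 < n)%N.
  by rewrite lt0n; apply/eqP => n0; move: r0; rewrite /rho n0 mul0r ltxx.
have nn : n%:R != 0 :> R by rewrite pnatr_eq0 -lt0n.
have mm : (m n)%:R != 0 :> R by rewrite pnatr_eq0 -lt0n.
have mn : (m n)%:R + n%:R != 0 :> R by rewrite -natrD pnatr_eq0 -lt0n addn_gt0 m0.
split=> //; rewrite /scaling sqr_sqrtr ?divr_ge0// /rho natrM natrD.
  by field; rewrite nn mm mn.
by field; rewrite mm mn.
Qed.

(** Three errors of e/3: the fixed eps of [gelbrich_clt_lipschitz], its term K / s, and the
    replacement of the deviation at step n by its limit. *)
Lemma gelbrich_limit (G : R -> R) (B L : R) :
  (forall x, `|G x| <= B) -> 0 <= L -> lipschitz_cst L G ->
  Ex (prodP (ptuple (gauss mu Sigma) n) (ptuple (gauss nu Xi) (m n)))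
    (fun z => G (scaling n * (gstat z - gelbrich mu nu Sigma Xi))) @[n --> \oo] -->
  Ex gamma (fun z => G (Num.sqrt ((1 - a) * vX + a * vY) * z)).
Proof.
move=> GB L0 GL; have [a0 a1] := andP a01.
have mG := lipschitz_measurable L0 GL.
have [A [B' [cA cB nE]]] := scaling_limit.
pose kappa := Ex gamma (fun z => `|z|).
have kappa0 : 0 <= kappa by apply: Ex_ge0 => z; exact: normr_ge0.
have lz : L1 gamma (fun z : mR => `|z|).
  exact: (L1_norm (gamma_L1_pow (isT : (1 <= 6)%N))).
set sigma := Num.sqrt _.
have ctau : Num.sqrt (A n * vX + B' n * vY) @[n --> \oo] --> sigma.
  apply: (@cvg_comp _ _ _ (fun n => A n * vX + B' n * vY) (@Num.sqrt R)); last first.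
    exact: sqrt_continuous.
  by apply: cvgD; apply: cvgM => //; exact: cvg_cst.
apply/cvgrPdist_le => e e0.
have e3 : 0 < e / 3 by rewrite divr_gt0.
have [K K0 hK] := gelbrich_clt_lipschitz mu nu pS pX uS uX GB L0 GL e3.
pose e4 := e / (3 * (L * kappa + 1)).
have Lk0 : 0 <= L * kappa by rewrite mulr_ge0.
have e40 : 0 < e4 by rewrite divr_gt0// mulr_gt0// ltr_wpDl.
have /cvgrPdist_le/(_ _ e40) htau := ctau.
(* The second summand makes K / s at most e/3. The first gives s^2 >= 4, and as s^2 is at most n and
   m, both samples have at least two observations. *)
pose s0 := 2 + 3 * K / e.
have Ke : 0 <= 3 * K / e by rewrite divr_ge0 ?mulr_ge0// ltW.
have s00 : 2 <= s0 by rewrite lerDl.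
have a2 : 0 < (1 - a) / 2 by rewrite divr_gt0// subr_gt0.
have /cvgrPdist_le/(_ _ a2) hA := cA.
near=> n.
have [n0 m0 An Bn] : [/\ (0 < n)%N, (0 < m n)%N,
      scaling n ^+ 2 / n%:R = A n & scaling n ^+ 2 / (m n)%:R = B' n] by near: n.
have nn : 0 < n%:R :> R by rewrite ltr0n.
have mm : 0 < (m n)%:R :> R by rewrite ltr0n.
have Age : (1 - a) / 2 <= A n.
  have : `|1 - a - A n| <= (1 - a) / 2 by near: n.
  by rewrite ler_norml => /andP[_]; lra.
have s2 : scaling n ^+ 2 = n%:R * A n by rewrite -An mulrC divfK// gt_eqF.
have sge0 : 0 <= scaling n by exact: sqrtr_ge0.
have sge : s0 <= scaling n.
  rewrite -(@ler_pXn2r _ 2)// ?nnegrE//; last by apply: le_trans s00.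
  rewrite s2; apply: (@le_trans _ _ (n%:R * ((1 - a) / 2))); last by rewrite ler_wpM2l.
  by rewrite -ler_pdivrMr//; near: n; exact: nbhs_infty_ger.
have sE : scaling n ^+ 2 = n%:R * (m n)%:R / (n%:R + (m n)%:R).
  by rewrite /scaling sqr_sqrtr ?divr_ge0// natrM natrD mulrC [_ * n%:R]mulrC [_ + n%:R]addrC mulrC.
have s4 : 4 <= scaling n ^+ 2 by nra.
have sn : scaling n ^+ 2 <= n%:R.
  by rewrite sE ler_pdivrMr ?addr_gt0// ler_pM2l// lerDr ltW.
have sm : scaling n ^+ 2 <= (m n)%:R.
  by rewrite sE ler_pdivrMr ?addr_gt0// mulrC ler_pM2l// lerDl ltW.
have n2 : (2 <= n)%N by rewrite -(ler_nat R); lra.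
have m2 : (2 <= m n)%N by rewrite -(ler_nat R); lra.
have sgt : 0 < scaling n by lra.
have s1 : 1 <= scaling n by lra.
have := hK (scaling n) n (m n) n2 m2 s1 sE.
rewrite -/T -/vX -/vY An Bn; set tau := Num.sqrt _.
have tausigma : `|sigma - tau| <= e4 by rewrite /tau; near: n.
have Kn : K / scaling n <= e / 3.
  rewrite ler_pdivrMr//; apply: (@le_trans _ _ (e / 3 * s0)); last by rewrite ler_wpM2l// ltW.
  rewrite /s0 mulrDr; have -> : e / 3 * (3 * K / e) = K by field; rewrite gt_eqF.
  by rewrite lerDr mulr_ge0// ltW.
have mlin (t : R) : measurable_fun setT (fun z : mR => t * z) by exact: measurable_funM.
have lG (t : R) : L1 gamma (fun z => G (t * z)).
  by apply: (L1_bounded _ (measurableT_comp mG (mlin t)) (k := B)) => z; exact: GB.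
have Lip : `|Ex gamma (fun z => G (sigma * z)) - Ex gamma (fun z => G (tau * z))| <= e / 3.
  rewrite -ExB//; apply: le_trans (Ex_norm (L1B (lG _) (lG _))) _.
  apply: (@le_trans _ _ (Ex gamma (fun z => L * e4 * `|z|))).
    apply: Ex_le; [exact/L1_norm/L1B|exact: L1Z|].
    move=> z; apply: le_trans (GL _ _) _; rewrite -mulrBl normrM mulrA.
    by rewrite ler_wpM2r// ler_wpM2l.
  rewrite ExZ// -/kappa.
  have -> : L * e4 * kappa = e / 3 * (L * kappa / (L * kappa + 1)).
    by rewrite /e4; field; rewrite gt_eqF// ltr_wpDl.
  by rewrite ler_piMr ?(ltW e3)// ler_pdivrMr ?ltr_wpDl// mul1r lerDl.
set E := Ex (prodP _ _) _.
move: Lip; rewrite !ler_norml => /andP[b1 b2] /andP[c1 c2].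
apply/andP; split; lra.
Unshelve. all: by end_near. Qed.

End gelbrich_limit.

(* If Sigma has a multiple eigenvalue, its eigendecomposition is not unique and
   the last sum of varpi2 depends on it, whereas the limit law does not: p is p0
   up to the choice of the basis of the eigenspaces of dimension at least 2. *)
Theorem theorem2p2 (R : realType) (d : nat)
    (mu nu : 'cV[R]_d) (Sigma Xi : 'M[R]_d) (a : R) (m : nat -> nat)
    (dT : nat -> measure_display) (T : forall n, measurableType (dT n))
    (Pr : forall n, probability (T n) R)
    (X : forall n, 'I_n -> {RV (Pr n) >-> 'cV[R]_d})
    (Y : forall n, 'I_(m n) -> {RV (Pr n) >-> 'cV[R]_d})
    (kappa : 'I_d -> R) (q : 'I_d -> 'cV[R]_d)
    (lambda : 'I_d -> R) (p0 : 'I_d -> 'cV[R]_d) :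
  psdmx Sigma -> psdmx Xi -> \rank Sigma = d -> \rank Xi = d ->
  ~ measure_eq (gauss mu Sigma) (gauss nu Xi) ->
  0 < a < 1 ->
  (n%:R / (m n)%:R : R) @[n --> \oo] --> a / (1 - a) ->
  (forall n, iid (@X n) (gauss mu Sigma)) ->
  (forall n, iid (@Y n) (gauss nu Xi)) ->
  (forall n, independent_samples (Pr n) (@X n) (@Y n)) ->
  eigendecomp (sqrtmx Sigma *m Xi *m sqrtmx Sigma) kappa q ->
  eigendecomp Sigma lambda p0 ->
  let GWhat n w :=
    fine (W2sq (gauss (smean (@X n ^~ w)) (scov (@X n ^~ w)))
               (gauss (smean (@Y n ^~ w)) (scov (@Y n ^~ w)))) in
  let GW := fine (W2sq (gauss mu Sigma) (gauss nu Xi)) in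
  exists p : 'I_d -> 'cV[R]_d,
    [/\ eigendecomp Sigma lambda p,
        forall i, (forall j, j != i -> lambda j != lambda i) -> p i = p0 i
      & cvg_in_law Pr
          (fun n w => Num.sqrt ((m n * n)%:R / (m n + n)%:R) * (GWhat n w - GW))
          (normal_prob 0
            (Num.sqrt (varpi2 a mu nu Sigma Xi kappa q lambda p)))].
Proof.
move=> pS pX rS rX neq a01 cm iX iY indep eK e0 GWhat GW.
have uS : Sigma \in unitmx by rewrite -row_free_unit /row_free rS.
have uX : Xi \in unitmx by rewrite -row_free_unit /row_free rX.
have KT : (sqrtmx (sqrtmx Sigma *m Xi *m sqrtmx Sigma))^T =
    sqrtmx (sqrtmx Sigma *m Xi *m sqrtmx Sigma).
  by apply: sqrtmx_sym; exact: psdmx_sandwich.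
have [p [ep pp0 offdiag]] := block_diagonal_basis KT e0.
exists p; split => //.
rewrite (varpi2_influence mu nu pS pX uS uX a eK offdiag).
set vX := influence_var mu nu _ _; set vY := influence_var nu mu _ _.
have [a0 a1] := andP a01.
have vX0 : 0 < vX.
  by apply: influence_var_gt0 => // -[eqmn eqSX]; apply: neq; rewrite eqmn eqSX => A mA.
have vY0 : 0 <= vY.
  by apply: influence_var_ge0 => //; apply: psdmx_invmx; exact: otmap_psd.
have sigma0 : 0 < Num.sqrt ((1 - a) * vX + a * vY).
  rewrite sqrtr_gt0; apply: ltr_wpDr; first by apply: mulr_ge0 => //; exact: ltW.
  by apply: mulr_gt0 => //; rewrite subr_gt0.
set sigma := Num.sqrt _ in sigma0 *.
pose W n := two_samples (@X n) (@Y n).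
pose h n (z : n.-tuple 'cV[R]_d * (m n).-tuple 'cV[R]_d) :=
  scaling m n * (gstat z - gelbrich mu nu Sigma Xi).
have mh n : measurable_fun setT (h n).
  by apply: measurable_funM => //; apply: measurable_funB => //; exact: measurable_gstat.
have GWE : GW = gelbrich mu nu Sigma Xi.
  by rewrite /GW (W2sq_gauss mu nu pS pX).
have tupE n k (V : 'I_k -> {RV (Pr n) >-> 'cV[R]_d}) w :
    (fun i => V i w) = tnth (sample_tup V w).
  by apply/funext => i; rewrite tnth_mktuple.
have GWhatE n w : GWhat n w = gstat (W n w).
  rewrite /gstat /W /two_samples -(tupE n n) -(tupE n (m n)).
  by rewrite /GWhat (W2sq_gauss _ _ (psdmx_scov _) (psdmx_scov _)).
have ZE n w : Num.sqrt ((m n * n)%:R / (m n + n)%:R) * (GWhat n w - GW) = h n (W n w).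
  by rewrite GWE GWhatE.
have mW n : measurable_fun setT (W n) by exact: measurable_two_samples.
have mZ n : measurable_fun setT (fun w => h n (W n w)).
  exact: measurableT_comp (mh n) (mW n).
split=> [n|f cf [M [Mr fM]]]; first by under eq_fun do rewrite ZE; exact: mZ.
(* [bounded_fun] provides a bound for each number strictly above M. *)
pose B := `|M| + 1.
have fB x : `|f x| <= B.
  apply: (fM B) => //; rewrite /B; apply: le_lt_trans (ler_norm M) _.
  by rewrite ltrDl.
have mf : measurable_fun setT (f : measurableTypeR R -> R).
  exact: continuous_measurable_fun.
have lf n : L1 (Pr n) (fun w => f (h n (W n w))).
  by apply: (L1_bounded _ (measurableT_comp mf (mZ n)) (k := B)) => w; exact: fB.
have lN : L1 (normal_prob 0 sigma : probability (measurableTypeR R) R) f.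
  exact: L1_bounded mf fB.
rewrite (L1_fin lN) (Ex_normal_scale sigma0 mf fB).
have -> : (fun n => \int[Pr n]_w
      (f (Num.sqrt ((m n * n)%:R / (m n + n)%:R) * (GWhat n w - GW)))%:E)%E =
    (fun n => (Ex (Pr n) (fun w => f (h n (W n w))))%:E).
  by apply/funext => n; under eq_integral do rewrite ZE; exact: L1_fin.
apply: cvg_EFin; first exact: nearW.
have ms : measurable_fun setT (fun z : measurableTypeR R => sigma * z).
  exact: measurable_funM.
apply: (portmanteau mZ ms _ cf fB) => G B' L GB L0 GL.
have := @gelbrich_limit _ _ mu nu _ _ pS pX uS uX a m a01 cm G B' L GB L0 GL.
apply: cvg_trans; apply: near_eq_cvg; apply: nearW => n.
have mG : measurable_fun setT (G : measurableTypeR R -> R) := lipschitz_measurable L0 GL.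
have mGh : measurable_fun setT (fun z => G (h n z)) by exact: measurableT_comp mG (mh n).
have lG : L1 (Pr n) (fun w => G (h n (W n w))).
  by apply: (L1_bounded _ (measurableT_comp mG (mZ n)) (k := B')) => w; exact: GB.
(* The expectation under the product law, where [gelbrich_limit] lives, is turned into one under the
   joint law of the given samples. *)
rewrite -(Ex_eq _ (two_samples_law (iX n) (iY n) (indep n))).
exact: (Ex_law mGh lG).
Qed.
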